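(* Let $G$, $G'$ be finite groups and let $B$, $B'$ be blocks of $\mathcal{O}G$, $\mathcal{O}G'$, respectively. Assume that $K$ contains a primitive root of unity of order divisible by $|G|$ and $|G'|$. Let $M$ be an indecomposable $B'$-$B$-bimodule inducing a stable equivalence of Morita type and having an endopermutation module $V$ as a source when regarded as an $\mathcal{O}(G'\times G)$-module. Assume that the character of $V$ has values in $\mathbb{Z}$. Denote by $\Phi_M:\mathbb{Z}\mathrm{Irr}(B)\to\mathbb{Z}\mathrm{Irr}(B')$ the group homomorphism induced by the functor $M\otimes_B-$. Then, for any $\psi\in\mathbb{Z}\mathrm{Irr}(B)$ we have $$c(\Phi_M(\psi))_p=c(\psi)_p.$$ Suppose moreover that there is an isometry $\Phi:\mathbb{Z}\mathrm{Irr}(B)\cong\mathbb{Z}\mathrm{Irr}(B')$ which extends the isometry $L^0(B)\cong L^0(B')$ induced by $M\otimes_B-$. Then for any $\chi\in\mathrm{Irr}(B)$ we have $$c(\Phi(\chi))_p=c(\chi)_p.$$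
   Context: Let $p$ be a prime, $\mathcal{O}$ a complete discrete valuation ring with residue field $k$ of characteristic $p$ and field of fractions $K$ of characteristic $0$. For a positive integer $n$, $\zeta_n$ denotes a primitive $n$-th root of unity in an extension field of $K$. For a block $B$ of $\mathcal{O}G$, $\mathrm{Irr}(B)$ is the set of $K$-valued irreducible characters of $G$ belonging to $B$, and $\mathbb{Z}\mathrm{Irr}(B)$ the group of generalised characters they generate. $L^0(B)$ is the subgroup of $\mathbb{Z}\mathrm{Irr}(B)$ of generalised characters which vanish on all elements of $G$ of order prime to $p$. A $B'$-$B$-bimodule $M$ is viewed as an $\mathcal{O}(G'\times G)$-module via $(x,y)\cdot m=xmy^{-1}$. It induces a stable equivalence of Morita type if it is finitely generated projective as a left $B'$-module and as a right $B$-module, and with $M^*=\mathrm{Hom}_{\mathcal{O}}(M,\mathcal{O})$ there are bimodule isomorphisms $M\otimes_BM^*\cong B'\oplus X'$ and $M^*\otimes_{B'}M\cong B\oplus X$ with $X'$ a projective $B'$-$B'$-bimodule and $X$ a projective $B$-$B$-bimodule. It is well known that in that case $\Phi_M$ restricts to an isometry $L^0(B)\cong L^0(B')$. Here $\Phi_M$ sends the character of an $\mathcal{O}$-free finitely generated $B$-module $U$ to the character of $M\otimes_BU$. An isometry is a group isomorphism preserving the standard scalar products of characters. An endopermutation module over a finite $p$-group $P$ is a finitely generated $\mathcal{O}$-free $\mathcal{O}P$-module $V$ such that $\mathrm{End}_{\mathcal{O}}(V)$ is a permutation $\mathcal{O}P$-module for the conjugation action of $P$. For a set $S$ of cyclotomic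 integers, $c(S)$ is the smallest positive integer $n$ with $S\subseteq\mathbb{Q}(\zeta_n)$. For a generalised character $\chi$ of $G$, $c(\chi)=c(\{\chi(g)\mid g\in G\})$, and $c(\chi)_p$ is the highest power of $p$ dividing $c(\chi)$. *)

(* Defs.v *)
From HB Require Import structures.
From mathcomp Require Import all_boot all_order all_algebra.
From mathcomp Require Import all_fingroup all_solvable all_field.
From mathcomp Require Import mxrepresentation fraction.
From mathcomp Require Import boolp classical_sets functions.

Set Implicit Arguments.
Unset Strict Implicit.
Unset Printing Implicit Defensive.

Import GRing.Theory.
Local Open Scope ring_scope.

Definition is_ideal (R : comNzRingType) (I : R -> Prop) :=
  [/\ I 0, forall x y, I x -> I y -> I (x + y) & forall a x, I x -> I (a * x)].

Definition principal_ideal_ring (R : comNzRingType) :=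
  forall I : R -> Prop, is_ideal I ->
    exists a, forall x, I x <-> exists c, x = c * a.

(* The nonunits form the ideal (pi): the ring is local with maximal ideal     *)
(* (pi), and it is not a field because pi != 0.                               *)
Definition uniformizer (R : idomainType) (pi : R) :=
  pi != 0 /\
  forall x : R, x \isn't a GRing.unit <-> exists c, x = c * pi.

Definition adic_cauchy (R : idomainType) (pi : R) (u : nat -> R) :=
  forall n, exists N, forall i j, (N <= i)%N -> (N <= j)%N ->
    exists c, u i - u j = c * pi ^+ n.

Definition adic_limit (R : idomainType) (pi : R) (u : nat -> R) (l : R) :=
  forall n, exists N, forall i, (N <= i)%N -> exists c, u i - l = c * pi ^+ n.

Definition complete_dvr (R : idomainType) :=
  principal_ideal_ring R /\
  exists2 pi : R, uniformizer pi &
    forall u, adic_cauchy pi u -> exists l, adic_limit pi u l.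

Definition galg (R : comNzRingType) (gT : finGroupType) := {ffun gT -> R^o}.

Section GroupAlgebra.
Variables (R : comNzRingType) (gT : finGroupType).
Local Notation A := (galg R gT).

HB.instance Definition _ := GRing.Lmodule.on A.

Definition gelt (x : gT) : A := [ffun y => (y == x)%:R].

Definition galg_mul (a c : A) : A :=
  [ffun z => \sum_x (a x : R) * c (x^-1 * z)%g].

Fact galg_mulA : associative galg_mul.
Proof.
move=> a c d; apply/ffunP => z; rewrite !ffunE.
under eq_bigr do rewrite ffunE mulr_sumr.
under [RHS]eq_bigr do rewrite ffunE mulr_suml.
rewrite [RHS]exchange_big /=; apply: eq_bigr => x _.
rewrite (reindex_inj (mulgI x^-1)%g) /=; apply: eq_bigr => y _.
by rewrite mulrA invMg invgK -!mulgA !mulKVg.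
Qed.

Fact galg_mul1 : left_id (gelt 1) galg_mul.
Proof.
move=> a; apply/ffunP => z; rewrite ffunE (bigD1 1%g) //= ffunE eqxx mul1r.
rewrite invg1 mul1g big1 ?addr0 // => x /negbTE x1.
by rewrite ffunE x1 mul0r.
Qed.

Fact galg_mulr1 : right_id (gelt 1) galg_mul.
Proof.
move=> a; apply/ffunP => z; rewrite ffunE (bigD1 z) //= ffunE mulVg eqxx mulr1.
rewrite big1 ?addr0 // => x xz; rewrite ffunE -eq_mulVg1 (negbTE xz) mulr0 //.
Qed.

Fact galg_mulDl : left_distributive galg_mul +%R.
Proof.
move=> a c d; apply/ffunP => z; rewrite !ffunE -big_split /=.
by apply: eq_bigr => x _; rewrite ffunE mulrDl.
Qed.

Fact galg_mulDr : right_distributive galg_mul +%R.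
Proof.
move=> a c d; apply/ffunP => z; rewrite !ffunE -big_split /=.
by apply: eq_bigr => x _; rewrite ffunE mulrDr.
Qed.

Fact galg_1neq0 : gelt 1 != 0.
Proof.
by apply/eqP => /ffunP/(_ 1%g); rewrite !ffunE eqxx => /eqP; rewrite oner_eq0.
Qed.

HB.instance Definition _ := GRing.Zmodule_isNzRing.Build A
  galg_mulA galg_mul1 galg_mulr1 galg_mulDl galg_mulDr galg_1neq0.

Fact galg_scaleAl (k : R) (a c : A) : k *: (a * c) = (k *: a) * c.
Proof.
apply/ffunP => z; rewrite !ffunE scaler_sumr; apply: eq_bigr => x _.
by rewrite ffunE; exact: mulrA.
Qed.

HB.instance Definition _ := GRing.Lmodule_isLalgebra.Build R A galg_scaleAl.

Fact galg_scaleAr (k : R) (a c : A) : k *: (a * c) = a * (k *: c).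
Proof.
apply/ffunP => z; rewrite !ffunE scaler_sumr; apply: eq_bigr => x _.
by rewrite ffunE; exact: mulrCA.
Qed.

HB.instance Definition _ := GRing.Lalgebra_isAlgebra.Build R A galg_scaleAr.

Definition antipode (a : A) : A := [ffun x => a x^-1%g].

Lemma geltM x y : gelt (x * y)%g = gelt x * gelt y.
Proof.
apply/ffunP => z; rewrite !ffunE (bigD1 x) //= !ffunE eqxx mul1r.
rewrite big1 ?addr0 => [|w /negbTE wx]; last by rewrite ffunE wx mul0r.
by rewrite -(inj_eq (mulgI x^-1%g)) mulKg; case: eqP.
Qed.

(* Blocks are the algebras RG b for b a primitive idempotent of Z(RG); they   *)
(* are represented by b.                                                      *)
Definition is_block_idempotent (b : A) :=
  [/\ b != 0, b * b = b, (forall a : A, a * b = b * a)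
    & forall e f : A, e * e = e -> f * f = f ->
        (forall a : A, a * e = e * a) -> (forall a : A, a * f = f * a) ->
        e * f = 0 -> b = e + f -> e = 0 \/ f = 0].

End GroupAlgebra.

Record block (R : comNzRingType) (gT : finGroupType) := Block {
  block_idem :> galg R gT;
  block_idemP : is_block_idempotent block_idem }.

Record gmod (R : comNzRingType) (gT : finGroupType) := GMod {
  gmod_car :> lmodType R;
  gmod_act : gT -> {linear gmod_car -> gmod_car};
  gmod_act1 : forall v, gmod_act 1%g v = v;
  gmod_actM : forall x y v, gmod_act (x * y)%g v = gmod_act x (gmod_act y v) }.

Section ModuleTheory.
Variables (R : comNzRingType) (gT : finGroupType).
Implicit Types (U V W : gmod R gT).

Definition galg_act V (a : galg R gT) (v : V) : V :=
  \sum_x a x *: gmod_act V x v.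

Definition gequivariant U V (f : U -> V) :=
  forall x u, f (gmod_act U x u) = gmod_act V x (f u).

Definition giso U V :=
  exists2 f : {linear U -> V}, gequivariant f & bijective f.

Definition gprod_act U V x (w : U * V) : U * V :=
  (gmod_act U x w.1, gmod_act V x w.2).

Fact gprod_act_linear U V x : linear (@gprod_act U V x).
Proof. by move=> k w w'; rewrite /gprod_act !linearP. Qed.

HB.instance Definition _ U V x :=
  GRing.isLinear.Build R (U * V)%type (U * V)%type _ (@gprod_act U V x)
    (@gprod_act_linear U V x).

Fact gprod_act1 U V (w : U * V) : gprod_act 1 w = w.
Proof. by case: w => u v; rewrite /gprod_act !gmod_act1. Qed.

Fact gprod_actM U V x y (w : U * V) :
  gprod_act (x * y) w = gprod_act x (gprod_act y w).
Proof. by rewrite /gprod_act !gmod_actM. Qed.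

Definition gprod U V : gmod R gT :=
  @GMod R gT (U * V)%type (fun x => @gprod_act U V x)
    (@gprod_act1 U V) (@gprod_actM U V).

Definition gsummand U V := exists W, giso V (gprod U W).

Definition gzero V := forall v : V, v = 0.

Definition indecomposable V :=
  ~ gzero V /\ forall U W, giso V (gprod U W) -> gzero U \/ gzero W.

Definition finitely_generated V :=
  exists n (w : 'I_n -> V), forall v, exists a : 'I_n -> galg R gT,
    v = \sum_i galg_act (a i) (w i).

(* For a central idempotent e, the RGe-modules are the RG-modules on which e  *)
(* acts as the identity.                                                      *)
Definition idem_module (e : galg R gT) V := forall v : V, galg_act e v = v.

Definition projective_in (C : gmod R gT -> Prop) W :=
  C W /\
  forall U V (f : {linear U -> V}) (g : {linear W -> V}), C U -> C V ->
    gequivariant f -> gequivariant g -> (forall v, exists u, f u = v) ->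
    exists2 h : {linear W -> U}, gequivariant h & forall w, f (h w) = g w.

Definition is_basis (V : lmodType R) n (e : 'I_n -> V) :=
  forall v, exists! a : {ffun 'I_n -> R}, v = \sum_i a i *: e i.

Definition is_lattice V := exists n (e : 'I_n -> V), is_basis e.

Definition permutation_module V :=
  exists n (e : 'I_n -> V), is_basis e /\
    forall x i, exists j, gmod_act V x (e i) = e j.

End ModuleTheory.

Section Pullback.
Variables (R : comNzRingType) (gT hT : finGroupType).
Variables (f : {morphism [set: hT] >-> gT}) (V : gmod R gT).

Fact gpull_act1 v : gmod_act V (f 1%g) v = v.
Proof. by rewrite morph1 gmod_act1. Qed.

Fact gpull_actM x y v :
  gmod_act V (f (x * y)%g) v = gmod_act V (f x) (gmod_act V (f y) v).
Proof. by rewrite morphM ?inE // gmod_actM. Qed.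

Definition gpull : gmod R hT :=
  @GMod R hT V (fun x => gmod_act V (f x)) gpull_act1 gpull_actM.

End Pullback.

Definition is_linear (R : comNzRingType) (U V : lmodType R) : {pred (U -> V)} :=
  fun f => `[< linear f >].

Section HomModule.
Variables (R : comNzRingType).

Fact is_linear_submod (U V : lmodType R) : submod_closed (@is_linear R U V).
Proof.
split=> [|k f g /asboolP lf /asboolP lg]; apply/asboolP.
  by move=> a u v; rewrite /= scaler0 addr0.
move=> a u v; rewrite !fctE /= lf lg !scalerDr !scalerA addrACA.
by rewrite [k * a]mulrC.
Qed.

HB.instance Definition _ (U V : lmodType R) :=
  GRing.isSubmodClosed.Build R (U -> V) (@is_linear R U V)
    (@is_linear_submod U V).

Record hom (U V : lmodType R) := Hom {
  hom_fun :> U -> V;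
  hom_funP : hom_fun \in @is_linear R U V }.

HB.instance Definition _ (U V : lmodType R) := [isSub for @hom_fun U V].
HB.instance Definition _ (U V : lmodType R) := [Choice of hom U V by <:].
HB.instance Definition _ (U V : lmodType R) :=
  [SubChoice_isSubLmodule of hom U V by <:].

Variable gT : finGroupType.
Variables (U V : gmod R gT).

Fact ghom_subproof x (f : hom U V) :
  (fun u => gmod_act V x (f (gmod_act U x^-1%g u))) \in @is_linear R U V.
Proof.
apply/asboolP => a u v.
by have /asboolP lf := hom_funP f; rewrite linearP lf linearP.
Qed.

(* (x . f)(u) = x f(x^-1 u) *)
Definition ghom_act x (f : hom U V) : hom U V := Hom (ghom_subproof x f).

Fact ghom_act_linear x : linear (ghom_act x).
Proof.
by move=> k f g; apply/val_inj/funext => u; rewrite /= !fctE /= linearP.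
Qed.

HB.instance Definition _ x :=
  GRing.isLinear.Build R (hom U V) (hom U V) _ (ghom_act x) (ghom_act_linear x).

Fact ghom_act1 f : ghom_act 1%g f = f.
Proof. by apply/val_inj/funext => u; rewrite /= invg1 !gmod_act1. Qed.

Fact ghom_actM x y f : ghom_act (x * y)%g f = ghom_act x (ghom_act y f).
Proof. by apply/val_inj/funext => u; rewrite /= invMg !gmod_actM. Qed.

Definition ghom : gmod R gT :=
  @GMod R gT (hom U V) (fun x => ghom_act x) ghom_act1 ghom_actM.

End HomModule.

Definition gtriv (R : comNzRingType) (gT : finGroupType) : gmod R gT :=
  @GMod R gT R^o (fun=> idfun) (fun=> erefl) (fun _ _ _ => erefl).

Definition endopermutation (R : comNzRingType) (gT : finGroupType) (p : nat)
    (V : gmod R gT) :=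
  [/\ (p.-group [set: gT])%g, is_lattice V & permutation_module (ghom V V)].

(* RG'-RG-bimodules are encoded as R(G' x G)-modules via                      *)
(* (x, y) . m = x m y^-1.                                                     *)

Section Bimodules.
Variables (R : comNzRingType).

Section Actions.
Variables (gT' gT : finGroupType) (M : gmod R (gT' * gT)%type).

Definition lres : gmod R gT' := gpull (@pairg1 gT' gT) M.

(* The right module M, as a left module via y . m = m y^-1. *)
Definition rres : gmod R gT := gpull (@pair1g gT' gT) M.

Definition bimod_lact (a : galg R gT') (m : M) : M := galg_act (V := lres) a m.

(* m . a = \sum_y a(y) (m . y) *)
Definition bimod_ract (m : M) (a : galg R gT) : M :=
  galg_act (V := rres) (antipode a) m.

Definition block_bimodule (b' : galg R gT') (b : galg R gT) :=
  forall m : M, bimod_lact b' m = m /\ bimod_ract m b = m.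

End Actions.

Section SwapMorphism.
Variables gT' gT : finGroupType.

Definition swap_pair (z : gT * gT') : gT' * gT := (z.2, z.1).

Fact swap_pairM : {in [set: gT * gT'] &, {morph swap_pair : z w / (z * w)%g}}.
Proof. by []. Qed.

Canonical swap_morphism := Morphism swap_pairM.

End SwapMorphism.

(* M^* = Hom_R(M, R) as an (RG, RG')-bimodule: (y . f . x)(m) = f(x m y). *)
Definition bimod_dual (gT' gT : finGroupType) (M : gmod R (gT' * gT)%type) :
    gmod R (gT * gT')%type :=
  gpull (@swap_morphism gT' gT) (ghom M (gtriv R _)).

Section Regular.
Variable gT : finGroupType.

Definition greg_act (z : gT * gT) (a : galg R gT) : galg R gT :=
  gelt R z.1 * a * gelt R z.2^-1.

Fact greg_act_linear z : linear (greg_act z).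
Proof.
by move=> k a c; rewrite /greg_act mulrDr mulrDl -scalerAr -scalerAl.
Qed.

HB.instance Definition _ z :=
  GRing.isLinear.Build R (galg R gT) (galg R gT) _ (greg_act z)
    (greg_act_linear z).

Fact greg_act1 a : greg_act 1%g a = a.
Proof. by rewrite /greg_act /= invg1 mul1r mulr1. Qed.

Fact greg_actM z w a : greg_act (z * w)%g a = greg_act z (greg_act w a).
Proof. by rewrite /greg_act /= invMg !geltM !mulrA. Qed.

Definition greg : gmod R (gT * gT)%type :=
  @GMod R _ (galg R gT) (fun z => greg_act z) greg_act1 greg_actM.

Variable B : block R gT.

Definition in_block : {pred galg R gT} := fun a => a * block_idem B == a.

Fact in_block_submod : submod_closed in_block.
Proof.
split=> [|k a c /eqP aB /eqP cB]; apply/eqP; first by rewrite mul0r.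
by rewrite mulrDl -scalerAl aB cB.
Qed.

HB.instance Definition _ :=
  GRing.isSubmodClosed.Build R (galg R gT) in_block in_block_submod.

Record block_alg := BlockAlg {
  block_val :> galg R gT;
  block_valP : block_val \in in_block }.

HB.instance Definition _ := [isSub for block_val].
HB.instance Definition _ := [Choice of block_alg by <:].
HB.instance Definition _ := [SubChoice_isSubLmodule of block_alg by <:].

Fact block_act_subproof z (a : block_alg) : greg_act z a \in in_block.
Proof.
have [_ _ Bc _] := block_idemP B; have /eqP aB := block_valP a.
by apply/eqP; rewrite /greg_act -mulrA Bc mulrA -[_ * _ * block_idem B]mulrA aB.
Qed.

Definition block_act z (a : block_alg) : block_alg :=
  BlockAlg (block_act_subproof z a).

Fact block_act_linear z : linear (block_act z).
Proof. by move=> k a c; apply: val_inj; rewrite /= linearP. Qed.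

HB.instance Definition _ z :=
  GRing.isLinear.Build R block_alg block_alg _ (block_act z)
    (block_act_linear z).

Fact block_act1 a : block_act 1%g a = a.
Proof. by apply: val_inj; exact: greg_act1. Qed.

Fact block_actM z w a : block_act (z * w)%g a = block_act z (block_act w a).
Proof. by apply: val_inj; exact: greg_actM. Qed.

Definition block_bimod : gmod R (gT * gT)%type :=
  @GMod R _ block_alg (fun z => block_act z) block_act1 block_actM.

End Regular.

Section Tensor.
Variables (gT' gT : finGroupType) (b : galg R gT).
Variables (M : gmod R (gT' * gT)%type) (U : gmod R gT).

Definition balanced (W : lmodType R) (f : M -> U -> W) :=
  [/\ forall u, linear (f^~ u), forall m, linear (f m)
    & forall a, a * b = a ->
        forall m u, f (bimod_ract m a) u = f m (galg_act a u)].

(* (T, t) is a tensor product of M and U over RGb. *)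
Definition is_tensor (T : lmodType R) (t : M -> U -> T) :=
  balanced t /\
  forall (W : lmodType R) (f : M -> U -> W), balanced f ->
    exists h : {linear T -> W}, (forall m u, h (t m u) = f m u) /\
      forall h' : {linear T -> W}, (forall m u, h' (t m u) = f m u) -> h' =1 h.

Definition is_tensor_module (T : gmod R gT') :=
  exists2 t : M -> U -> T, is_tensor t &
    forall x m u, t (gmod_act M (x, 1%g) m) u = gmod_act T x (t m u).

End Tensor.

Definition is_tensor_bimodule (gT' gT gT'' : finGroupType) (b : galg R gT)
    (M : gmod R (gT' * gT)%type) (N : gmod R (gT * gT'')%type)
    (T : gmod R (gT' * gT'')%type) :=
  exists2 t : M -> lres N -> T, is_tensor b t &
    forall x z m n,
      t (gmod_act M (x, 1%g) m) (gmod_act N (1%g, z) n) =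
        gmod_act T (x, z) (t m n).

Section StableEquivalence.
Variables (gT' gT : finGroupType) (B' : block R gT') (B : block R gT).

Definition stable_Morita (M : gmod R (gT' * gT)%type) :=
  [/\ block_bimodule M B' B,
      finitely_generated (lres M) /\ projective_in (idem_module B') (lres M),
      finitely_generated (rres M) /\
        projective_in (idem_module (antipode B)) (rres M),
      exists T X', [/\ is_tensor_bimodule B M (bimod_dual M) T,
        projective_in (fun Y => block_bimodule Y B' B') X'
        & giso T (gprod (block_bimod B') X')]
    & exists T X, [/\ is_tensor_bimodule B' (bimod_dual M) M T,
        projective_in (fun Y => block_bimodule Y B B) X
        & giso T (gprod (block_bimod B) X)]].

End StableEquivalence.

Section Sources.
Variables (gT : finGroupType).
Implicit Type P : {group gT}.

Definition sub_pair P (z : gT * subg_of P) : gT * gT := (z.1, sgval z.2).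

Fact sub_pairM P :
  {in [set: gT * subg_of P] &, {morph @sub_pair P : z w / (z * w)%g}}.
Proof. by []. Qed.

Canonical sub_pair_morphism P := Morphism (@sub_pairM P).

(* I is RG \otimes_RP V. *)
Definition is_induced P (V : gmod R (subg_of P)) (I : gmod R gT) :=
  is_tensor_module 1 (gpull (sub_pair_morphism P) (greg gT)) V I.

Definition relatively_projective P (M : gmod R gT) :=
  exists (V : gmod R (subg_of P)) I, is_induced V I /\ gsummand M I.

Definition is_vertex P (M : gmod R gT) :=
  relatively_projective P M /\
  forall Q : {group gT}, Q \proper P -> ~ relatively_projective Q M.

Definition is_source (M : gmod R gT) P (V : gmod R (subg_of P)) :=
  [/\ is_vertex P M, indecomposable V
    & exists2 I, is_induced V I & gsummand M I].

End Sources.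

End Bimodules.

Section Characters.
Variables (O : idomainType) (gT : finGroupType).
Local Notation K := {fraction O}.
Local Notation cfunK := {ffun gT -> K}.

Definition lattice_character (V : gmod O gT) (chi : cfunK) :=
  exists n (e : 'I_n -> V) (A : gT -> 'M[O]_n),
    [/\ is_basis e,
        forall x j, gmod_act V x (e j) = \sum_i A x i j *: e i
      & chi = [ffun x => tofrac (\tr (A x))]].

(* Irr(B): the characters of the irreducible KG-modules on which the block    *)
(* idempotent acts as the identity.                                           *)
Definition Irr (b : galg O gT) : set cfunK :=
  fun chi => exists n (rG : mx_representation K [set: gT] n),
    [/\ mx_irreducible rG, \sum_x tofrac (b x : O) *: rG x = 1%:M
      & chi = [ffun x => \tr (rG x)]].

Definition ZIrr (b : galg O gT) : set cfunK :=
  fun psi => exists n (c : 'I_n -> cfunK) (z : 'I_n -> int),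
    (forall i, Irr b (c i)) /\ psi = \sum_i c i *~ z i.

Definition L0 (p : nat) (b : galg O gT) : set cfunK :=
  fun psi => ZIrr b psi /\ forall x : gT, (p^'.-elt x)%g -> psi x = 0.

Definition cdot (phi psi : cfunK) : K :=
  #|gT|%:R^-1 * \sum_x phi x * psi x^-1%g.

End Characters.

Section CharacterMaps.
Variables (O : idomainType) (gT gT' : finGroupType).
Variables (B : block O gT) (B' : block O gT').
Local Notation K := {fraction O}.

(* Maps between character groups are total functions on functions G -> K;     *)
(* only their values on ZIrr(B) matter.                                       *)
Definition ZIrr_hom (Phi : {ffun gT -> K} -> {ffun gT' -> K}) :=
  (forall psi, ZIrr B psi -> ZIrr B' (Phi psi)) /\
  (forall phi psi, ZIrr B phi -> ZIrr B psi ->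
     Phi (phi + psi) = Phi phi + Phi psi).

Definition induced_by_tensor (M : gmod O (gT' * gT)%type)
    (Phi : {ffun gT -> K} -> {ffun gT' -> K}) :=
  ZIrr_hom Phi /\
  forall (U : gmod O gT) chi, idem_module B U -> lattice_character U chi ->
    exists2 T, is_tensor_module B M U T & lattice_character T (Phi chi).

Definition ZIrr_isometry (Phi : {ffun gT -> K} -> {ffun gT' -> K}) :=
  [/\ ZIrr_hom Phi, set_bij (ZIrr B) (ZIrr B') Phi
    & forall phi psi, ZIrr B phi -> ZIrr B psi ->
        cdot (Phi phi) (Phi psi) = cdot phi psi].

End CharacterMaps.

(* S is contained in Q(z), for z a primitive n-th root of unity in some       *)
(* extension field of K; as z is algebraic, Q(z) = Q[z].                      *)
Definition in_cyclotomic (K : fieldType) (S : set K) (n : nat) :=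
  exists (L : fieldType) (j : {rmorphism K -> L}) (z : L),
    n.-primitive_root z /\
    forall s, S s -> exists q : {poly rat}, j s = (map_poly ratr q).[z].

(* The junk value 0 is taken when S lies in no Q(zeta_n).                     *)
Definition conductor (K : fieldType) (S : set K) : nat :=
  if pselect (exists n, `[< in_cyclotomic S n >]) is left ex
  then ex_minn ex else 0%N.

Definition char_conductor (K : fieldType) (gT : finGroupType)
    (chi : {ffun gT -> K}) : nat := conductor (range chi).

(* Main.v *)
Require Import Defs.
From HB Require Import structures.
From mathcomp Require Import all_boot all_order all_algebra.
From mathcomp Require Import all_fingroup all_solvable all_field.
From mathcomp Require Import mxrepresentation character fraction.
From mathcomp Require Import boolp classical_sets functions.
From mathcomp Require Import zify ring.

(** Let [N] be the order of a root of unity [mu] of [K] such that both group orders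
    divide [N]. For [t] prime to [N] and congruent to 1 modulo the part of [N] prime
    to [p], write [psi^(t)] for the function [y |-> psi (y ^+ t)]. The cyclotomic
    polynomials are irreducible over the rationals, so [psi^(t)] is the conjugate of
    the generalised character [psi] under [mu |-> mu ^+ t] ([prim_root_transfer]),
    and the [p]-part of the conductor of [psi] only depends on the set of those [t]
    for which [psi^(t) = psi] ([leq_conductor_part], [powf_fixed]). Both assertions
    therefore say that [psi] and its image are fixed by the same [t].

    The heart of the proof is that the character [m] of [M] satisfies
    [m (z ^+ t) = m z] ([source_trace_invariant]). Decomposing [M] into eigenspaces
    of the part of [z] of order prime to [p] ([rigid_eigen]) leaves the [p]-part [u]
    of [z]. As [M] is a summand of a module induced from [V], its identity is a sum of
    endomorphisms indexed by cosets, which [u] permutes ([source_maps]). The sum over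
    the nontrivial orbits is congruent, modulo the maximal ideal, to an endomorphism
    that conjugates [u] to a multiple of [u] by a [p]-th root of unity; on an
    indecomposable summand where it is invertible, [u] and [u ^+ t] have trace 0. The
    other indecomposable summands are summands of a translate of [V] fixed by [u]
    ([krull_schmidt_trace]). If [W] is a summand of [V], the same argument applies to
    [Hom V W], a summand of the permutation module [End V], and shows that the
    product of the traces of [u] on [W] and of its inverse on [V] is invariant under
    the power map; the second factor is an integer, and either it is nonzero or the
    traces on [W] vanish ([endopermutation_rigid]).

    A trace formula for tensor products ([tensor_trace]) identifies the map induced
    by [M] with the operator [F psi x = #|G|^-1 sum_y m (x, y) psi y]; let [F'] be the
    operator of the dual of [M]. Projective bimodules have trace 0 at the elements of
    order divisible by [p] ([projective_trace0]). Hence, on functions vanishing on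
    the elements of order prime to [p], the operators [F' F] and [F F'] are the
    projections onto the blocks ([dual_kernelK], [bimod_kernelK]). All these
    operators commute with [psi |-> psi^(t)]. If [F psi] is fixed by [t], applying
    [F' F] to [psi - psi^(t)] shows that [psi] is fixed as well ([kern_fixed]).

    For the isometry [Phi], put [eta = Phi chi]. A positive multiple of [psi^(t)] is
    again a generalised character ([conjugate_multiple]), so that [Phi] is given by
    [F] on a multiple of [psi - psi^(t)]. If [eta] is fixed by [t], then
    [chi - chi^(t)] is orthogonal to [chi], because its image is [F chi - (F chi)^(t)],
    which is orthogonal to [eta]; as the scalar product is positive definite on
    functions with cyclotomic values ([cdot_definite]), [chi] is fixed. The converse
    uses [psi = F' eta] in the same way ([isometry_fixed]). *)

Set Implicit Arguments.
Unset Strict Implicit.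
Unset Printing Implicit Defensive.

Import GRing.Theory Num.Theory.
Local Open Scope ring_scope.

(** * Values in cyclotomic fields *)

(** The embedding [f] of the rationals is a parameter, so that composing it with a
    morphism of fields yields an expression of the same form. *)
Definition evq (L : fieldType) (f : {rmorphism rat -> L}) (q : {poly rat}) (z : L) :=
  (map_poly f q).[z].

Lemma evqB (L : fieldType) (f : {rmorphism rat -> L}) q r z :
  evq f (q - r) z = evq f q z - evq f r z.
Proof. by rewrite /evq rmorphB /= hornerD hornerN. Qed.

Lemma evqXn (L : fieldType) (f : {rmorphism rat -> L}) q n z :
  evq f (q \Po 'X^n) z = evq f q (z ^+ n).
Proof. by rewrite /evq map_comp_poly /= map_polyXn horner_comp hornerXn. Qed.

Lemma evq_sum (L : fieldType) (f : {rmorphism rat -> L}) q z :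
  evq f q z = \sum_(i < size q) f q`_i * z ^+ i.
Proof.
rewrite /evq (horner_coef_wide _ (size_poly _ _)).
by apply: eq_bigr => i _; rewrite coef_map.
Qed.

Lemma evq_map (K L : fieldType) (f : {rmorphism rat -> K}) (j : {rmorphism K -> L})
    (g : {rmorphism rat -> L}) q z :
  j (evq f q z) = evq g q (j z).
Proof.
rewrite /evq -horner_map /= -map_poly_comp; congr _.[_]; apply: eq_map_poly => x.
by rewrite /= (fmorph_eq_rat g) -(fmorph_eq_rat (j \o f)).
Qed.

Lemma ratr_rmorphism (L : fieldType) : [pchar L] =i pred0 ->
  {f : {rmorphism rat -> L} | f =1 ratr}.
Proof.
move=> /pcharf0P L0.
have nz (d : int) : d != 0 -> d%:~R != 0 :> L.
  by case: d => d; rewrite ?NegzE ?rmorphN ?oppr_eq0 /= -?pmulrn L0.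
have frac (a d : int) : d != 0 -> ratr (a%:~R / d%:~R) = a%:~R / d%:~R :> L.
  move=> d0; set x : rat := _ / _.
  have nzd : d%:~R != 0 :> rat by rewrite intr_eq0.
  apply/eqP; rewrite /ratr eqr_div ?nz ?denq_eq0 // -!intrM; apply/eqP.
  congr _%:~R; apply: (@intr_inj rat); rewrite !intrM numqE /x.
  by rewrite mulrAC divfK.
have add : zmod_morphism (@ratr L).
  move=> x y; rewrite -[x]divq_num_den -[y]divq_num_den.
  have [nx ny] : denq x != 0 /\ denq y != 0 by rewrite !denq_eq0.
  have sub (F : fieldType) (a b c d : int) : b%:~R != 0 :> F -> d%:~R != 0 :> F ->
      a%:~R / b%:~R - c%:~R / d%:~R = (a * d - c * b)%:~R / (b * d)%:~R :> F.
    by move=> b0 d0; rewrite -mulNr addf_div // intrM intrB !intrM mulNr.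
  by rewrite sub ?intr_eq0 // !frac ?mulf_neq0 // sub ?nz.
have mul : monoid_morphism (@ratr L).
  split=> [|x y]; first by rewrite (ratr_int _ 1).
  rewrite -[x]divq_num_den -[y]divq_num_den mulf_div -!intrM.
  by rewrite !frac ?mulf_neq0 ?denq_eq0 // mulf_div -!intrM.
pose A := GRing.isZmodMorphism.Build rat L (@ratr L) add.
pose M := GRing.isMonoidMorphism.Build rat L (@ratr L) mul.
pose f : {rmorphism rat -> L} := HB.pack (@ratr L) A M.
by exists f.
Qed.

(** Irreducibility of the cyclotomic polynomial over the rationals, in the form
    of a transfer principle: a polynomial relation with rational coefficients
    satisfied by one primitive [n]-th root of unity is satisfied by all of them,
    in every field of characteristic 0. It plays the part of Galois theory. *)
Lemma prim_root_transfer (L L' : fieldType) (f : {rmorphism rat -> L})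
    (f' : {rmorphism rat -> L'}) n (z : L) (w : L') (q : {poly rat}) :
  n.-primitive_root z -> n.-primitive_root w -> evq f q z = 0 -> evq f' q w = 0.
Proof.
pose Phi : {poly rat} := map_poly intr 'Phi_n.
have rootPhi (F : fieldType) (h : {rmorphism rat -> F}) (x : F) :
    n.-primitive_root x -> root (map_poly h Phi) x.
  move=> xP; have n_gt0 := prim_order_gt0 xP.
  have mapPhi d : map_poly h (map_poly intr 'Phi_d) = map_poly intr 'Phi_d.
    by rewrite -map_poly_comp; apply: eq_map_poly => a /=; rewrite rmorph_int.
  have Xn1 d : (d > 0)%N -> \prod_(e <- divisors d) map_poly intr 'Phi_e
      = 'X^d - 1 :> {poly F}.
    by move=> d0; rewrite -rmorph_prod prod_Cyclotomic // rmorphB /= map_polyXn rmorph1.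
  have: root (\prod_(e <- divisors n) map_poly intr 'Phi_e : {poly F}) x.
    by rewrite Xn1 // rootE !hornerE (prim_expr_order xP) subrr.
  rewrite rootE horner_prod prodf_seq_eq0 => /hasP[d].
  rewrite -dvdn_divisors //= -rootE => dn xd.
  have d_gt0 := dvdn_gt0 n_gt0 dn.
  have: root (\prod_(e <- divisors d) map_poly intr 'Phi_e : {poly F}) x.
    rewrite rootE horner_prod prodf_seq_eq0; apply/hasP.
    by exists d; rewrite -?dvdn_divisors //= -rootE.
  rewrite Xn1 // rootE !hornerE subr_eq0 -(prim_order_dvd xP) => nd.
  by move: xd; rewrite mapPhi; have /eqP-> : d == n by rewrite eqn_dvd dn.
move=> zP wP qz.
suff /dvdpP[r ->] : Phi %| q.
  by rewrite /evq rmorphM hornerM (rootP (rootPhi _ _ _ wP)) mulr0.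
have [->|q0] := eqVneq q 0; first exact: dvdp0.
pose g := gcdp q Phi.
have gz : root (map_poly f g) z.
  by rewrite gcdp_map root_gcd rootPhi // andbT rootE; apply/eqP.
have [x gx] : exists x : algC, root (map_poly ratr g) x.
  apply/closed_rootP; rewrite size_map_poly.
  have: (1 < size (map_poly f g))%N.
    by apply: root_size_gt1 gz; rewrite map_poly_eq0 gcdp_eq0 negb_and q0.
  by rewrite size_map_poly => /gtn_eqF ->.
have [n_gt0 PhiC] : (n > 0)%N /\ map_poly ratr Phi = map_poly intr 'Phi_n :> {poly algC}.
  split; first exact: prim_order_gt0 zP.
  by rewrite -map_poly_comp; apply: eq_map_poly => a /=; rewrite ratr_int.
have xP : n.-primitive_root x.
  have [y yP] := C_prim_root_exists n_gt0.
  rewrite -(root_cyclotomic yP) -(Cintr_Cyclotomic yP) -PhiC.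
  have /dvdpP[r ->] := dvdp_gcdr q Phi.
  by rewrite rmorphM /= rootM gx orbT.
have [m [mE _ mP]] := minCpolyP x.
have -> : Phi = m.
  apply: (map_poly_inj (@ratr algC)).
  by rewrite -mE (minCpoly_cyclotomic xP) -(Cintr_Cyclotomic xP) PhiC.
by apply: dvdp_trans (dvdp_gcdl q Phi); rewrite -mP.
Qed.

Lemma prim_root_transfer_eq (L L' : fieldType) (f : {rmorphism rat -> L})
    (f' : {rmorphism rat -> L'}) n (z : L) (w : L') (q r : {poly rat}) :
  n.-primitive_root z -> n.-primitive_root w ->
  evq f q z = evq f r z -> evq f' q w = evq f' r w.
Proof.
move=> zP wP /eqP; rewrite -subr_eq0 -evqB => /eqP /(prim_root_transfer f' zP wP).
by rewrite evqB => /eqP; rewrite subr_eq0 => /eqP.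
Qed.

Lemma prim_root_mul (F : fieldType) a b (x y : F) : coprime a b ->
  a.-primitive_root x -> b.-primitive_root y -> (a * b).-primitive_root (x * y).
Proof.
move=> ab xP yP; have [a0 b0] := (prim_order_gt0 xP, prim_order_gt0 yP).
have expx k : x ^+ (k * a) = 1 by rewrite mulnC exprM (prim_expr_order xP) expr1n.
have expy k : y ^+ (k * b) = 1 by rewrite mulnC exprM (prim_expr_order yP) expr1n.
have xy1 : (x * y) ^+ (a * b) = 1 by rewrite exprMn expy mulnC expx mul1r.
have [|m mP mab] := prim_order_exists _ xy1; first by rewrite muln_gt0 a0.
have m1 k : (x * y) ^+ (m * k) = 1 by rewrite exprM (prim_expr_order mP) expr1n.
suff /eqP<- : m == (a * b)%N by [].
rewrite eqn_dvd mab Gauss_dvd //=; apply/andP; split.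
  by rewrite -(Gauss_dvdl m ab) (prim_order_dvd xP) -(m1 b) exprMn expy mulr1.
rewrite -(@Gauss_dvdl _ m a) 1?coprime_sym //.
by rewrite (prim_order_dvd yP) -(m1 a) exprMn expx mul1r.
Qed.

(** Suitable powers of [x] and [y] have as orders the parts of [a] and [b] at
    complementary sets of primes, which multiply to the least common multiple. *)
Lemma prim_root_lcm (F : fieldType) a b (x y : F) :
  a.-primitive_root x -> b.-primitive_root y ->
  exists v : F, (lcmn a b).-primitive_root v.
Proof.
move=> xP yP; have [a0 b0] := (prim_order_gt0 xP, prim_order_gt0 yP).
pose pi : nat_pred := [pred q | (logn q b <= logn q a)%N].
have sub (c d : nat) (rho : nat_pred) : (0 < c)%N -> (0 < d)%N ->
    {in rho, forall q, (logn q c <= logn q d)%N} -> (c`_rho %| d`_rho)%N.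
  move=> c0 d0 le_cd; apply/dvdn_partP=> [|q]; first exact: part_gt0.
  rewrite pi_of_part // !inE /= => /andP[_ q_rho].
  rewrite partn_part => [|r]; last by rewrite inE => /eqP->.
  have le_q : (c`_q %| d`_q)%N by rewrite !p_part dvdn_exp2l ?le_cd.
  apply: dvdn_trans le_q _; rewrite -(@partn_part q rho d) ?dvdn_part // => r.
  by rewrite inE => /eqP->.
have lcmE : lcmn a b = (a`_pi * b`_pi^')%N.
  rewrite -(partnC pi (_ : 0 < lcmn a b)%N) ?lcmn_gt0 ?a0 // !partn_lcm //.
  congr (_ * _)%N; first by apply/lcmn_idPl/sub.
  apply/lcmn_idPr/sub => // q; rewrite !inE -ltnNge => /ltnW; exact.
rewrite lcmE; exists (x ^+ (a %/ a`_pi) * y ^+ (b %/ b`_pi^')).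
apply: prim_root_mul; try by apply: dvdn_prim_root; rewrite ?dvdn_part.
by rewrite (@coprime_partC pi).
Qed.

(** Two cyclotomic descriptions [Q(z)], [Q(w)] of one number: it is moved only by
    those automorphisms of the common cyclotomic field which act nontrivially on
    the intersection. *)
Lemma cyclotomic_inter_fixed (L : fieldType) (f : {rmorphism rat -> L}) N c (z w : L)
    (q r : {poly rat}) t :
  N.-primitive_root z -> c.-primitive_root w -> evq f q z = evq f r w ->
  coprime t N -> t = 1 %[mod gcdn N c] -> evq f q (z ^+ t) = evq f q z.
Proof.
move=> zP wP qr tN t1; have [v vP] := prim_root_lcm zP wP.
have [N0 c0] := (prim_order_gt0 zP, prim_order_gt0 wP).
(* [N] and [c] need not be coprime, but [t] and 1 agree modulo their gcd *)
have [T [TN Tc]] : exists T, T = t %[mod N] /\ T = 1 %[mod c].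
  have [u k uE _] := egcdnP c N0; set g := gcdn N c in t1 uE.
  have g_gt0 : (0 < g)%N by rewrite gcdn_gt0 N0.
  have [e eE] : exists e, (t + e * g = 1 + c * t)%N.
    have lt : (t <= 1 + c * t)%N by rewrite (leq_trans (leq_pmull t c0)) // leq_addl.
    have : (g %| 1 + c * t - t)%N.
      rewrite -eqn_mod_dvd //; apply/eqP; rewrite -modnDmr -modnMml.
      by rewrite (eqP (dvdn_gcdr N c : _ == _)) mul0n mod0n addn0 t1.
    by move=> /dvdnP[e eE]; exists e; rewrite -eE subnKC.
  exists (t + e * (u * N))%N; split; first by rewrite mulnA addnC modnMDl.
  by rewrite uE mulnDr mulnA addnCA modnMDl eE addnC mulnC modnMDl.
have co : coprime T (lcmn N c).
  have: coprime T (N * c).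
    by rewrite coprimeMr -coprime_modl TN coprime_modl tN -coprime_modl Tc coprime_modl coprime1n.
  by apply: coprime_dvdr; rewrite dvdn_lcm dvdn_mulr ?dvdn_mull.
have pw a (x : L) : a.-primitive_root x -> (a %| lcmn N c)%N -> exists i, x = v ^+ i.
  move=> xP /dvdnP[d dE].
  have: x ^+ lcmn N c = 1 by rewrite dE mulnC exprM (prim_expr_order xP) expr1n.
  by move=> /(prim_rootP vP)[i xE]; exists i.
have [i zE] := pw _ _ zP (dvdn_lcml _ _).
have [k wE] := pw _ _ wP (dvdn_lcmr _ _).
have := @prim_root_transfer_eq _ _ f f _ v (v ^+ T) (q \Po 'X^i) (r \Po 'X^k) vP.
rewrite prim_root_exp_coprime // => /(_ co).
rewrite !evqXn -zE -wE => /(_ qr); rewrite -!exprM ![(T * _)%N]mulnC !exprM -zE -wE.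
rewrite -(prim_expr_mod zP T) TN (prim_expr_mod zP).
by rewrite -(prim_expr_mod wP T) Tc (prim_expr_mod wP) expr1 => ->.
Qed.

(** Galois descent along the extension [Q(z) / Q(z ^+ p)]: averaging over the
    automorphisms [z |-> z ^+ (1 + m p^c j)] sends every power of [z] into the
    smaller field, because the sums that occur are geometric. *)
Lemma cyclotomic_descent_step (L : fieldType) (f : {rmorphism rat -> L}) p m c
    (z : L) (q : {poly rat}) :
  prime p -> (m * p ^ c.+1).-primitive_root z ->
  (forall t, coprime t (m * p ^ c.+1) -> t = 1 %[mod m * p ^ c] ->
     evq f q (z ^+ t) = evq f q z) ->
  exists r, evq f q z = evq f r (z ^+ p).
Proof.
move=> p_pr; rewrite expnSr mulnA; set M := (m * p ^ c)%N => zP fix_q.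
have p_gt0 := prime_gt0 p_pr.
pose w := z ^+ M; have wP : p.-primitive_root w.
  have := dvdn_prim_root zP (dvdn_mull M (dvdnn p)); rewrite mulnK //.
have coM j : coprime (1 + M * j) M.
  by rewrite coprime_sym /coprime addnC mulnC gcdnMDl gcdn1.
pose C := [pred j : 'I_p | coprime (1 + M * j) (M * p)].
(* the exponents [1 + M * j] prime to [M * p] form the Galois group *)
have avg i : exists r, \sum_(j < p | C j) z ^+ (i * (1 + M * j)) = evq f r (z ^+ p).
  have [r rE] : exists r, \sum_(j < p) z ^+ (i * (1 + M * j)) = evq f r (z ^+ p).
    have -> : \sum_(j < p) z ^+ (i * (1 + M * j)) = z ^+ i * \sum_(j < p) (w ^+ i) ^+ j.
      rewrite big_distrr; apply: eq_bigr => j _ /=.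
      by rewrite -!exprM -exprD mulnDr muln1 mulnCA mulnA.
    have [/dvdnP[d iE]|p_i] := boolP (p %| i)%N.
      exists (p%:R *: 'X^d); rewrite /evq linearZ /= map_polyXn hornerZ hornerXn.
      have -> : w ^+ i = 1 by rewrite iE mulnC exprM (prim_expr_order wP) expr1n.
      under eq_bigr do rewrite expr1n.
      by rewrite sumr_const card_ord rmorph_nat mulr_natl mulr_natr iE mulnC exprM.
    exists 0; rewrite /evq rmorph0 horner0; apply/eqP; rewrite mulf_eq0; apply/orP; right.
    have w1 : w ^+ i - 1 != 0 by rewrite subr_eq0 -(prim_order_dvd wP).
    apply/eqP/(mulfI w1); rewrite mulr0 -subrX1 -exprM mulnC exprM (prim_expr_order wP).
    by rewrite expr1n subrr.
  have [r' rE'] : exists r, \sum_(j < p | ~~ C j) z ^+ (i * (1 + M * j)) = evq f r (z ^+ p).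
    exists (\sum_(j < p | ~~ C j) 'X^(i * ((1 + M * j) %/ p))).
    rewrite /evq rmorph_sum horner_sum; apply: eq_bigr => j /=.
    rewrite coprimeMr coM coprime_sym prime_coprime // negbK => p_j.
    by rewrite map_polyXn hornerXn -exprM mulnCA [(p * _)%N]mulnC divnK.
  by exists (r - r'); rewrite evqB -rE -rE' [in RHS](bigID C) /= addrK.
have [r rE] := choice avg.
pose n := #|C|; have n0 : f n%:R != 0.
  rewrite fmorph_eq0 pnatr_eq0 -lt0n; apply/card_gt0P; exists (Ordinal p_gt0).
  by rewrite inE /= muln0 coprime1n.
exists (n%:R^-1 *: \sum_(i < size q) q`_i *: r i).
rewrite /evq linearZ /= hornerZ fmorphV; apply: (mulfI n0); rewrite mulVKf //.
transitivity (\sum_(j | C j) evq f q (z ^+ (1 + M * j))).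
  rewrite (eq_bigr (fun=> evq f q z)) => [|j Cj].
    by rewrite sumr_const rmorph_nat mulr_natl.
  by apply: fix_q => //; rewrite mulnC addnC modnMDl.
under [LHS]eq_bigr do rewrite evq_sum.
rewrite exchange_big /= rmorph_sum horner_sum; apply: eq_bigr => i _.
rewrite /= map_polyZ hornerZ -/(evq f (r i) _) -rE big_distrr /=.
by apply: eq_bigr => j _; rewrite -exprM mulnC.
Qed.

(** The invariance passes from [q] to [r] in the induction because [z ^+ t] satisfies
    the same rational relations as [z]. *)
Lemma cyclotomic_descent (L : fieldType) (f : {rmorphism rat -> L}) p m b d
    (z : L) (q : {poly rat}) :
  prime p -> (m * p ^ (b + d)).-primitive_root z ->
  (forall t, coprime t (m * p ^ (b + d)) -> t = 1 %[mod m * p ^ b] ->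
     evq f q (z ^+ t) = evq f q z) ->
  exists r, evq f q z = evq f r (z ^+ (p ^ d)).
Proof.
move=> p_pr; elim: d z q => [|d IHd] z q zP fix_q.
  by exists q; rewrite expn0 expr1.
rewrite addnS in zP fix_q.
have [r rE] : exists r, evq f q z = evq f r (z ^+ p).
  apply: (@cyclotomic_descent_step _ f p m (b + d)) => // t co_t t1.
  apply: fix_q => //; have dv : (m * p ^ b %| m * p ^ (b + d))%N.
    by rewrite dvdn_mul // dvdn_exp2l // leq_addr.
  by rewrite -(modn_dvdm t dv) t1 modn_dvdm.
have zpP : (m * p ^ (b + d)).-primitive_root (z ^+ p).
  have NE : (m * p ^ (b + d).+1 = m * p ^ (b + d) * p)%N by rewrite expnSr mulnA.
  rewrite NE in zP; have := dvdn_prim_root zP (dvdn_mulr p (dvdnn _)).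
  by have := prim_order_gt0 zP; rewrite muln_gt0 => /andP[M_gt0 _]; rewrite mulKn.
case: d zP zpP IHd fix_q => [|d] zP zpP IHd fix_q; first by exists r.
have [|r' r'E] := IHd (z ^+ p) r zpP; last by exists r'; rewrite rE r'E -exprM -expnS.
move=> t co_t t1.
have {}co_t : coprime t (m * p ^ (b + d.+1).+1).
  by move: co_t; rewrite !coprimeMr !coprime_pexpr // addnS.
rewrite -rE -(fix_q t) //.
have := @prim_root_transfer_eq _ _ f f _ z (z ^+ t) q (r \Po 'X^p) zP.
rewrite prim_root_exp_coprime // !evqXn => /(_ co_t rE) ->.
by rewrite -!exprM mulnC.
Qed.

(** ** Conductors *)

Lemma conductor_min (K : fieldType) (S : set K) n :
  in_cyclotomic S n ->
  [/\ in_cyclotomic S (conductor S), (0 < conductor S)%N & (conductor S <= n)%N].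
Proof.
move=> Sn; rewrite /conductor; case: pselect => [ex|[]]; last by exists n; apply/asboolP.
case: ex_minnP => c /asboolP Sc min_c; split=> //; last exact/min_c/asboolP.
by have [? [? [? [/prim_order_gt0]]]] := Sc.
Qed.

Lemma part_decomp p n : prime p -> (0 < n)%N ->
  exists m a, [/\ n = (m * p ^ a)%N, coprime p m, (n`_p = p ^ a)%N & (n`_p^' = m)%N].
Proof.
move=> p_pr n_gt0; exists (n`_p^')%N, (logn p n); split=> //; last by rewrite p_part.
  by rewrite -p_part mulnC partnC.
rewrite prime_coprime // -p'natE //; exact: part_pnat.
Qed.

(** Let [p ^ b] be the [p]-part of the conductor of [S]. The conjugations that are
    trivial on the roots of unity of order [N`_p^' * p ^ b] fix [S], hence [S'], which
    therefore lies in the field generated by these roots. Intersecting this field with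
    the one generated by the roots of order [conductor S'] contradicts minimality if
    the [p]-part of [conductor S'] is larger than [p ^ b]. *)
Lemma leq_conductor_part (K : fieldType) (f : {rmorphism rat -> K}) p N (z : K)
    (S S' : set K) :
  prime p -> N.-primitive_root z ->
  (forall s, S s -> exists q, s = evq f q z) ->
  (forall s, S' s -> exists q, s = evq f q z) ->
  (forall t, coprime t N -> t = 1 %[mod (N`_p^')%N] ->
     (forall q, S (evq f q z) -> evq f q (z ^+ t) = evq f q z) ->
     (forall q, S' (evq f q z) -> evq f q (z ^+ t) = evq f q z)) ->
  ((conductor S')`_p <= (conductor S)`_p)%N.
Proof.
move=> p_pr zP Sq S'q fix_t; have p_gt1 := prime_gt1 p_pr.
have ratr_evq (L : fieldType) (j : {rmorphism K -> L}) q x :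
    (map_poly ratr q).[x] = evq (j \o f) q x.
  by rewrite /evq (eq_map_poly (fmorph_eq_rat (j \o f))).
have inN T : (forall s, T s -> exists q, s = evq f q z) -> in_cyclotomic T N.
  move=> Tq; exists K, idfun, z; split=> // s /Tq[q ->]; exists q.
  by rewrite /evq (eq_map_poly (fmorph_eq_rat f)).
have [[L [j [w [wP Sw]]]] c_gt0 _] := conductor_min (inN _ Sq).
have [[L' [j' [w' [w'P S'w']]]] c'_gt0 _] := conductor_min (inN _ S'q).
have N_gt0 := prim_order_gt0 zP.
set c := conductor S in w wP Sw c_gt0 *; set c' := conductor S' in w' w'P S'w' c'_gt0 *.
have [m [a [NE pm Np Np']]] := part_decomp p_pr N_gt0.
have [mc [b [cE _ cp _]]] := part_decomp p_pr c_gt0.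
have [m' [b' [c'E pm' c'p c'p']]] := part_decomp p_pr c'_gt0.
rewrite cp c'p leqNgt; apply/negP; rewrite ltn_exp2l // => lt_bb'.
have gcd_dvd (u v e u' v' e' : nat) : (0 < u)%N -> (0 < u')%N ->
    (u`_p = p ^ e)%N -> (u`_p^' = v)%N -> (u'`_p = p ^ e')%N ->
    (gcdn u u' %| v * p ^ minn e e')%N.
  move=> u_gt0 u'_gt0 up up' u'p; rewrite mulnC -(partnC p (_ : 0 < gcdn u u')%N).
    rewrite dvdn_mul // ?dvdn_gcd ?partn_dvd ?dvdn_gcdl ?dvdn_gcdr //; last first.
      by rewrite -up' partn_dvd ?dvdn_gcdl.
    by rewrite /minn; case: ifP => _; rewrite -?up -?u'p partn_dvd ?dvdn_gcdl ?dvdn_gcdr.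
  by rewrite gcdn_gt0 u_gt0.
pose b0 := minn a b; pose M := (m * p ^ b0)%N.
have NE' : N = (m * p ^ (b0 + (a - b0)))%N by rewrite subnKC ?geq_minl.
(* [S] lies in the intersection of the fields generated by [z] and [w] *)
have fixS t : coprime t N -> t = 1 %[mod M] -> forall q, S (evq f q z) ->
    evq f q (z ^+ t) = evq f q z.
  move=> tN t1 q /[dup] /Sw[r]; rewrite (ratr_evq L j) => rE _.
  apply: (fmorph_inj j); rewrite !(evq_map _ _ (j \o f)) rmorphXn /=.
  rewrite (evq_map f j (j \o f)) in rE.
  apply: (@cyclotomic_inter_fixed L (j \o f) N c (j z) w q r) => //.
    by rewrite fmorph_primitive_root.
  have dv : (gcdn N c %| M)%N by apply: gcd_dvd => //; rewrite NE -NE.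
  by rewrite -(modn_dvdm t dv) t1 modn_dvdm.
have descS' s : S' s -> exists r, s = evq f r (z ^+ (p ^ (a - b0))).
  move=> S's; have [q sE] := S'q s S's; rewrite sE.
  apply: (@cyclotomic_descent K f p m b0) => //; first by rewrite -NE'.
  rewrite -NE' => t tN t1; apply: (fix_t t tN); last by rewrite -sE.
    have dv : (m %| M)%N by apply: dvdn_mulr.
    by rewrite Np' -(modn_dvdm t dv) t1 modn_dvdm.
  exact: fixS.
pose z1 := z ^+ (p ^ (a - b0)).
have z1P : M.-primitive_root z1.
  have NM : N = (M * p ^ (a - b0))%N by rewrite -mulnA -expnD subnKC ?geq_minl.
  have M_gt0 : (0 < M)%N by move: N_gt0; rewrite NM muln_gt0 => /andP[].
  rewrite NM in zP; have := dvdn_prim_root zP (dvdn_mulr _ (dvdnn M)).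
  by rewrite mulKn.
have lt_b0b' : (b0 <= b')%N by rewrite (leq_trans (geq_minr _ _)) // ltnW.
have c'E' : c' = (m' * p ^ (b0 + (b' - b0)))%N by rewrite subnKC.
(* the same argument in the field [L'], between [w'] and the image of [z1] *)
have descw' s : S' s -> exists r, j' s = evq (j' \o f) r (w' ^+ (p ^ (b' - b0))).
  move=> S's; have [q] := S'w' s S's; rewrite (ratr_evq L' j') => qE; rewrite qE.
  have [r sE] := descS' s S's.
  apply: (@cyclotomic_descent L' _ p m' b0) => //; first by rewrite -c'E'.
  rewrite -c'E' => t tc' t1.
  have j'z1 : M.-primitive_root (j' z1) by rewrite fmorph_primitive_root.
  apply: (cyclotomic_inter_fixed w'P j'z1) => //.
    by rewrite -qE sE (evq_map f j' (j' \o f)).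
  have dv : (gcdn c' M %| m' * p ^ b0)%N.
    have Mp : (M`_p = p ^ b0)%N.
      have M_gt0 := prim_order_gt0 z1P; have := M_gt0; rewrite muln_gt0 => /andP[m_gt0 pb_gt0].
      rewrite partnM // part_p'nat ?p'natE -?prime_coprime // mul1n part_pnat_id //.
      by rewrite pnatX pnat_id.
    by rewrite -(minn_idPr lt_b0b'); apply: gcd_dvd => //; apply: prim_order_gt0 z1P.
  by rewrite -(modn_dvdm t dv) t1 modn_dvdm.
have : in_cyclotomic S' (m' * p ^ b0).
  exists L', j', (w' ^+ (p ^ (b' - b0))); split; last first.
    by move=> s /descw'[r rE]; exists r; rewrite (ratr_evq L' j').
  have c'M : c' = (m' * p ^ b0 * p ^ (b' - b0))%N by rewrite -mulnA -expnD subnKC.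
  have M'_gt0 : (0 < m' * p ^ b0)%N by move: c'_gt0; rewrite c'M muln_gt0 => /andP[].
  rewrite c'M in w'P; have := dvdn_prim_root w'P (dvdn_mulr _ (dvdnn (m' * p ^ b0))).
  by rewrite mulKn.
case/conductor_min => _ _; rewrite -/c' c'E leqNgt => /negP; apply.
rewrite ltn_pmul2l ?ltn_exp2l ?(leq_ltn_trans (geq_minr _ _)) //.
by move: c'_gt0; rewrite c'E muln_gt0 => /andP[].
Qed.

(** * Matrices over a complete discrete valuation ring *)

Section DVR.

Variables (O : idomainType) (O_dvr : complete_dvr O).

(** Divided by a generator of the ideal that they span, the two elements become
    coprime, so that one of them becomes a unit of the local ring [O]. *)
Lemma dvr_total (a b : O) : (exists c, a = c * b) \/ (exists c, b = c * a).
Proof.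
have [PID [pi [pi0 piP] _]] := O_dvr.
have [|d dP] := PID (fun x => exists u v, x = u * a + v * b).
- split; first by exists 0, 0; rewrite !mul0r addr0.
    move=> _ _ [u [v ->]] [u' [v' ->]]; exists (u + u'), (v + v').
    by rewrite !mulrDl addrACA.
  by move=> c _ [u [v ->]]; exists (c * u), (c * v); rewrite mulrDr !mulrA.
have [a' aE] : exists c, a = c * d by apply/dP; exists 1, 0; rewrite mul1r mul0r addr0.
have [b' bE] : exists c, b = c * d by apply/dP; exists 0, 1; rewrite mul1r mul0r add0r.
have [d0|d0] := eqVneq d 0; first by left; exists 0; rewrite aE d0 mulr0 mul0r.
have [u [v dE]] : exists u v, d = u * a + v * b by apply/dP; exists 1; rewrite mul1r.
have uv1 : u * a' + v * b' = 1.
  by apply: (mulIf d0); rewrite mul1r mulrDl -!mulrA -aE -bE -dE.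
have [a'U|a'U] := boolP (a' \is a GRing.unit).
  by right; exists (b' / a'); rewrite aE mulrA divrK.
have [b'U|b'U] := boolP (b' \is a GRing.unit).
  by left; exists (a' / b'); rewrite bE mulrA divrK.
have /piP[c ca] := a'U; have /piP[c' cb] := b'U.
have pi1 : pi \is a GRing.unit.
  apply/unitrPr; exists (u * c + v * c').
  by rewrite mulrC mulrDl -!mulrA -ca -cb.
by have /negP[] : pi \isn't a GRing.unit; [apply/piP; exists 1; rewrite mul1r|].
Qed.

Lemma dvr_min_seq (s : seq O) : has (predC1 0) s ->
  exists x, [/\ x \in s, x != 0 & forall y, y \in s -> exists c, y = c * x].
Proof.
have refl x : exists c : O, x = c * x by exists 1; rewrite mul1r.
have dv0 x : exists c : O, 0 = c * x by exists 0; rewrite mul0r.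
elim: s => //= a s IHs; have [/IHs[x [xs x0 xP]] _|s0] := boolP (has _ s).
  have [a0|a0] := eqVneq a 0.
    exists x; rewrite inE xs orbT; split=> // y; rewrite inE => /orP[/eqP->|/xP//].
    by rewrite a0.
  have [[c aE]|[c xE]] := dvr_total a x.
    exists x; rewrite inE xs orbT; split=> // y; rewrite inE => /orP[/eqP->|/xP//].
    by exists c.
  exists a; rewrite mem_head; split=> // y; rewrite inE => /orP[/eqP->//|/xP[d ->]].
  by exists (d * c); rewrite -mulrA -xE.
rewrite orbF => a0; exists a; rewrite mem_head; split=> // y.
rewrite inE => /orP[/eqP->//|ys]; suff /eqP-> : y == 0 by [].
by apply: contraNT s0 => y0; apply/hasP; exists y.
Qed.

(** A finitely generated submodule of a free module is free: in a generating
    family of minimal size, a linear relation would have a coefficient dividing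
    all the others, and the corresponding generator would be redundant. *)
Lemma row_basis m n (G : 'M[O]_(m, n)) :
  exists r (W : 'M[O]_(r, n)) (C : 'M_(m, r)) (D : 'M_(r, m)),
    [/\ G = C *m W, W = D *m G & forall x : 'rV_r, x *m W = 0 -> x = 0].
Proof.
pose gens r := exists (W : 'M[O]_(r, n)) (C : 'M_(m, r)) (D : 'M_(r, m)),
  G = C *m W /\ W = D *m G.
have ex : exists r, `[< gens r >].
  by exists m; apply/asboolP; exists G, 1%:M, 1%:M; rewrite !mul1mx.
have [r /asboolP[W [C [D [GE WE]]]] min_r] := ex_minnP ex.
exists r, W, C, D; split=> // x xW; apply: contrapT => /eqP x0.
have [|_ [/mapP[i _ ->] xi0 xiP]] := @dvr_min_seq [seq x 0 i | i <- enum 'I_r].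
  apply/hasP; have /existsP[i xi0] : [exists i, x 0 i != 0].
    apply: contraNT x0; rewrite negb_exists => /forallP x0.
    by apply/eqP/rowP => i; rewrite mxE; apply/eqP; rewrite -[_ == _]negbK.
  by exists (x 0 i) => //; rewrite map_f ?mem_enum.
have [r' rE] : exists r', r = r'.+1 by exists r.-1; rewrite (ltn_predK (ltn_ord i)).
subst r; rename r' into r; suff: (r.+1 <= r)%N by rewrite ltnn.
apply/min_r/asboolP.
have /fin_all_exists[c cE] j : exists c, x 0 j = c * x 0 i.
  by apply: xiP; rewrite map_f ?mem_enum.
have WiE : row i W = - \sum_(j | j != i) c j *: row j W.
  apply/eqP; rewrite -addr_eq0; apply/eqP/rowP => l; rewrite [RHS]mxE [LHS]mxE.
  apply: (mulfI xi0); rewrite mulr0 -[RHS](_ : (x *m W) 0 l = 0); last by rewrite xW mxE.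
  rewrite [RHS]mxE [RHS](bigD1 i) //= mulrDr !mxE; congr (_ + _).
  rewrite summxE big_distrr; apply: eq_bigr => j _ /=.
  by rewrite !mxE mulrCA mulrA -cE.
pose R : 'M[O]_(r, r.+1) := \matrix_(a, b) (b == lift i a)%:R.
have RE (Q : 'M[O]_(r.+1, n)) a : row a (R *m Q) = row (lift i a) Q.
  rewrite row_mul [row (lift i a) Q]rowE; congr (_ *m _).
  by apply/rowP => b; rewrite !mxE eqxx.
exists (R *m W).
have [C' WC'] : exists C', W = C' *m (R *m W).
  exists (\matrix_j if unlift i j is Some a then delta_mx 0 a
                    else - \sum_b c (lift i b) *: delta_mx 0 b).
  apply/row_matrixP => j; rewrite row_mul rowK; case: unliftP => [a|] ->.
    by rewrite -rowE RE.
  rewrite WiE mulNmx mulmx_suml; congr (- _).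
  rewrite (reindex_omap (lift i) (unlift i)) => [|b b_i]; last first.
    by case: unliftP b_i => [a ->|->] //=; rewrite ?eqxx.
  apply: eq_big => b; first by rewrite liftK eqxx eq_sym neq_lift.
  by move=> _; rewrite -scalemxAl -rowE RE.
exists (C *m C'), (R *m D); rewrite -mulmxA -WC' -mulmxA -WE; split=> //.
Qed.

(** The image of an idempotent is finitely generated, hence free. *)
Lemma idempotent_split n (E : 'M[O]_n) : E *m E = E ->
  exists r (B : 'M[O]_(n, r)) (A : 'M_(r, n)), B *m A = E /\ A *m B = 1%:M.
Proof.
move=> EE; have [r [W [C [D [EC WD W_inj]]]]] := row_basis E.
exists r, C, W; split=> //; apply/row_matrixP => i; apply/eqP.
rewrite -subr_eq0 -linearB /=; apply/eqP/W_inj; rewrite -row_mul mulmxBl mul1mx.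
by rewrite -mulmxA -EC {2}WD WD -mulmxA EE subrr row0.
Qed.

End DVR.

Section Residue.

Variables (O : idomainType) (k : fieldType) (res : {rmorphism O -> k}).
Hypotheses (O_dvr : complete_dvr O) (res_surj : forall y, exists x, res x = y).

(** The kernel of a morphism onto a field is a maximal ideal. *)
Lemma res_eq0 (pi x : O) : uniformizer pi -> (res x == 0) = (x \isn't a GRing.unit).
Proof.
move=> [pi0 piP]; apply/eqP/idP => [x0|].
  by apply: contra_eqN x0 => xU; rewrite -unitfE rmorph_unit.
move=> /piP[c ->]; rewrite rmorphM; suff -> : res pi = 0 by rewrite mulr0.
apply: contrapT => /eqP pi_n0; have [y yE] := res_surj (res pi)^-1.
have /piP[d dE] : 1 - y * pi \isn't a GRing.unit.
  apply/negP => /(rmorph_unit res); rewrite rmorphB rmorph1 rmorphM yE mulVf //.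
  by rewrite subrr unitr0.
have: pi \isn't a GRing.unit by apply/piP; exists 1; rewrite mul1r.
case/negP; apply/unitrPr; exists (d + y); rewrite mulrC mulrDl -dE subrK //.
Qed.

Lemma unitmx_res n (A : 'M[O]_n) : (A \in unitmx) = (map_mx res A \in unitmx).
Proof.
have [_ [pi piP _]] := O_dvr.
by rewrite !unitmxE det_map_mx unitfE (res_eq0 _ piP) negbK.
Qed.

Definition mx_dvd (pi : O) e m n (A : 'M[O]_(m, n)) := exists C, A = pi ^+ e *: C.

Lemma mx_dvdD pi e m n (A C : 'M[O]_(m, n)) :
  mx_dvd pi e A -> mx_dvd pi e C -> mx_dvd pi e (A + C).
Proof. by move=> [A' ->] [C' ->]; exists (A' + C'); rewrite scalerDr. Qed.

Lemma mx_dvdN pi e m n (A : 'M[O]_(m, n)) : mx_dvd pi e A -> mx_dvd pi e (- A).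
Proof. by move=> [A' ->]; exists (- A'); rewrite scalerN. Qed.

Lemma mx_dvdMr pi e m n q (A : 'M[O]_(m, n)) (C : 'M[O]_(n, q)) :
  mx_dvd pi e A -> mx_dvd pi e (A *m C).
Proof. by move=> [A' ->]; exists (A' *m C); rewrite scalemxAl. Qed.

Lemma mx_dvdMl pi e m n q (A : 'M[O]_(m, n)) (C : 'M[O]_(n, q)) :
  mx_dvd pi e C -> mx_dvd pi e (A *m C).
Proof. by move=> [C' ->]; exists (A *m C'); rewrite scalemxAr. Qed.

Lemma mx_dvd_leq pi e e' m n (A : 'M[O]_(m, n)) : (e <= e')%N ->
  mx_dvd pi e' A -> mx_dvd pi e A.
Proof.
by move=> le_e [A' ->]; exists (pi ^+ (e' - e) *: A'); rewrite scalerA -exprD subnKC.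
Qed.

Lemma mx_dvd_res (pi : O) m n (A : 'M[O]_(m, n)) : uniformizer pi ->
  mx_dvd pi 1 A <-> map_mx res A = 0.
Proof.
move=> piP; have pi_res0 x : res x = 0 <-> exists c, x = c * pi.
  by rewrite -piP.2 -(res_eq0 x piP); split=> /eqP.
split=> [[C ->]|A0].
  by apply/matrixP => i j; rewrite !mxE rmorphM (pi_res0 pi).2 ?mul0r //; exists 1; rewrite mul1r.
have /fin_all_exists[c cE] (ij : 'I_m * 'I_n) : exists c, A ij.1 ij.2 = c * pi.
  by apply/pi_res0; have /matrixP/(_ ij.1 ij.2) := A0; rewrite !mxE.
by exists (\matrix_(i, j) c (i, j)); apply/matrixP => i j; rewrite !mxE (cE (i, j)) mulrC expr1.
Qed.

(** The maximal ideal of a discrete valuation ring has trivial intersection of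
    its powers; this uses that ascending chains of principal ideals stop. *)
Lemma dvr_separated (pi x : O) : uniformizer pi -> (forall e, exists c, x = c * pi ^+ e) -> x = 0.
Proof.
move=> [pi0 piP] xP; apply: contrapT => /eqP x0; have [c cE] := choice xP.
have cS e : c e = c e.+1 * pi.
  by apply: (mulIf (expf_neq0 e pi0)); rewrite -cE -mulrA -exprS.
have [PID _] := O_dvr.
have cD e d : exists a, c e = a * c (e + d)%N.
  elim: d => [|d [a aE]]; first by exists 1; rewrite addn0 mul1r.
  by exists (a * pi); rewrite aE addnS (cS (e + d)%N) mulrAC mulrA.
have [|a aP] := PID (fun y => exists e b, y = b * c e).
  split; first by exists 0, 0; rewrite mul0r.
    move=> _ _ [e [b ->]] [e' [b' ->]]; exists (e + e')%N.
    have [u ->] := cD e e'; have [u' ->] := cD e' e; rewrite [(e' + e)%N]addnC.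
    by exists (b * u + b' * u'); rewrite mulrDl !mulrA.
  by move=> d _ [e [b ->]]; exists e, (d * b); rewrite mulrA.
have [e [b aE]] : exists e b, a = b * c e by apply/aP; exists 1; rewrite mul1r.
have [d dE] : exists d, c e.+1 = d * a by apply/aP; exists e.+1, 1; rewrite mul1r.
have ce0 : c e.+1 != 0.
  by apply: contraNneq x0 => ce0; rewrite (cE e.+1) ce0 mul0r.
have: pi \isn't a GRing.unit by apply/piP; exists 1; rewrite mul1r.
case/negP; apply/unitrPr; exists (d * b); apply: (mulIf ce0).
have cE' : c e.+1 = d * (b * (c e.+1 * pi)) by rewrite -cS -aE -dE.
by rewrite mul1r [RHS]cE'; ring.
Qed.

Lemma mx_separated (pi : O) m n (A : 'M[O]_(m, n)) : uniformizer pi ->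
  (forall e, mx_dvd pi e A) -> A = 0.
Proof.
move=> piP A_pi; apply/matrixP => i j; rewrite mxE; apply: (dvr_separated piP) => e.
by have [C ->] := A_pi e; exists (C i j); rewrite mxE mulrC.
Qed.

Lemma mx_limit (pi : O) m n (E : nat -> 'M[O]_(m, n)) : uniformizer pi ->
  (forall u, adic_cauchy pi u -> exists l, adic_limit pi u l) ->
  (forall e, mx_dvd pi e (E e.+1 - E e)) ->
  exists L, forall e, exists2 i, (e <= i)%N & mx_dvd pi e (L - E i).
Proof.
move=> piP compl E_cauchy.
have Ed e d : mx_dvd pi e (E (e + d)%N - E e).
  elim: d => [|d IHd]; first by exists 0; rewrite addn0 subrr scaler0.
  rewrite addnS -(subrK (E (e + d)%N) (E _)) -addrA.
  apply: mx_dvdD IHd; apply: mx_dvd_leq (E_cauchy _); exact: leq_addr.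
have lim (ij : 'I_m * 'I_n) : exists l, adic_limit pi (fun e => E e ij.1 ij.2) l.
  apply: compl => e; exists e => i j ei ej.
  have [[C CE] [C' CE']] := (Ed e (i - e)%N, Ed e (j - e)%N).
  rewrite !subnKC // in CE CE'.
  exists (C ij.1 ij.2 - C' ij.1 ij.2); rewrite mulrBl ![_ * pi ^+ e]mulrC.
  have /matrixP/(_ ij.1 ij.2) := CE; have /matrixP/(_ ij.1 ij.2) := CE'.
  by rewrite !mxE => <- <-; ring.
have [l lP] := fin_all_exists lim.
exists (\matrix_(i, j) l (i, j)) => e.
have [N NP] := fin_all_exists (fun ij => lP ij e).
pose i := maxn e (\max_ij N ij); exists i; first exact: leq_maxl.
have [C CE] := fin_all_exists (fun ij =>
  NP ij i (leq_trans (leq_bigmax ij) (leq_maxr _ _))).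
exists (- \matrix_(a, b) C (a, b)); apply/matrixP => a b; rewrite !mxE.
by have /= CE' := CE (a, b); rewrite mulrN mulrC -CE' opprB.
Qed.

(** Newton iteration [e |-> 3 e^2 - 2 e^3] lifts idempotents from the residue
    field; the lift is a limit of polynomials in the first approximation. *)
Lemma idempotent_lift n (E0 : 'M[O]_n) :
  map_mx res E0 *m map_mx res E0 = map_mx res E0 ->
  exists E, [/\ E *m E = E, map_mx res E = map_mx res E0
    & forall A, A *m E0 = E0 *m A -> A *m E = E *m A].
Proof.
case: n E0 => [|n] E0 E0E0; first by exists 0; split=> *; apply/matrixP; case.
have [_ [pi piP compl]] := O_dvr.
pose step (F : 'M[O]_n.+1) := F ^+ 2 *+ 3 - F ^+ 3 *+ 2.
pose E e := iter e step E0.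
pose defect (F : 'M[O]_n.+1) := F ^+ 2 - F.
have stepP F : step F - F = defect F * (1 - F *+ 2)
    /\ defect (step F) = defect F * defect F * (defect F *+ 4 - 1 *+ 3).
  have hX : horner_mx F 'X = F by exact: horner_mx_X.
  have stepX : step F = horner_mx F ('X ^+ 2 *+ 3 - 'X ^+ 3 *+ 2).
    by rewrite rmorphB !rmorphMn !rmorphXn /= hX.
  have defectX P : defect (horner_mx F P) = horner_mx F (P ^+ 2 - P).
    by rewrite rmorphB rmorphXn.
  have defectF : defect F = horner_mx F ('X ^+ 2 - 'X) by rewrite -{1}hX defectX.
  have subF P : horner_mx F P - F = horner_mx F (P - 'X) by rewrite rmorphB /= hX.
  have oneF : 1 - F *+ 2 = horner_mx F (1 - 'X *+ 2).
    by rewrite rmorphB rmorphMn rmorph1 /= hX.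
  have threeD P : horner_mx F P *+ 4 - 1 *+ 3 = horner_mx F (P *+ 4 - 1 *+ 3).
    by rewrite rmorphB !rmorphMn rmorph1.
  rewrite stepX defectX defectF subF oneF threeD -!rmorphM.
  by split; congr (horner_mx F _); ring.
have defectE e : mx_dvd pi e.+1 (defect (E e)).
  elim: e => [|e IHe].
    apply/(mx_dvd_res _ piP); rewrite /defect expr2 map_mxB map_mxM.
    by rewrite -[X in _ - X]E0E0 subrr.
  rewrite /E iterS -/(E e) (stepP _).2; apply: mx_dvdMr.
  have [C CE] := IHe; rewrite CE -[_ * _]scalemxAl -scalemxAr scalerA -exprD.
  by exists (pi ^+ e *: (C *m C)); rewrite scalerA -exprD; congr (_ ^+ _ *: _); lia.
have cauchyE e : mx_dvd pi e.+1 (E e.+1 - E e).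
  by rewrite /E iterS -/(E e) (stepP _).1; apply: mx_dvdMr.
have [L LP] := mx_limit piP compl (fun e => mx_dvd_leq (leqnSn e) (cauchyE e)).
have E_res e : map_mx res (E e) = map_mx res E0.
  elim: e => // e <-; apply/eqP; rewrite -subr_eq0 -map_mxB; apply/eqP.
  by apply/(mx_dvd_res _ piP); apply: mx_dvd_leq (cauchyE e).
have E_comm e A : A *m E0 = E0 *m A -> A * E e = E e * A.
  move=> AE0; elim: e => // e IHe; rewrite /E iterS -/(E e) /step.
  have comm j : A * E e ^+ j = E e ^+ j * A by apply: commrX.
  by rewrite mulrBr mulrBl !mulrnAr !mulrnAl !comm.
exists L; split.
- apply/eqP; rewrite -subr_eq0; apply/eqP/(mx_separated piP) => e.
  have [i ei LE] := LP e.
  have -> : L *m L - L = (L - E i) *m L + E i *m (L - E i) - (L - E i) + defect (E i).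
    rewrite mulmxBl mulmxBr /defect expr2 -[E i * E i]/(E i *m E i).
    by rewrite [X in X - _ + _]addrA subrK opprB addrACA subrK addrAC subrr add0r.
  apply: mx_dvdD; last by apply: mx_dvd_leq (defectE i); lia.
  apply: mx_dvdD (mx_dvdN LE); apply: mx_dvdD; [exact: mx_dvdMr|exact: mx_dvdMl].
- have [i _ LE] := LP 1; rewrite -(E_res i); apply/eqP.
  by rewrite -subr_eq0 -map_mxB; apply/eqP/(mx_dvd_res _ piP).
- move=> A AE0; apply/eqP; rewrite -subr_eq0; apply/eqP/(mx_separated piP) => e.
  have [i _ LE] := LP e.
  have -> : A *m L - L *m A = A *m (L - E i) - (L - E i) *m A.
    have AE : A *m E i = E i *m A by exact: E_comm.
    by rewrite mulmxBr mulmxBl AE opprB addrA subrK.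
  apply: mx_dvdD; [exact: mx_dvdMl|apply/mx_dvdN; exact: mx_dvdMr].
Qed.
End Residue.

(** * Traces on indecomposable summands *)

Section KrullSchmidt.

Variables (O : idomainType) (k : fieldType) (res : {rmorphism O -> k}).
Hypotheses (O_dvr : complete_dvr O) (res_surj : forall y, exists x, res x = y).

(** Fitting's lemma over [k] produces an idempotent polynomial in [X], which
    lifts to [O]: an endomorphism ring without idempotents is local. *)
Lemma commutant_local n (U X : 'M[O]_n) :
  (forall E, E *m E = E -> E *m U = U *m E -> E = 0 \/ E = 1%:M) ->
  X *m U = U *m X -> X \in unitmx \/ 1%:M - X \in unitmx.
Proof.
case: n U X => [|n] U X indec XU.
  by left; rewrite unitmxE det_mx00 unitr1.
set x := map_mx res X.
have [a [h h0 charE]] := multiplicity_XsubC (char_poly x) 0.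
rewrite (monic_neq0 (char_poly_monic x)) /= polyC0 subr0 in h0 charE.
have [[u v] /= uv1] : exists u : {poly k} * {poly k}, u.1 * 'X^(a.+1) + u.2 * h = 1.
  by apply/Bezout_eq1_coprimepP; rewrite coprimep_expl // coprimep_sym coprimepX.

pose P := u * 'X^(a.+1).
have XhP q : horner_mx x ('X^(a.+1) * h * q) = 0.
  have -> : 'X^(a.+1) * h * q = char_poly x * ('X * q) by rewrite charE exprS; ring.
  by rewrite rmorphM /= Cayley_Hamilton mul0r.
have [s sE] := choice res_surj.
pose Q := \poly_(i < size P) s P`_i.
have QP : map_poly res Q = P.
  apply/polyP => i; rewrite coef_map coef_poly; case: ltnP => [_|szP].
    exact: sE.
  by rewrite [RHS]nth_default ?raddf0.
pose E0 := horner_mx X Q.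
have E0P : map_mx res E0 = horner_mx x P by rewrite map_horner_mx QP.
have [|E [EE Eres Ecomm]] := @idempotent_lift _ _ _ O_dvr res_surj _ E0.
  rewrite E0P -[_ *m _]rmorphM; apply/eqP; rewrite -subr_eq0 -rmorphB.
  have -> : P * P - P = 'X^(a.+1) * h * (- u * v) by rewrite /P -[X in _ - X]mulr1 -uv1; ring.
  by apply/eqP; exact: XhP.
have [|E0'|E1] := indec E EE.
- apply/esym/Ecomm; apply: comm_mx_horner; exact/esym.
- right; rewrite (unitmx_res O_dvr res_surj) map_mxB map_mx1 -/x.
  have xa0 : x ^+ a.+1 = 0.
    have -> : x ^+ a.+1 = horner_mx x ('X^(a.+1) * h * v + P * 'X^(a.+1)).
      rewrite [X in horner_mx x X](_ : _ = 'X^(a.+1)) ?rmorphXn /= ?horner_mx_X //.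
      by rewrite -[RHS]mul1r -uv1 /P; ring.
    by rewrite rmorphD /= (XhP v) add0r rmorphM /= -E0P -Eres E0' map_mx0 mul0r.
  have := subrX1 x a.+1; rewrite xa0 sub0r => /(congr1 -%R); rewrite opprK -mulNr opprB.
  by move=> /esym/mulmx1_unit[].
left; rewrite (unitmx_res O_dvr res_surj) -/x.
have : horner_mx x (u * 'X^a) *m x = 1%:M.
  transitivity (horner_mx x P); last by rewrite -E0P -Eres E1 map_mx1.
  by rewrite /P exprSr mulrA [RHS]rmorphM /= horner_mx_X.
by case/mulmx1_unit.
Qed.

(** In a local ring, some term of an invertible sum is invertible. *)
Lemma commutant_local_sum n (U : 'M[O]_n) (I : finType) (Z : I -> 'M[O]_n) (r : seq I) Y :
  (forall E, E *m E = E -> E *m U = U *m E -> E = 0 \/ E = 1%:M) ->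
  (forall i, Z i *m U = U *m Z i) ->
  Y *m U = U *m Y -> Y + \sum_(i <- r) Z i \in unitmx ->
  Y \in unitmx \/ exists i, Z i \in unitmx.
Proof.
move=> indec ZU; elim: r Y => [|i r IHr] Y YU; first by rewrite big_nil addr0; left.
rewrite big_cons addrCA addrC => S_unit.
set S := Y + _ + _ in S_unit; have SU : S *m U = U *m S.
  rewrite !mulmxDl !mulmxDr YU ZU mulmx_suml mulmx_sumr.
  by congr (_ + _ + _); apply: eq_bigr => j _; exact: ZU.
have iSU : invmx S *m U = U *m invmx S.
  by apply: (canLR (mulKmx S_unit)); rewrite mulmxA SU -mulmxA mulmxV ?mulmx1.
have [|ZS|YS] := commutant_local indec (_ : invmx S *m Z i *m U = U *m (invmx S *m Z i)).
- by rewrite -mulmxA ZU !mulmxA iSU.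
- by right; exists i; move: ZS; rewrite unitmx_mul => /andP[].
apply: IHr => //; move: YS; have -> : 1%:M - invmx S *m Z i = invmx S *m (S - Z i).
  by rewrite mulmxBr mulVmx.
by rewrite unitmx_mul /S addrK => /andP[].
Qed.

Variables (zp : O) (t : nat).
Hypothesis zpt : zp ^+ t != 1.
Hypothesis zp1 : zp != 1.

(** An endomorphism which modulo the maximal ideal agrees with one that
    conjugates [U] to a multiple of itself by a nontrivial root of unity. *)
Definition twisted n (U X : 'M[O]_n) :=
  exists2 X', map_mx res X' = map_mx res X & zp *: (U *m X') = X' *m U.

(** Being invertible is detected over [k], so [X'] is invertible as well, and it
    conjugates [U ^+ e] to its multiple by a power of [zp]. *)
Lemma twisted_trace0 n (U X : 'M[O]_n) : twisted U X -> X \in unitmx ->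
  \tr U = 0 /\ \tr (U ^+ t) = 0.
Proof.
move=> [X' X'X UX'] X_unit.
have X'_unit : X' \in unitmx.
  by move: X_unit; rewrite !(unitmx_res O_dvr res_surj) X'X.
have UX'n e : zp ^+ e *: (U ^+ e *m X') = X' *m U ^+ e.
  elim: e => [|e IHe]; first by rewrite !expr0 scale1r mul1mx mulmx1.
  rewrite exprSr [U ^+ e.+1]exprSr -[U ^+ e * U]/(U ^+ e *m U) -scalerA -mulmxA.
  by rewrite [zp *: _]scalemxAr UX' !mulmxA scalemxAl IHe.
have trU e : zp ^+ e != 1 -> \tr (U ^+ e) = 0.
  move=> ze1; have ze0 : zp ^+ e - 1 != 0 by rewrite subr_eq0.
  apply: (mulfI ze0); rewrite mulr0 mulrBl mul1r.
  rewrite -[in X in X - _](mulmxK X'_unit (U ^+ e)) mxtrace_mulC -mxtraceZ scalemxAr UX'n.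
  by rewrite mulmxA mulVmx // mul1mx subrr.
by split; [have := trU 1; rewrite !expr1; apply|exact: trU].
Qed.

Lemma twistedM n r (U : 'M[O]_n) (W : 'M[O]_r) (A : 'M_(r, n)) (B : 'M_(n, r)) X :
  A *m U = W *m A -> U *m B = B *m W -> twisted U X -> twisted W (A *m X *m B).
Proof.
move=> AU UB [X' X'X UX']; exists (A *m X' *m B); first by rewrite !map_mxM X'X.
transitivity (A *m (zp *: (U *m X')) *m B).
  by rewrite !mulmxA -AU -scalemxAr -scalemxAl !mulmxA.
by rewrite UX' -!mulmxA UB.
Qed.

(** Quantifying over all direct summands makes the notion available to inductions on
    the rank: the factorisations of the identity of a module restrict to its summands. *)
Definition rigid d (Y : 'M[O]_d) :=
  forall r (U : 'M[O]_r) (A : 'M_(d, r)) (B : 'M_(r, d)),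
    B *m A = 1%:M -> A *m U = Y *m A -> U *m B = B *m Y -> \tr (U ^+ t) = \tr U.

Definition rigid_factor n (U Z : 'M[O]_n) :=
  exists d (Y : 'M[O]_d) (A : 'M_(d, n)) (B : 'M_(n, d)),
    [/\ rigid Y, A *m U = Y *m A, U *m B = B *m Y & Z = B *m A].

Lemma idempotent_action n (U F : 'M[O]_n) : F *m F = F -> F *m U = U *m F ->
  exists r (W : 'M[O]_r) (A : 'M_(r, n)) (B : 'M_(n, r)),
    [/\ B *m A = F /\ A *m B = 1%:M, A *m U = W *m A, U *m B = B *m W
      & forall e, \tr (U ^+ e *m F) = \tr (W ^+ e)].
Proof.
move=> FF FU; have [r [B [A [BA AB]]]] := idempotent_split O_dvr FF.
pose W := A *m U *m B; exists r, W, A, B.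
have AF : A *m F = A by rewrite -BA mulmxA AB mul1mx.
have FB : F *m B = B by rewrite -BA -mulmxA AB mulmx1.
have AU : A *m U = W *m A by rewrite /W -mulmxA BA -mulmxA -FU mulmxA AF.
split=> // [|e]; first by rewrite /W !mulmxA BA FU -mulmxA FB.
have -> : W ^+ e = A *m U ^+ e *m B.
  elim: e => [|e IHe]; first by rewrite !expr0 mulmx1 AB.
  rewrite !exprS -[LHS]/(W *m _) IHe !mulmxA -AU; congr (_ *m _); exact: mulmxA.
by rewrite -BA mulmxA mxtrace_mulC mulmxA.
Qed.

(** Krull-Schmidt, in the form in which it is used: if the identity is a sum of
    a twisted endomorphism and of endomorphisms factoring through rigid lattices,
    then an indecomposable summand either is twisted, and has trace 0, or is a
    summand of a rigid lattice. *)
Lemma krull_schmidt_trace n (U : 'M[O]_n) X (I : finType) (Z : I -> 'M[O]_n) :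
  twisted U X -> (forall i, rigid_factor U (Z i)) -> X + \sum_i Z i = 1%:M ->
  \tr (U ^+ t) = \tr U.
Proof.
elim/ltn_ind: n U X Z => n IHn U X Z X_tw Z_rig sum1.
have [[E [EE EU E0 E1]]|indec] := pselect (exists E,
    [/\ E *m E = E, E *m U = U *m E, E != 0 & E != 1%:M]).
  have tr_summand (F : 'M[O]_n) : F *m F = F -> F *m U = U *m F -> F != 1%:M ->
      \tr (U ^+ t *m F) = \tr (U *m F).
    move=> FF FU F1.
    have [r [W [A [B [[BA AB] AU UB trE]]]]] := idempotent_action FF FU.
    have r_n : (r < n)%N.
      rewrite ltn_neqAle; apply/andP; split.
        apply: contraNneq F1 => rn; subst r.
        by rewrite -BA; apply/eqP/mulmx1C.
      (* ranks of matrices are compared over the field [k] *)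
      rewrite -(mxrank1 k r) -(map_mx1 res) -AB map_mxM.
      exact: leq_trans (mxrankM_maxr _ _) (rank_leq_row _).
    rewrite trE -[U in RHS]expr1 trE expr1.
    apply: (IHn r r_n W (A *m X *m B) (fun i => A *m Z i *m B)).
    - exact: twistedM X_tw.
    - move=> i; have [d [Y [A' [B' [Yr A'U UB' ->]]]]] := Z_rig i.
      exists d, Y, (A' *m B), (A *m B'); split=> //.
      - by rewrite -[LHS]mulmxA -UB mulmxA A'U mulmxA.
      - by rewrite mulmxA -AU -mulmxA UB' mulmxA.
      by rewrite !mulmxA.
    by rewrite -mulmx_suml -mulmx_sumr -mulmxDl -mulmxDr sum1 mulmx1.
  have split_tr (Y : 'M[O]_n) : \tr Y = \tr (Y *m E) + \tr (Y *m (1%:M - E)).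
    by rewrite -mxtraceD -mulmxDr addrC subrK mulmx1.
  rewrite (split_tr (U ^+ t)) (split_tr U) (tr_summand E) // (tr_summand (1%:M - E)) //.
  - by rewrite mulmxBl !mul1mx mulmxBr mulmx1 EE subrr subr0.
  - by rewrite mulmxBl mulmxBr mulmx1 mul1mx EU.
  by apply: contraNneq E0 => /eqP; rewrite -subr_eq0 addrC addKr oppr_eq0.
have {}indec E : E *m E = E -> E *m U = U *m E -> E = 0 \/ E = 1%:M.
  move=> EE EU; have [->|E0] := eqVneq E 0; first by left.
  have [->|E1] := eqVneq E 1%:M; first by right.
  by case: indec; exists E.
have ZU i : Z i *m U = U *m Z i.
  have [d [Y [A [B [_ AU UB ->]]]]] := Z_rig i.
  by rewrite -mulmxA AU !mulmxA UB.
have XU : X *m U = U *m X.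
  rewrite -[X](addrK (\sum_i Z i)) sum1 mulmxBl mulmxBr mul1mx mulmx1.
  by rewrite mulmx_suml mulmx_sumr; congr (_ - _); apply: eq_bigr.
have S_unit : X + \sum_i Z i \in unitmx by rewrite sum1 unitmx1.
have [X_unit|[i Zi]] := commutant_local_sum indec ZU XU S_unit.
  by have [-> ->] := twisted_trace0 X_tw X_unit.
have [d [Y [A [B [Y_rig AU UB ZE]]]]] := Z_rig i.
apply: (Y_rig n U A (invmx (Z i) *m B)) => //.
  by rewrite -mulmxA -ZE mulVmx.
rewrite -mulmxA -UB !mulmxA; congr (_ *m _).
by apply/esym/(canLR (mulKmx Zi)); rewrite mulmxA ZU -mulmxA mulmxV ?mulmx1.
Qed.

End KrullSchmidt.

(** * Lattices and traces of their endomorphisms *)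

Section Coordinates.

Variable O : idomainType.

(** A free module with a basis, as an isomorphism with column vectors. *)
Record coords (X : lmodType O) (n : nat) := Coords {
  co : {linear X -> 'cV[O]_n};
  inc : {linear 'cV[O]_n -> X};
  coK : cancel co inc;
  incK : cancel inc co }.

Definition mat X Y n m (cX : coords X n) (cY : coords Y m) (f : X -> Y) : 'M[O]_(m, n) :=
  \matrix_(i, j) co cY (f (inc cX (delta_mx j 0))) i 0.

Lemma cV_sum_delta n (v : 'cV[O]_n) : v = \sum_j v j 0 *: delta_mx j 0.
Proof.
apply/colP => i; rewrite summxE (bigD1 i) //= !mxE !eqxx mulr1 big1 ?addr0 // => j ji.
by rewrite !mxE eq_sym (negbTE ji) mulr0.
Qed.

Lemma eq_mulmx_cV m n (A B : 'M[O]_(m, n)) :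
  (forall v : 'cV_n, A *m v = B *m v) -> A = B.
Proof.
by move=> AB; apply/matrixP => i j; have := AB (delta_mx j 0);
   rewrite -!colE => /colP/(_ i); rewrite !mxE.
Qed.

Lemma mat_mul X Y n m (cX : coords X n) (cY : coords Y m) (f : {linear X -> Y}) v :
  mat cX cY f *m v = co cY (f (inc cX v)).
Proof.
rewrite [in RHS](cV_sum_delta v) !linear_sum; apply/colP => i.
rewrite mxE summxE; apply: eq_bigr => j _.
by rewrite !linearZ /= !mxE mulrC.
Qed.

Lemma mat_co X Y n m (cX : coords X n) (cY : coords Y m) (f : {linear X -> Y}) x :
  mat cX cY f *m co cX x = co cY (f x).
Proof. by rewrite mat_mul coK. Qed.

Lemma mat_eq X Y n m (cX : coords X n) (cY : coords Y m) (f g : X -> Y) :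
  f =1 g -> mat cX cY f = mat cX cY g.
Proof. by move=> fg; apply/matrixP => i j; rewrite !mxE fg. Qed.

Lemma mat_comp X Y Z n m l (cX : coords X n) (cY : coords Y m) (cZ : coords Z l)
    (g : {linear Y -> Z}) (f : {linear X -> Y}) :
  mat cX cZ (g \o f) = mat cY cZ g *m mat cX cY f.
Proof.
apply: eq_mulmx_cV => v; rewrite -mulmxA !mat_mul.
by rewrite /= coK.
Qed.

Lemma mat_id X n (cX : coords X n) : mat cX cX id = 1%:M.
Proof.
apply/matrixP => i j; rewrite !mxE incK mxE andbC; by rewrite eqxx.
Qed.

Lemma mat_sum X Y n m (cX : coords X n) (cY : coords Y m) (I : finType) (f : X -> Y)
    (g : I -> X -> Y) (a : I -> O) : (forall x, f x = \sum_i a i *: g i x) ->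
  mat cX cY f = \sum_i a i *: mat cX cY (g i).
Proof.
move=> fE; apply/matrixP => i j; rewrite mxE fE linear_sum summxE summxE.
by apply: eq_bigr => h _; rewrite linearZ /= !mxE.
Qed.

Definition lat_tr X n (cX : coords X n) (f : X -> X) : O := \tr (mat cX cX f).

Lemma lat_trC X Y n m (cX : coords X n) (cY : coords Y m)
    (f : {linear X -> Y}) (g : {linear Y -> X}) :
  lat_tr cX (g \o f) = lat_tr cY (f \o g).
Proof. by rewrite /lat_tr (mat_comp _ cY) (mat_comp _ cX) mxtrace_mulC. Qed.

Lemma lat_tr_eq X n (cX : coords X n) f g : f =1 g -> lat_tr cX f = lat_tr cX g.
Proof. by move=> fg; rewrite /lat_tr (mat_eq _ _ fg). Qed.

Lemma lat_tr_sum X n (cX : coords X n) (I : finType) (f : X -> X)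
    (g : I -> X -> X) (a : I -> O) : (forall x, f x = \sum_i a i *: g i x) ->
  lat_tr cX f = \sum_i a i * lat_tr cX (g i).
Proof.
move=> fE; rewrite /lat_tr (mat_sum cX cX fE) raddf_sum.
by apply: eq_bigr => i _; rewrite /= mxtraceZ.
Qed.

Lemma lat_tr_coords X n m (cX : coords X n) (cX' : coords X m) (f : {linear X -> X}) :
  lat_tr cX f = lat_tr cX' f.
Proof. exact: (lat_trC cX cX' f idfun). Qed.

(** ** Matrices as a lattice *)

Definition mx_co m n (Q : 'M[O]_(m, n)) : 'cV_(m * n) := (mxvec Q)^T.
Definition mx_inc m n (v : 'cV[O]_(m * n)) : 'M_(m, n) := vec_mx v^T.

Fact mx_co_linear m n : linear (@mx_co m n).
Proof. by move=> a Q R; rewrite /mx_co !linearP. Qed.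
HB.instance Definition _ m n := GRing.isLinear.Build O _ _ _ (@mx_co m n) (@mx_co_linear m n).

Fact mx_inc_linear m n : linear (@mx_inc m n).
Proof. by move=> a Q R; rewrite /mx_inc !linearP. Qed.
HB.instance Definition _ m n := GRing.isLinear.Build O _ _ _ (@mx_inc m n) (@mx_inc_linear m n).

Fact mx_coK m n : cancel (@mx_co m n) (@mx_inc m n).
Proof. by move=> Q; rewrite /mx_inc trmxK mxvecK. Qed.

Fact mx_incK m n : cancel (@mx_inc m n) (@mx_co m n).
Proof. by move=> v; rewrite /mx_co vec_mxK trmxK. Qed.

Definition mx_coords m n : coords 'M[O]_(m, n) (m * n) := Coords (@mx_coK m n) (@mx_incK m n).

Lemma lat_tr_mx m n (A : 'M[O]_m) (B : 'M[O]_n) :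
  lat_tr (mx_coords m n) (fun Q => A *m Q *m B) = \tr A * \tr B.
Proof.
rewrite /lat_tr /mxtrace; set d := mat _ _ _.
have dE i j : d (mxvec_index i j) (mxvec_index i j) = A i i * B j j.
  rewrite /d mxE /= /mx_co mxE mxvecE /mx_inc trmx_delta vec_mx_delta.
  rewrite -(mul_delta_mx (0 : 'I_1)) !mulmxA -mulmxA -colE -rowE mxE big_ord1.
  by rewrite !mxE.
rewrite (reindex _ (curry_mxvec_bij m n)) /= mulr_suml.
rewrite (eq_bigr (fun ij => A ij.1 ij.1 * B ij.2 ij.2)) => [|[i j] _]; last exact: dE.
rewrite -(pair_bigA _ (fun i j => A i i * B j j)) /=.
by apply: eq_bigr => i _; rewrite mulr_sumr.
Qed.

(** ** Bases *)

Lemma basis_coords (V : lmodType O) n (e : 'I_n -> V) : is_basis e ->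
  {c : coords V n | forall i, inc c (delta_mx i 0) = e i}.
Proof.
move=> eB; pose f (w : 'cV[O]_n) : V := \sum_i w i 0 *: e i.
have f_lin : linear f.
  move=> a v w; rewrite /f scaler_sumr -big_split; apply: eq_bigr => i _ /=.
  by rewrite !mxE scalerDl scalerA.
have f_surj v : exists w, f w = v.
  have [a [-> _]] := eB v; exists (\col_i a i).
  by apply: eq_bigr => i _; rewrite mxE.
have f_inj : injective f.
  move=> v w vw; have [a [_ aP]] := eB (f v).
  have h (x : 'cV_n) : f x = f v -> a = [ffun i => x i 0].
    by move=> fx; apply: aP; rewrite -fx; apply: eq_bigr => i _; rewrite ffunE.
  have := h v erefl; rewrite (h w (esym vw)) => /ffunP wv.
  by apply/colP => i; have := wv i; rewrite !ffunE.
pose g v := sval (cid (f_surj v)).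
have gK : cancel g f by move=> v; rewrite /g; case: cid.
have fK : cancel f g by move=> w; apply: f_inj; rewrite gK.
have g_lin : linear g.
  by move=> a v w; apply: f_inj; rewrite f_lin !gK.
pose F : {linear _ -> _} := HB.pack f (GRing.isLinear.Build O _ _ _ f f_lin).
pose G : {linear _ -> _} := HB.pack g (GRing.isLinear.Build O _ _ _ g g_lin).
exists (@Coords V n G F gK fK) => i /=.
rewrite /f (bigD1 i) //= mxE !eqxx scale1r big1 ?addr0 // => j ji.
by rewrite mxE (negbTE ji) scale0r.
Qed.

Lemma coords_basis (V : lmodType O) n (c : coords V n) :
  is_basis (fun i => inc c (delta_mx i 0)).
Proof.
move=> v; exists [ffun i => co c v i 0]; split.
  rewrite -[LHS](coK c) {1}(cV_sum_delta (co c v)) linear_sum.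
  by apply: eq_bigr => i _; rewrite linearZ ffunE.
move=> a ->; apply/ffunP => i; rewrite ffunE linear_sum summxE (bigD1 i) //=.
rewrite linearZ /= incK !mxE !eqxx mulr1 big1 ?addr0 // => j ji.
by rewrite linearZ /= incK !mxE eq_sym (negbTE ji) mulr0.
Qed.

(** A direct summand of a free module is the image of an idempotent matrix. *)
Lemma retract_coords (V : lmodType O) N (i : {linear V -> 'cV[O]_N})
    (r : {linear 'cV[O]_N -> V}) : complete_dvr O -> cancel i r ->
  exists n, inhabited (coords V n).
Proof.
move=> O_dvr ir; pose cN : coords 'cV[O]_N N := @Coords _ _ idfun idfun (fun=> erefl) (fun=> erefl).
pose E := mat cN cN (i \o r).
have EE v : E *m v = i (r v) by rewrite (mat_mul _ _ (i \o r)).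
have [|n [B [A [BA AB]]]] := @idempotent_split _ O_dvr _ E.
  by apply: eq_mulmx_cV => v; rewrite -mulmxA !EE ir.
exists n; constructor.
apply: (@Coords V n (mulmx A \o i) (r \o mulmx B)) => [v|w] /=.
  by rewrite mulmxA BA EE !ir.
by rewrite -EE -BA !mulmxA AB mul1mx AB mul1mx.
Qed.

(** ** Characters of lattices *)

Lemma lattice_characterP (gT : finGroupType) (V : gmod O gT) chi :
  lattice_character V chi <->
  exists n (c : coords V n), forall x, chi x = tofrac (lat_tr c (gmod_act V x)).
Proof.
split=> [[n [e [A [eB eA ->]]]]|[n [c chiE]]].
  have [c cE] := basis_coords eB; exists n, c => x; rewrite ffunE; congr (tofrac _).
  congr (\tr _); apply/matrixP => i j; rewrite mxE cE eA linear_sum summxE.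
  rewrite (bigD1 i) //= linearZ /= -cE incK !mxE !eqxx mulr1 big1 ?addr0 // => l li.
  by rewrite linearZ /= -cE incK !mxE eq_sym (negbTE li) mulr0.
exists n, (fun i => inc c (delta_mx i 0)), (fun x => mat c c (gmod_act V x)).
split=> [|x j|]; first exact: coords_basis; last by apply/ffunP => x; rewrite ffunE chiE.
rewrite -[LHS](coK c) {1}[co c _]cV_sum_delta linear_sum.
by apply: eq_bigr => i _; rewrite linearZ !mxE.
Qed.

End Coordinates.

(** * Permuted decompositions of the identity *)

(** An orbit whose length is divisible by [p] maps onto [Z/p], equivariantly for
    the translation. *)
Lemma orbit_grading (I : finType) (s : I -> I) p : injective s -> exists g : I -> nat,
  forall i, (p %| fingraph.order s i)%N -> g (s i) = (g i).+1 %[mod p].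
Proof.
move=> s_inj; exists (fun i => findex s (froot s i) i) => i p_i.
have sC : connect_sym (frel s) by exact: fconnect_sym.
have ri : fconnect s (froot s i) i by rewrite sC connect_root.
have -> : froot s (s i) = froot s i.
  by apply/eqP; rewrite root_connect // sC fconnect1.
set r := froot s i in ri *; set j := findex s r i.
have iE : iter j s r = i by exact: iter_findex.
have rE : fingraph.order s r = fingraph.order s i by exact/eq_card/same_connect.
have j_lt : (j < fingraph.order s r)%N by rewrite findex_max.
rewrite -{1}iE -iterS; case: (ltnP j.+1 (fingraph.order s r)) => [lt|ge].
  by rewrite findex_iter.
have -> : j.+1 = fingraph.order s r by apply/eqP; rewrite eqn_leq j_lt.
by rewrite iter_order // findex0 mod0n; apply/esym/eqP; rewrite rE.
Qed.

Lemma iter_order_dvd (I : finType) (s : I -> I) n i : injective s ->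
  iter n s i = i -> (fingraph.order s i %| n)%N.
Proof.
move=> s_inj; set d := fingraph.order s i; have d_gt0 : (0 < d)%N by exact: fingraph.order_gt0.
rewrite {1}(divn_eq n d) addnC iterD.
have -> : iter (n %/ d * d) s i = i.
  by elim: (n %/ d)%N => //= q IHq; rewrite mulSn iterD IHq iter_order.
move=> /(congr1 (findex s i)); rewrite findex_iter ?ltn_pmod // findex0.
by move/eqP.
Qed.

(** A nontrivial orbit has a length divisible by [p]. *)
Lemma p_orbit_grading (I : finType) (s : I -> I) p a : prime p -> injective s ->
  (forall i, iter (p ^ a) s i = i) -> exists g : I -> nat,
  forall i, s i != i -> g (s i) = (g i).+1 %[mod p].
Proof.
move=> p_pr s_inj s_pa; have [g gP] := orbit_grading p s_inj.
exists g => i si; apply: gP.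
have /(dvdn_pfactor _ _ p_pr)[[|m] _ oE] := iter_order_dvd s_inj (s_pa i).
  by have := iter_order s_inj i; rewrite oE => /eqP; rewrite (negbTE si).
by rewrite oE expnS dvdn_mulr.
Qed.

(** Projections onto the eigenspaces of an automorphism of finite order [m], over
    a domain containing [m]-th roots of unity and the inverse of [m]. *)
Lemma eigenprojectors (R : idomainType) n (S : 'M[R]_n) m (w : R) :
  S ^+ m = 1%:M -> m%:R \is a @GRing.unit R -> m.-primitive_root w ->
  exists e : 'I_m -> 'M[R]_n,
    [/\ forall j, S *m e j = (w ^+ j) ^+ m.-1 *: e j, forall j, e j *m e j = e j,
        \sum_j e j = 1%:M & forall j U, S *m U = U *m S -> e j *m U = U *m e j].
Proof.
move=> Sm mU wP; have m_gt0 := prim_order_gt0 wP.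
pose e (j : 'I_m) : 'M[R]_n := m%:R^-1 *: \sum_(i < m) (w ^+ j) ^+ i *: S ^+ i.
have wj (j : 'I_m) : (w ^+ j) ^+ m = 1.
  by rewrite -exprM mulnC exprM (prim_expr_order wP) expr1n.
have Se (j : 'I_m) : w ^+ j *: (S *m e j) = e j.
  rewrite /e -scalemxAr scalerA mulrC -scalerA; congr (_ *: _).
  rewrite mulmx_sumr scaler_sumr; pose F i := (w ^+ j) ^+ i *: S ^+ i.
  transitivity (\sum_(i < m) F i.+1).
    by apply: eq_bigr => i _; rewrite -scalemxAr scalerA -exprS -[S *m _]/(S * _) -exprS.
  have Fm : F m = F 0%N by rewrite /F wj Sm !expr0.
  have : \sum_(i < m.+1) F i = \sum_(i < m) F i.+1 + F 0%N.
    by rewrite big_ord_recl addrC; congr (_ + _); apply: eq_bigr.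
  by rewrite big_ord_recr /= Fm => /addIr.
have Sie (j : 'I_m) i : (w ^+ j) ^+ i *: (S ^+ i *m e j) = e j.
  elim: i => [|i IHi]; first by rewrite scale1r mul1mx.
  rewrite exprSr [S ^+ i.+1]exprSr -[_ * S]/(_ *m S) -scalerA -mulmxA.
  by rewrite [X in _ *: X]scalemxAr Se IHi.
have Se' (j : 'I_m) : S *m e j = (w ^+ j) ^+ m.-1 *: e j.
  by rewrite -[in RHS]Se scalerA -exprSr (prednK m_gt0) wj scale1r.
have ee (j : 'I_m) : e j *m e j = e j.
  rewrite {1}/e -scalemxAl mulmx_suml (eq_bigr (fun=> e j)) => [|i _].
    by rewrite sumr_const card_ord -scaler_nat scalerA mulVr // scale1r.
  by rewrite -scalemxAl Sie.
have sum_e : \sum_(j < m) e j = 1%:M.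
  rewrite /e -scaler_sumr exchange_big /=.
  rewrite (bigD1 (Ordinal m_gt0)) //= [X in _ + X]big1 ?addr0 => [|i i0].
    under eq_bigr do rewrite expr0 scale1r.
    by rewrite sumr_const card_ord -scaler_nat scalerA mulVr // scale1r.
  rewrite -scaler_suml; under eq_bigr do rewrite -exprM mulnC exprM.
  suff -> : \sum_(j < m) (w ^+ i) ^+ j = 0 by rewrite scale0r.
  have w1 : w ^+ i - 1 != 0.
    rewrite subr_eq0 -(prim_order_dvd wP); apply: contra i0 => /dvdn_leq.
    by case: posnP => [i0 _|_ /(_ isT)]; [apply/eqP/val_inj | rewrite leqNgt ltn_ord].
  by apply: (mulfI w1); rewrite mulr0 -subrX1 wj subrr.
exists e; split=> // j U SU.
  rewrite /e -scalemxAl -scalemxAr mulmx_suml mulmx_sumr; congr (_ *: _).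
  apply: eq_bigr => i _; rewrite -scalemxAl -scalemxAr; congr (_ *: _).
  by apply/esym/commrX/esym.
Qed.

Section Rigid.

Variables (O : idomainType) (k : fieldType) (res : {rmorphism O -> k}).
Hypotheses (O_dvr : complete_dvr O) (res_surj : forall y, exists x, res x = y).
Variables (p : nat) (zp : O) (t : nat).
Hypotheses (p_pr : prime p) (zpP : p.-primitive_root zp) (res_zp : res zp = 1).
Hypothesis p_t : coprime p t.

Let zp1 : zp != 1.
Proof. by rewrite -[zp]expr1 -(prim_order_dvd zpP) dvdn1 neq_ltn prime_gt1 ?orbT. Qed.

Let zpt1 : zp ^+ t != 1.
Proof. by rewrite -(prim_order_dvd zpP) -prime_coprime. Qed.

(** As [zp] reduces to 1, weighting the summands by powers of [zp] does not change
    their sum modulo the maximal ideal. *)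
Lemma twisted_grading n (U : 'M[O]_n) (I : finType) (P : pred I) (s : I -> I)
    (g : I -> nat) (x : I -> 'M[O]_n) :
  injective s -> (forall i, P (s i) = P i) ->
  (forall i, P i -> g (s i) = (g i).+1 %[mod p]) ->
  (forall i, U *m x i = x (s i) *m U) -> twisted res zp U (\sum_(i | P i) x i).
Proof.
move=> s_inj Ps gP Ux; exists (\sum_(i | P i) zp ^+ g i *: x i).
  rewrite !map_mx_sum; apply: eq_bigr => i _.
  by rewrite map_mxZ rmorphXn res_zp expr1n scale1r.
rewrite mulmx_sumr mulmx_suml scaler_sumr [RHS](reindex_inj s_inj) /=.
rewrite [RHS](eq_bigl P) //; apply: eq_bigr => i Pi.
rewrite -scalemxAr Ux scalerA -exprS -scalemxAl.
by rewrite -(prim_expr_mod zpP) -gP // prim_expr_mod.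
Qed.

Lemma twisted_orbits n (U : 'M[O]_n) (I : finType) (s : I -> I) a (x : I -> 'M[O]_n) :
  injective s -> (forall i, iter (p ^ a) s i = i) ->
  (forall i, U *m x i = x (s i) *m U) ->
  twisted res zp U (\sum_(i | s i != i) x i).
Proof.
move=> s_inj s_pa Ux; have [g gP] := p_orbit_grading p_pr s_inj s_pa.
by apply: twisted_grading gP Ux => // i; rewrite (inj_eq s_inj).
Qed.

Lemma rigid1 d : rigid t (1%:M : 'M[O]_d).
Proof.
move=> r U A B BA AU UB; suff -> : U = 1%:M by rewrite [1%:M ^+ t]expr1n.
by rewrite -[U]mulmx1 -BA mulmxA UB mulmx1.
Qed.

Lemma rigid_factor0 n (U : 'M[O]_n) : rigid_factor t U 0.
Proof.
exists 0, 1%:M, 0, 0; split; rewrite ?mul0mx ?mulmx0 //; exact: rigid1.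
Qed.

(** The sum over the nontrivial orbits is twisted, and the other terms are handled
    by hypothesis; both properties are inherited by summands. *)
Lemma orbit_rigid n (U : 'M[O]_n) (I : finType) (s : I -> I) a (x : I -> 'M[O]_n) :
  injective s -> (forall i, iter (p ^ a) s i = i) ->
  (forall i, U *m x i = x (s i) *m U) -> \sum_i x i = 1%:M ->
  (forall i, s i = i -> rigid_factor t U (x i)) -> rigid t U.
Proof.
move=> s_inj s_pa Ux sum1 fixed r W A B BA AW WB.
pose y i := B *m x i *m A.
have Wy i : W *m y i = y (s i) *m W.
  by rewrite /y !mulmxA WB -[B *m U *m _]mulmxA Ux -!mulmxA AW.
apply: (krull_schmidt_trace O_dvr res_surj zpt1 zp1 (twisted_orbits s_inj s_pa Wy)
         (Z := fun i => if s i == i then y i else 0)).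
  move=> i; case: eqP => [si|_]; last exact: rigid_factor0.
  have [d [Y [A' [B' [Yr A'U UB' xE]]]]] := fixed i si.
  exists d, Y, (A' *m A), (B *m B'); split=> //.
  - by rewrite -mulmxA AW !mulmxA A'U.
  - by rewrite mulmxA WB -mulmxA UB' mulmxA.
  by rewrite /y xE !mulmxA.
transitivity (\sum_i y i).
  by rewrite -big_mkcond addrC [RHS](bigID (fun i => s i == i)).
by rewrite -mulmx_suml -mulmx_sumr sum1 mulmx1.
Qed.

Lemma rigid_trace n (U : 'M[O]_n) : rigid t U -> \tr (U ^+ t) = \tr U.
Proof. by move=> Ur; apply: (Ur n U 1%:M 1%:M); rewrite ?mulmx1 ?mul1mx. Qed.

(** A lattice [V] on which a [p]-element acts by [R], such that conjugation by
    [R] permutes a basis [b] of [End V]. If there is no fixed basis element then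
    the identity of [V] is twisted. Otherwise the trace of [R] is nonzero, and for
    a summand [W] of [V] the lattice [Hom V W] is a summand of the permutation
    lattice [End V], so the product of the traces on [W] and on the dual of [V]
    is invariant. *)
Lemma endopermutation_rigid n (R R' : 'M[O]_n) a N (b : 'I_N -> 'M[O]_n)
    (s : 'I_N -> 'I_N) :
  (forall d, d.+1%:R != 0 :> O) ->
  R *m R' = 1%:M -> R ^+ (p ^ a) = 1%:M -> \tr (R' ^+ t) = \tr R' ->
  is_basis b -> (forall l, R *m b l *m R' = b (s l)) -> rigid t R.
Proof.
move=> O_char0 RR' Rpa trR' bB Rb; have R'R := mulmx1C RR'.
have [cF cFE] := basis_coords bB.
pose cf l Q := co cF Q l 0.
have cfE Q : Q = \sum_l cf l Q *: b l.
  rewrite -[LHS](coK cF) [co cF Q in LHS]cV_sum_delta linear_sum.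
  by apply: eq_bigr => l _; rewrite linearZ /= cFE.
have co_b l : co cF (b l) = delta_mx l 0 by rewrite -cFE incK.
have b_inj : injective b.
  move=> l l' /(congr1 (co cF)); rewrite !co_b => /colP/(_ l); rewrite !mxE eqxx.
  by have [//|_] := eqVneq l l'; move/eqP; rewrite oner_eq0.
have s_inj : injective s.
  move=> l l' ll'; apply: b_inj.
  have := Rb l; rewrite ll' -Rb => /(congr1 (fun Q => R' *m Q *m R)).
  by rewrite !mulmxA R'R !mul1mx -!mulmxA R'R !mulmx1.
have R'pa : R' ^+ (p ^ a) = 1%:M.
  have RR'n e : R ^+ e *m R' ^+ e = 1%:M.
    elim: e => [|e IHe]; first by rewrite mulmx1.
    rewrite exprSr exprS -[R ^+ e * R]/(R ^+ e *m R) -[R' * _]/(R' *m _).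
    by rewrite mulmxA -[R ^+ e *m R *m R']mulmxA RR' mulmx1.
  by have := RR'n (p ^ a)%N; rewrite Rpa mul1mx.
have s_pa l : iter (p ^ a) s l = l.
  apply: b_inj; have iterE e : b (iter e s l) = R ^+ e *m b l *m R' ^+ e.
    elim: e => [|e IHe]; first by rewrite mul1mx mulmx1.
    rewrite iterS -Rb IHe exprS exprSr -[R * _]/(R *m _) -[_ * R']/(_ *m R').
    by rewrite !mulmxA.
  by rewrite iterE Rpa R'pa mul1mx mulmx1.
have cf_s l Q : cf (s l) (R *m Q *m R') = cf l Q.
  rewrite /cf [in LHS](cfE Q) mulmx_sumr mulmx_suml linear_sum summxE (bigD1 l) //=.
  rewrite -scalemxAr -scalemxAl Rb linearZ /= co_b !mxE !eqxx mulr1 big1 ?addr0 // => l' l'l.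
  rewrite -scalemxAr -scalemxAl Rb linearZ /= co_b !mxE (inj_eq s_inj).
  by rewrite eq_sym (negbTE l'l) mulr0.
pose f := #|[pred l | s l == l]|.
(* the trace of conjugation by [R] counts the basis elements that it fixes *)
have trRR' : \tr R * \tr R' = f%:R.
  rewrite -lat_tr_mx (lat_tr_coords _ cF (mulmxr R' \o mulmx R)) /lat_tr /mxtrace.
  rewrite /f -sum1_card natr_sum [RHS]big_mkcond /=; apply: eq_bigr => l _.
  by rewrite mxE /= cFE Rb co_b mxE eqxx andbT inE eq_sym; case: eqP.
have [f0|f_gt0] := posnP f.
  have no_fix l : s l != l.
    by apply/negP => sl; have := card0_eq f0 l; rewrite inE sl.
  apply: (orbit_rigid (x := fun l => cf l 1%:M *: b l) s_inj s_pa).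
  - move=> l; rewrite -scalemxAr -scalemxAl -Rb -[in RHS]mulmxA R'R mulmx1.
    by rewrite -(cf_s l 1%:M) mulmx1 RR'.
  - by rewrite -cfE.
  - by move=> l /eqP; rewrite (negbTE (no_fix l)).
have trR'0 : \tr R' != 0.
  apply: contraTneq isT => R'0; move: trRR'; rewrite R'0 mulr0 => /esym/eqP.
  by rewrite -(prednK f_gt0) (negbTE (O_char0 _)).
move=> r W A B BA AW WB; apply: (mulIf trR'0); rewrite -{1}trR' -!lat_tr_mx.
(* [u] is the action on [Hom V W]; the [Bl l] and [Al l] make it a retract of [End V] *)
set c := mx_coords O r n; pose u := mulmxr R' \o mulmx W.
have uX e : mat c c (fun Q => W ^+ e *m Q *m R' ^+ e) = mat c c u ^+ e.
  elim: e => [|e IHe].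
    apply: etrans (mat_id c); apply: mat_eq => Q; by rewrite mul1mx mulmx1.
  rewrite [RHS]exprS -IHe -[_ * _]/(_ *m _).
  rewrite -(mat_comp c c c u (mulmxr (R' ^+ e) \o mulmx (W ^+ e))).
  apply: mat_eq => Q; rewrite exprS exprSr -[W * _]/(W *m _) -[_ * R']/(_ *m R') /=.
  by rewrite !mulmxA.
rewrite /lat_tr uX; apply: rigid_trace.
pose Bl l : 'cV_(r * n) := co c (B *m b l).
pose Al l : 'M[O]_(1, r * n) := \row_j cf l (A *m inc c (delta_mx j 0)).
have AlE l v : Al l *m v = (cf l (A *m inc c v))%:M.
  apply/matrixP => i j; rewrite !ord1 !mxE eqxx mulr1n /cf [in RHS](cV_sum_delta v).
  rewrite linear_sum mulmx_sumr linear_sum summxE; apply: eq_bigr => h _.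
  by rewrite linearZ -scalemxAr linearZ !mxE mulrC.
have uE v : mat c c u *m v = co c (W *m inc c v *m R') by rewrite mat_mul.
have uBl l : mat c c u *m Bl l = Bl (s l).
  by rewrite uE /Bl coK -Rb !mulmxA WB.
have Alu l : Al (s l) *m mat c c u = Al l.
  apply: eq_mulmx_cV => v; rewrite -mulmxA uE !AlE coK !mulmxA AW.
  by rewrite -[R *m A *m _]mulmxA cf_s.
apply: (orbit_rigid (x := fun l => Bl l *m Al l) s_inj s_pa).
- by move=> l; rewrite mulmxA uBl -mulmxA Alu.
- apply: eq_mulmx_cV => v; rewrite mulmx_suml mul1mx.
  rewrite -[RHS](incK c) -[in RHS](mul1mx (inc c v)) -BA -mulmxA.
  rewrite [in RHS](cfE (A *m _)) mulmx_sumr linear_sum; apply: eq_bigr => l _ /=.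
  by rewrite -mulmxA AlE mul_mx_scalar -scalemxAr linearZ.
move=> l sl; exists 1%N, 1%:M, (Al l), (Bl l); split=> //; first exact: rigid1.
  by rewrite mul1mx -{1}sl Alu.
by rewrite mulmx1 uBl sl.
Qed.

(** Splitting a lattice into the eigenspaces of an automorphism [S] of order
    prime to [p] extends rigidity from [U] to [U *m S]. *)
Lemma rigid_eigen n (U S : 'M[O]_n) m (w : O) : rigid t U -> S *m U = U *m S ->
  S ^+ m = 1%:M -> m%:R \is a @GRing.unit O -> m.-primitive_root w ->
  \tr (U ^+ t *m S) = \tr (U *m S).
Proof.
move=> Ur SU Sm mU wP.
have [e [Se' ee sum_e eS]] := eigenprojectors Sm mU wP.
have eU j : e j *m U = U *m e j by apply: eS.
have tre (j : 'I_m) : \tr (U ^+ t *m e j) = \tr (U *m e j).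
  have [r [W [A [B [[BA AB] AU UB trE]]]]] := idempotent_action O_dvr (ee j) (eU j).
  by rewrite trE -[U in RHS]expr1 trE expr1; apply: (Ur r W B A).
have trS X : \tr (X *m S) = \sum_(j < m) (w ^+ j) ^+ m.-1 * \tr (X *m e j).
  rewrite -[S]mulmx1 -sum_e !mulmx_sumr raddf_sum; apply: eq_bigr => j _ /=.
  by rewrite Se' -scalemxAr mxtraceZ.
by rewrite !trS; apply: eq_bigr => j _; rewrite tre.
Qed.

End Rigid.

(** * Traces of matrices of finite order *)

Lemma frac_num_den (R : idomainType) (x : {fraction R}) :
  exists a b : R, b != 0 /\ x = tofrac a / tofrac b.
Proof.
elim/quotW: x => r; exists (frac r).1, (frac r).2; split; first exact: denom_ratioP.
have d0 : tofrac (frac r).2 != 0 :> {fraction R} by rewrite tofrac_eq0 denom_ratioP.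
apply: (canRL (mulfK d0)).
rewrite [LHS](_ : _ = FracField.mul (\pi_{fraction R} r)%qT (tofrac (frac r).2)) //.
rewrite !piE; apply/eqmodP; rewrite /= FracField.equivfE.
rewrite /FracField.mulf !numden_Ratio ?mulf_neq0 ?oner_neq0 ?denom_ratioP //.
by rewrite !mulr1 mulrC.
Qed.

Lemma idempotent_factor (F : fieldType) n (E : 'M[F]_n) : E *m E = E ->
  exists (C : 'M_(n, \rank E)) (W : 'M_(\rank E, n)), C *m W = E /\ W *m C = 1%:M.
Proof.
move=> EE; exists (col_base E), (row_base E).
move: (mulmx_base E) (col_base_full E) (row_base_free E).
move: (col_base E) (row_base E) => C W CW C_full W_free.
split=> //; apply: (row_free_inj W_free); apply: (row_full_inj C_full).
by rewrite /= mul1mx -!mulmxA CW mulmxA CW EE.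
Qed.

Lemma mxtrace_idempotent (F : fieldType) n (E : 'M[F]_n) : E *m E = E ->
  \tr E = (\rank E)%:R.
Proof.
by move=> /idempotent_factor[C [W [CW WC]]]; rewrite -{1}CW mxtrace_mulC WC mxtrace1.
Qed.

(** The trace is a combination of powers of [w] with the ranks of the eigenprojectors
    as coefficients. *)
Lemma trace_evq (K : fieldType) (f : {rmorphism rat -> K}) N (w : K) n (A : 'M[K]_n) :
  N.-primitive_root w -> A ^+ N = 1%:M ->
  exists q, forall j, \tr (A ^+ j) = evq f q (w ^+ j).
Proof.
move=> wP AN.
have NU : N%:R \is a @GRing.unit K by rewrite unitfE (prim_root_natf_neq0 wP).
have [e [Ae ee sum_e _]] := eigenprojectors AN NU wP.
exists (\sum_(i < N) (\rank (e i))%:R *: 'X^(i * N.-1)) => j.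
rewrite -[A ^+ j]mulmx1 -sum_e mulmx_sumr raddf_sum /evq rmorph_sum horner_sum.
apply: eq_bigr => i _; rewrite /= map_polyZ map_polyXn hornerZ hornerXn rmorph_nat.
have -> : A ^+ j *m e i = ((w ^+ i) ^+ N.-1) ^+ j *: e i.
  elim: j => [|j IHj]; first by rewrite mul1mx scale1r.
  rewrite exprS -[A * _]/(A *m _) -mulmxA IHj -scalemxAr Ae scalerA -exprSr //.
by rewrite mxtraceZ mxtrace_idempotent // mulrC -!exprM; congr (_ * _ ^+ _); lia.
Qed.

Section RootsOfUnity.

Variables (p : nat) (O : idomainType) (k : fieldType) (res : {rmorphism O -> k}).
Hypotheses (p_pr : prime p) (O_dvr : complete_dvr O).
Hypothesis res_surj : forall y : k, exists x : O, res x = y.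
Hypotheses (k_char : p \in [pchar k]) (K_char : [pchar {fraction O}] =i pred0).
Variables (N : nat) (mu : {fraction O}).
Hypothesis mu_prim : N.-primitive_root mu.
Local Notation K := {fraction O}.

Lemma O_char0 d : d.+1%:R != 0 :> O.
Proof.
rewrite -(tofrac_eq0 (d.+1%:R : O)) rmorph_nat.
by have /pcharf0P -> := K_char.
Qed.

Lemma pprime_unit m : coprime p m -> m%:R \is a @GRing.unit O.
Proof.
move=> pm; have [_ [pi piP _]] := O_dvr.
have := res_eq0 res_surj (m%:R : O) piP; rewrite rmorph_nat -(dvdn_pcharf k_char).
by move: pm; rewrite prime_coprime // => /negbTE-> /esym/negbFE.
Qed.

(** One of the numerator and the denominator divides the other; and if the inverse of
    a root of unity is integral, then so is the root, which is a power of its inverse. *)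
Lemma unity_root_integral (x : K) n : (0 < n)%N -> x ^+ n = 1 -> exists y : O, tofrac y = x.
Proof.
move=> n_gt0 xn; have [a [b [b0 xE]]] := frac_num_den x.
have fb0 : tofrac b != 0 :> K by rewrite tofrac_eq0.
have [[c aE]|[c bE]] := dvr_total O_dvr a b.
  by exists c; rewrite xE aE rmorphM mulfK.
have a0 : a != 0 by apply: contraNneq b0 => a0; rewrite bE a0 mulr0.
have fa0 : tofrac a != 0 :> K by rewrite tofrac_eq0.
have xc : x * tofrac c = 1.
  by rewrite xE mulrAC; apply: (canLR (mulfK fb0)); rewrite mul1r mulrC bE rmorphM.
exists (c ^+ n.-1); rewrite rmorphXn -[LHS]mul1r -xn -{1}(prednK n_gt0) exprS.
by rewrite -mulrA -exprMn xc expr1n mulr1.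
Qed.

Lemma prim_root_in_O d : (d %| N)%N -> exists w : O, d.-primitive_root w.
Proof.
move=> dN; have xP := dvdn_prim_root mu_prim dN.
have [w wE] := unity_root_integral (prim_order_gt0 xP) (prim_expr_order xP).
exists w; have := xP; rewrite -wE !/(primitive_root_of_unity _ _).
have n_gt0 := prim_order_gt0 xP; rewrite /primitive_root_of_unity n_gt0 /=.
congr (_ = true); apply: eq_forallb => i; congr (_ == _).
by rewrite !unity_rootE -rmorphXn -(rmorph1 (@tofrac O)) tofrac_eq.
Qed.

(** The Frobenius endomorphism of [k] is injective. *)
Lemma res_p_root w : w ^+ p = 1 -> res w = 1.
Proof.
move=> wp; apply/eqP; rewrite -subr_eq0.
suff: (res w - 1) ^+ p == 0 by rewrite expf_eq0 prime_gt0.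
have := pFrobenius_autB_comm k_char (commr1 (res w)).
by rewrite pFrobenius_aut1 !pFrobenius_autE -rmorphXn wp rmorph1 subrr => ->; rewrite eqxx.
Qed.

End RootsOfUnity.

(** * Invariance of characters under power maps *)

Section GroupMatrices.

Variables (O : idomainType) (gT : finGroupType) (M : gmod O gT) (n : nat) (c : coords M n).

Definition rho x := mat c c (gmod_act M x).

Lemma rho1 : rho 1%g = 1%:M.
Proof. by rewrite -(mat_id c); apply: mat_eq => m; exact: gmod_act1. Qed.

Lemma rhoM x y : rho (x * y)%g = rho x *m rho y.
Proof. by rewrite -mat_comp; apply: mat_eq => m; exact: gmod_actM. Qed.

Lemma rhoX x e : rho (x ^+ e)%g = rho x ^+ e.
Proof.
by elim: e => [|e IHe]; rewrite ?expg0 ?rho1 // expgS rhoM IHe [RHS]exprS.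
Qed.

End GroupMatrices.

Section GroupAlgebra.

Variables (R : comNzRingType) (gT : finGroupType).
Implicit Type a c : galg R gT.

Lemma galg_mulE a c z : (a * c) z = \sum_x (a x : R) * c (x^-1 * z)%g.
Proof. by rewrite ffunE. Qed.

Lemma galg_geltl s a z : (gelt R s * a) z = a (s^-1 * z)%g.
Proof.
rewrite galg_mulE (bigD1 s) //= ffunE eqxx mul1r big1 ?addr0 // => x xs.
by rewrite ffunE (negbTE xs) mul0r.
Qed.

Lemma galg_geltr s a z : (a * gelt R s) z = a (z * s^-1)%g.
Proof.
rewrite galg_mulE (bigD1 (z * s^-1)%g) //= ffunE invMg invgK mulgKV eqxx mulr1.
rewrite big1 ?addr0 // => x xs; rewrite ffunE; case: eqP => [sE|_]; last by rewrite mulr0.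
by rewrite -sE invMg invgK mulKVg eqxx in xs.
Qed.

Lemma galg_geltE a : a = \sum_x a x *: gelt R x.
Proof.
apply/ffunP => z; rewrite sum_ffunE (bigD1 z) //= !ffunE eqxx big1 => [|x xz].
  by rewrite addr0 [RHS]mulr1.
by rewrite !ffunE eq_sym (negbTE xz) [LHS]mulr0.
Qed.

Lemma gelt_act (V : gmod R gT) x v : galg_act (gelt R x) v = gmod_act V x v.
Proof.
rewrite /galg_act (bigD1 x) //= ffunE eqxx scale1r big1 ?addr0 // => y yx.
by rewrite ffunE (negbTE yx) scale0r.
Qed.

End GroupAlgebra.

Lemma gelt_ract (R : comNzRingType) (gT' gT : finGroupType) (M : gmod R (gT' * gT)%type)
    (m : M) y : bimod_ract m (gelt R y) = gmod_act M (1, y^-1)%g m.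
Proof.
rewrite /bimod_ract; have -> : antipode (gelt R y) = gelt R y^-1%g.
  by apply/ffunP => x; rewrite !ffunE (canF_eq invgK).
exact: (@gelt_act _ _ (rres M)).
Qed.

Lemma bimod_ract_sum (R : comNzRingType) (gT' gT : finGroupType)
    (M : gmod R (gT' * gT)%type) (m : M) a :
  bimod_ract m a = \sum_y a y *: gmod_act M (1, y^-1)%g m.
Proof.
rewrite /bimod_ract /galg_act (reindex_inj invg_inj); apply: eq_bigr => y _.
by rewrite ffunE invgK.
Qed.

Lemma tensor_ext (R : comNzRingType) (gT' gT : finGroupType) (b : galg R gT)
    (M : gmod R (gT' * gT)%type) (U : gmod R gT) (T : lmodType R) (t : M -> U -> T)
    (W : lmodType R) (f g : {linear T -> W}) :
  is_tensor b t -> (forall m u, f (t m u) = g (t m u)) -> f =1 g.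
Proof.
move=> [[lin1 lin2 bal] univ] fg.
have [|h [_ h_uniq]] := univ W (fun m u => f (t m u)).
  split=> [u a m m'|m a u u'|a ab m u]; first by rewrite lin1 linearP.
    by rewrite lin2 linearP.
  by rewrite bal.
by move=> x; rewrite (h_uniq f) // (h_uniq g).
Qed.

Section PowerMaps.

Variables (p : nat) (O : idomainType) (k : fieldType) (res : {rmorphism O -> k}).
Hypotheses (p_pr : prime p) (O_dvr : complete_dvr O).
Hypothesis res_surj : forall y : k, exists x : O, res x = y.
Hypotheses (k_char : p \in [pchar k]) (K_char : [pchar {fraction O}] =i pred0).
Variables (N : nat) (mu : {fraction O}).
Hypothesis mu_prim : N.-primitive_root mu.
Variable t : nat.
Hypotheses (tN : coprime t N) (t1 : t = 1 %[mod (N`_p^')%N]).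
Local Notation K := {fraction O}.

Section Trace.
Variables (gT : finGroupType) (M : gmod O gT) (n : nat) (c : coords M n).

(** The power map fixes the part of [z] of order prime to [p]. *)
Lemma rigid_group_trace (z : gT) : (#[z]%g %| N)%N -> rigid t (rho c (z.`_p)%g) ->
  lat_tr c (gmod_act M (z ^+ t)%g) = lat_tr c (gmod_act M z).
Proof.
move=> zN Ur; have N_gt0 := prim_order_gt0 mu_prim.
pose u := (z.`_p)%g; pose s := (z.`_p^')%g; rewrite -/u in Ur.
have sN : (#[s]%g %| N`_p^')%N by rewrite order_constt partn_dvd.
have st : (s ^+ t)%g = s.
  apply/eqP; rewrite -[X in _ == X]expg1 eq_expg_mod_order; apply/eqP.
  by rewrite -(modn_dvdm t sN) t1 modn_dvdm.
have us : (u * s)%g = z by exact: consttC.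
have cus : commute u s by rewrite /commute -!expgD addnC.
have [w wP] := prim_root_in_O O_dvr mu_prim (dvdn_trans sN (dvdn_part _ _)).
have Su : rho c s *m rho c u = rho c u *m rho c s by rewrite -!rhoM cus.
have s1 : rho c s ^+ #[s]%g = 1%:M by rewrite -rhoX expg_order rho1.
have sU : #[s]%g%:R \is a @GRing.unit O.
  apply: (pprime_unit p_pr O_dvr res_surj k_char).
  rewrite coprime_sym (coprime_dvdl sN) // coprime_sym.
  by rewrite (@pnat_coprime p) ?pnat_id ?part_pnat.
have := rigid_eigen O_dvr Ur Su s1 sU wP.
by rewrite -rhoX -!rhoM -[in (_ * s)%g]st -expgMn // us.
Qed.

Lemma group_orbit_rigid (u : gT) (I : finType) (s : I -> I) (x : I -> 'M[O]_n) :
  (p.-elt u)%g -> (#[u]%g %| N)%N ->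
  injective s -> (forall i, iter #[u]%g s i = i) ->
  (forall i, rho c u *m x i = x (s i) *m rho c u) -> \sum_i x i = 1%:M ->
  (forall i, s i = i -> rigid_factor t (rho c u) (x i)) -> rigid t (rho c u).
Proof.
move=> pu uN s_inj s_u ux sum1 fixed.
have [a uE] := p_natP pu.
(* if [u] is trivial, [O] may contain no primitive [p]-th root of unity *)
case: a uE => [|a] uE.
  have -> : u = 1%g by apply/eqP; rewrite -order_eq1 uE.
  by rewrite rho1; exact: rigid1.
have pN : (p %| N)%N by apply: dvdn_trans uN; rewrite uE expnS dvdn_mulr.
have [zp zpP] := prim_root_in_O O_dvr mu_prim pN.
have res_zp := res_p_root res p_pr k_char (prim_expr_order zpP).
have p_t : coprime p t by rewrite coprime_sym (coprime_dvdr pN).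
rewrite uE in s_u.
exact: (orbit_rigid O_dvr res_surj p_pr zpP res_zp p_t s_inj s_u ux sum1 fixed).
Qed.

End Trace.

(** Integers are fixed by the conjugation [mu |-> mu ^+ t]. *)
Lemma int_trace_invariant n (A : 'M[O]_n) z : A ^+ N = 1%:M ->
  tofrac (\tr A) = z%:~R :> K -> \tr (A ^+ t) = \tr A.
Proof.
move=> AN Az; have [f _] := ratr_rmorphism K_char.
pose A' : 'M[K]_n := map_mx (@tofrac O) A.
have A'X j : A' ^+ j = map_mx (@tofrac O) (A ^+ j).
  elim: j => [|j IHj]; first by rewrite map_mx1.
  by rewrite !exprS IHj; apply/esym/map_mxM.
have A'N : A' ^+ N = 1%:M by rewrite A'X AN map_mx1.
have [q qE] := trace_evq f mu_prim A'N.
have trE j : tofrac (\tr (A ^+ j)) = evq f q (mu ^+ j) by rewrite -qE A'X trace_map_mx.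
have zE w : evq f (z%:~R)%:P w = z%:~R by rewrite /evq map_polyC hornerC /= rmorph_int.
apply/eqP; rewrite -tofrac_eq; apply/eqP; rewrite trE Az -(zE (mu ^+ t)).
apply: (@prim_root_transfer_eq _ _ f f _ mu _ _ _ mu_prim); first by rewrite prim_root_exp_coprime.
by rewrite zE -Az -[A in RHS]expr1 trE expr1.
Qed.

Lemma basis_transport (X Y : lmodType O) (f : {linear X -> Y}) (g : Y -> X) n
    (e : 'I_n -> X) : cancel f g -> cancel g f -> is_basis e -> is_basis (f \o e).
Proof.
move=> fK gK eB y; have [a [yE a_uniq]] := eB (g y); exists a; split.
  by rewrite -[LHS]gK yE linear_sum; apply: eq_bigr => i _; rewrite linearZ.
move=> a' a'E; apply: a_uniq; apply: (can_inj fK); rewrite gK a'E linear_sum.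
by apply: eq_bigr => i _; rewrite linearZ.
Qed.

Lemma endopermutation_group_rigid (gT : finGroupType) (V : gmod O gT) n (c : coords V n) x :
  endopermutation p V ->
  (forall chi, lattice_character V chi -> forall x, exists z : int, chi x = z%:~R) ->
  (#[x]%g %| N)%N -> rigid t (rho c x).
Proof.
move=> [pG _ [Nb [e [eB perm]]]] V_int xN.
have px : (p.-elt x)%g by apply: mem_p_elt pG (finset.in_setT x).
have [a xE] := p_natP px.
case: a xE => [|a] xE.
  have -> : x = 1%g by apply/eqP; rewrite -order_eq1 xE.
  by rewrite rho1; exact: rigid1.
have pN : (p %| N)%N by apply: dvdn_trans xN; rewrite xE expnS dvdn_mulr.
have [zp zpP] := prim_root_in_O O_dvr mu_prim pN.
have res_zp := res_p_root res p_pr k_char (prim_expr_order zpP).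
have p_t : coprime p t by rewrite coprime_sym (coprime_dvdr pN).
have hom_lin (f : Defs.hom V V) : linear f by have /asboolP := hom_funP f.
pose lin (f : Defs.hom V V) : {linear V -> V} := HB.pack (hom_fun f)
  (GRing.isLinear.Build O V V _ f (hom_lin f)).
pose m (f : Defs.hom V V) : 'M[O]_n := mat c c (lin f).
have m_lin : linear m.
  by move=> b f g; apply/matrixP => i j; rewrite !mxE linearP !mxE.
pose mL : {linear Defs.hom V V -> 'M[O]_n} := HB.pack m
  (GRing.isLinear.Build O _ _ _ m m_lin).
have inv_lin (Q : 'M[O]_n) : (fun v => inc c (Q *m co c v)) \in @is_linear O V V.
  by apply/asboolP => b u v; rewrite linearP mulmxDr -scalemxAr linearP.
pose m' (Q : 'M[O]_n) := Defs.Hom (inv_lin Q).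
have mK : cancel mL m'.
  by move=> f; apply/val_inj/funext => v; rewrite /= /m mat_mul !coK.
have m'K : cancel m' mL.
  by move=> Q; apply: eq_mulmx_cV => v; rewrite [LHS]mat_mul /= !incK.
have [s sE] := fin_all_exists (perm x).
have Rb l : rho c x *m m (e l) *m rho c x^-1%g = m (e (s l)).
  by rewrite -sE -!mat_comp; apply: mat_eq.
have xV : rho c x *m rho c x^-1%g = 1%:M by rewrite -rhoM mulgV rho1.
have xa : rho c x ^+ (p ^ a.+1) = 1%:M by rewrite -rhoX -xE expg_order rho1.
apply: (endopermutation_rigid O_dvr res_surj p_pr zpP res_zp p_t (O_char0 K_char) xV xa
  _ (basis_transport mK m'K eB) Rb).
have [|z zE] := V_int [ffun y => tofrac (lat_tr c (gmod_act V y))] _ x^-1%g.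
  by apply/lattice_characterP; exists n, c => y; rewrite ffunE.
rewrite ffunE in zE; apply: int_trace_invariant zE.
rewrite -rhoX; have /eqP-> : (x^-1 ^+ N == 1)%g by rewrite -order_dvdn orderV.
exact: rho1.
Qed.

(** ** Summands of induced modules *)

Section Source.

Variables (gT : finGroupType) (P : {group gT}) (V : gmod O (subg_of P)).
Variables (M I : gmod O gT).
Hypotheses (V_ind : is_induced V I) (M_sum : gsummand M I).

(** The left cosets of [P] are the sets [C] equal to [(repr C *: P)%g]. *)
Lemma cosets_sum (E : nmodType) (F : gT -> E) :
  \sum_(C : {set gT} | C == (repr C *: P)%g) \sum_(x : subg_of P) F (repr C * sgval x)%g
   = \sum_y F y.
Proof.
rewrite [RHS](partition_big (fun y => (y *: P)%g) (fun C => C == (repr C *: P)%g)) /=; last first.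
  move=> y _; rewrite eq_sym; apply/eqP/lcoset_eqP; exact: mem_repr (lcoset_refl P y).
apply: eq_bigr => C /eqP CE.
rewrite (reindex (fun x : subg_of P => (repr C * sgval x)%g)); last first.
  exists (fun y => subg P ((repr C)^-1 * y)%g) => [x _|y]; first by rewrite mulKg sgvalK.
  rewrite inE {1}CE => /eqP yC; rewrite subgK ?mulKVg // -mem_lcoset -yC.
  exact: lcoset_refl.
apply: eq_bigl => x; rewrite [X in _ == X]CE; apply/esym/eqP/lcoset_eqP.
by rewrite mem_lcoset mulKg subgP.
Qed.

(** An induced module is the direct sum of translates of [V] indexed by the cosets of
    [P], onto which the universal property of the tensor product projects; and [M] is a
    retract of it. *)
Lemma source_maps : exists (A : gT -> {linear M -> V}) (B : gT -> {linear V -> M}),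
  [/\ forall h z m, A (z * h)%g (gmod_act M z m) = A h m,
      forall h z v, gmod_act M z (B h v) = B (z * h)%g v,
      forall h x m, A (h * sgval x)%g m = gmod_act V x^-1%g (A h m),
      forall h x v, B (h * sgval x)%g v = B h (gmod_act V x v)
    & forall m, m = \sum_(C | C == (repr C *: P)%g) B (repr C) (A (repr C) m)].
Proof.
have [T [[T_lin1 T_lin2 T_bal] T_univ] T_act] := V_ind.
set G := gpull _ _ in T T_lin1 T_lin2 T_bal T_univ T_act.
have actl z (a : G) : gmod_act G (z, 1)%g a = gelt O z * a.
  by rewrite /= /greg_act /= invg1 -[gelt O 1]/(1 : galg O gT) mulr1.
have ractE (a : G) x : bimod_ract a (gelt O x) = a * gelt O (sgval x).
  by rewrite gelt_ract /= /greg_act /= invgK -[gelt O 1]/(1 : galg O gT) mul1r.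
(* the component of the tensor of [a] and [v] in the translate of [V] by [h] *)
pose F h (a : G) (v : V) : V := \sum_(x : subg_of P) (a (h * sgval x)%g : O) *: gmod_act V x v.
have F_bal h : balanced 1 (F h).
  split=> [v b a a'|a b v v'|a _ m v].
  - rewrite /F scaler_sumr -big_split; apply: eq_bigr => x _ /=.
    by rewrite !ffunE scalerDl scalerA.
  - rewrite /F scaler_sumr -big_split; apply: eq_bigr => x _ /=.
    by rewrite linearP scalerDr !scalerA mulrC.
  transitivity (\sum_y \sum_x (a y * m (h * sgval (x * y^-1))%g) *: gmod_act V x v).
    rewrite exchange_big; apply: eq_bigr => x _ /=; rewrite -scaler_suml; congr (_ *: _).
    rewrite bimod_ract_sum sum_ffunE; apply: eq_bigr => y _.
    rewrite ffunE -gelt_ract ractE galg_geltr; congr (_ * m _).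
    by rewrite /= mulgA.
  rewrite /F /galg_act; under [RHS]eq_bigr do rewrite linear_sum scaler_sumr.
  rewrite [RHS]exchange_big; apply: eq_bigr => y _ /=.
  rewrite (reindex_inj (mulIg y)); apply: eq_bigr => x _ /=.
  by rewrite linearZ scalerA -gmod_actM mulrC mulgK.
have exP h : exists Q : {linear I -> V}, forall a v, Q (T a v) = F h a v.
  by have [Q [QE _]] := T_univ V (F h) (F_bal h); exists Q.
have [Q QE] := choice exP.
have ext (W : lmodType O) (f g : {linear I -> W}) : (forall a v, f (T a v) = g (T a v)) -> f =1 g.
  exact: tensor_ext (conj (And3 T_lin1 T_lin2 T_bal) T_univ).
have T_geltr h (x : subg_of P) v : T (gelt O (h * sgval x)%g : G) v = T (gelt O h : G) (gmod_act V x v).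
  by rewrite -gelt_act -T_bal ?mulr1 // ractE geltM.
have [J JE] : exists J : gT -> {linear V -> I}, forall h v, J h v = T (gelt O h) v.
  pose J h : {linear V -> I} := HB.pack (T (gelt O h))
    (GRing.isLinear.Build O V I _ (T (gelt O h)) (T_lin2 (gelt O h))).
  by exists J.
have zQ h z w : Q (z * h)%g (gmod_act I z w) = Q h w.
  apply: (ext V (Q (z * h)%g \o gmod_act I z) (Q h)) => a v /=.
  rewrite -T_act !QE; apply: eq_bigr => x _; congr (_ *: _).
  by rewrite actl galg_geltl -mulgA mulKg.
have Qx h x w : Q (h * sgval x)%g w = gmod_act V x^-1%g (Q h w).
  apply: (ext V (Q (h * sgval x)%g) (gmod_act V x^-1%g \o Q h)) => a v /=.
  rewrite !QE /F linear_sum [RHS](reindex_inj (mulgI x)) /=; apply: eq_bigr => y _.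
  by rewrite linearZ /= -gmod_actM mulKg mulgA.
have zJ h z v : gmod_act I z (J h v) = J (z * h)%g v by rewrite !JE -T_act actl geltM.
have sumQ w : w = \sum_(C | C == (repr C *: P)%g) J (repr C) (Q (repr C) w).
  pose S (w : I) : I := \sum_(C | C == (repr C *: P)%g) J (repr C) (Q (repr C) w).
  have S_lin : linear S.
    move=> a u v; rewrite /S scaler_sumr -big_split; apply: eq_bigr => C _ /=.
    by rewrite !linearP.
  pose SL : {linear I -> I} := HB.pack S (GRing.isLinear.Build O I I _ S S_lin).
  apply/esym/(ext I SL idfun) => a v /=; rewrite /S.
  transitivity (T (\sum_y a y *: gelt O y) v); last by rewrite -galg_geltE.
  have T_lin x : T (\sum_y a y *: x y : G) v = \sum_y a y *: T (x y) v.
    pose Tv : {linear G -> I} := HB.pack (T^~ v) (GRing.isLinear.Build O G I _ (T^~ v) (T_lin1 v)).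
    have -> : T (\sum_y a y *: x y) v = Tv (\sum_y a y *: x y) by [].
    by rewrite linear_sum; apply: eq_bigr => y _; rewrite linearZ.
  rewrite T_lin -cosets_sum; apply: eq_bigr => C _.
  rewrite QE /F linear_sum; apply: eq_bigr => x _.
  by rewrite linearZ JE T_geltr.
have [W [f f_eq [g fK gK]]] := M_sum.
have g_lin : linear g by move=> a u v; apply: (can_inj fK); rewrite gK linearP !gK.
have g_eq x u : gmod_act I x (g u) = g (gmod_act (gprod M W) x u).
  by apply: (can_inj fK); rewrite f_eq !gK.
have i_lin : linear (fun m : M => g (m, 0)).
  by move=> a u v; rewrite -g_lin; congr g; apply: injective_projections;
     rewrite /= ?scaler0 ?addr0.
have r_lin : linear (fun w : I => (f w).1 : M) by move=> a u v; rewrite linearP.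
have [i iE] : exists i : {linear M -> I}, forall m, i m = g (m, 0).
  pose i : {linear M -> I} := HB.pack (fun m : M => g (m, 0))
    (GRing.isLinear.Build O M I _ _ i_lin).
  by exists i.
have [r rE] : exists r : {linear I -> M}, forall w, r w = (f w).1.
  pose r : {linear I -> M} := HB.pack (fun w : I => (f w).1 : M)
    (GRing.isLinear.Build O I M _ _ r_lin).
  by exists r.
have ir m : r (i m) = m by rewrite rE iE gK.
have i_eq x m : gmod_act I x (i m) = i (gmod_act M x m).
  by rewrite !iE g_eq; congr g; apply: injective_projections; rewrite /= ?linear0.
have r_eq x w : gmod_act M x (r w) = r (gmod_act I x w) by rewrite !rE f_eq.
exists (fun h => Q h \o i), (fun h => r \o J h); split=> [h z m|h z v|h x m|h x v|m].
- by rewrite /= -i_eq zQ.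
- by rewrite /= r_eq zJ.
- by rewrite /= Qx.
- by rewrite /= !JE T_geltr.
by rewrite -[LHS]ir {1}[i m]sumQ linear_sum.
Qed.

End Source.
End PowerMaps.

(** ** Modules with an endopermutation source *)

Section Lattices.

Variables (O : idomainType).
Hypothesis O_dvr : complete_dvr O.

(** The maps [A i] and [B i] make [M] a retract of a direct sum of copies of [V]. *)
Lemma retract_sum (V M : lmodType O) n (c : coords V n) (I : finType) (P : pred I)
    (A : I -> {linear M -> V}) (B : I -> {linear V -> M}) :
  (forall m, m = \sum_(i | P i) B i (A i m)) -> exists r, inhabited (coords M r).
Proof.
move=> sumBA.
pose i (m : M) := mx_co (\matrix_(a, b) co c (A (enum_val a) m) b 0 : 'M_(#|I|, n)).
pose r (v : 'cV[O]_(#|I| * n)) : M :=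
  \sum_(a | P a) B a (inc c (row (enum_rank a) (mx_inc v))^T).
have i_lin : linear i.
  move=> a u v; rewrite /i -linearP; congr mx_co.
  by apply/matrixP => x y; rewrite !mxE linearP linearP !mxE.
have r_lin : linear r.
  move=> a u v; rewrite /r scaler_sumr -big_split; apply: eq_bigr => x _ /=.
  by rewrite !linearP.
pose iL : {linear _ -> _} := HB.pack i (GRing.isLinear.Build O M _ _ i i_lin).
pose rL : {linear _ -> _} := HB.pack r (GRing.isLinear.Build O _ M _ r r_lin).
apply: (retract_coords (i := iL) (r := rL) O_dvr) => m /=.
rewrite [RHS]sumBA; apply: eq_bigr => a _; congr (B a _); rewrite -[RHS](coK c).
congr (inc c _); apply/colP => x; rewrite mxE mxE /i mx_coK mxE enum_rankK.
by [].
Qed.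

Definition scalar_co (x : O^o) : 'cV[O]_1 := const_mx x.
Definition scalar_inc (v : 'cV[O]_1) : O^o := v 0 0.

Fact scalar_co_linear : linear scalar_co.
Proof. by move=> a x y; apply/colP => i; rewrite !mxE. Qed.
HB.instance Definition _ := GRing.isLinear.Build O _ _ _ scalar_co scalar_co_linear.

Fact scalar_inc_linear : linear scalar_inc.
Proof. by move=> a x y; rewrite /scalar_inc !mxE. Qed.
HB.instance Definition _ := GRing.isLinear.Build O _ _ _ scalar_inc scalar_inc_linear.

Fact scalar_coK : cancel scalar_co scalar_inc.
Proof. by move=> x; rewrite /scalar_inc mxE. Qed.

Fact scalar_incK : cancel scalar_inc scalar_co.
Proof. by move=> v; apply/colP => i; rewrite mxE (ord1 i). Qed.

Definition scalar_coords : coords O^o 1 := Coords scalar_coK scalar_incK.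

End Lattices.

Section InvariantTraces.

Variables (p : nat) (O : idomainType) (k : fieldType) (res : {rmorphism O -> k}).
Hypotheses (p_pr : prime p) (O_dvr : complete_dvr O).
Hypothesis res_surj : forall y : k, exists x : O, res x = y.
Hypotheses (k_char : p \in [pchar k]) (K_char : [pchar {fraction O}] =i pred0).
Variables (N : nat) (mu : {fraction O}).
Hypothesis mu_prim : N.-primitive_root mu.
Local Notation K := {fraction O}.

Section Source.

Variables (gT : finGroupType) (P : {group gT}) (V : gmod O (subg_of P)).
Variables (M I : gmod O gT).
Hypotheses (V_ind : is_induced V I) (M_sum : gsummand M I).
Hypothesis V_endo : endopermutation p V.
Hypothesis V_int : forall chi, lattice_character V chi ->
  forall x, exists z : int, chi x = z%:~R.

Lemma source_lattice : exists n, inhabited (coords M n).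
Proof.
have [_ [n [e eB]] _] := V_endo; have [cV _] := basis_coords eB.
have [A [B [_ _ _ _ sumBA]]] := source_maps V_ind M_sum.
exact: (retract_sum (A := A \o repr) (B := B \o repr) O_dvr cV sumBA).
Qed.

Variable t : nat.
Hypotheses (tN : coprime t N) (t1 : t = 1 %[mod (N`_p^')%N]).

(** The element [u], of order a power of [p], permutes the translates of [V]. On a
    translate that it fixes, it acts as an element of [P] does on [V]. *)
Lemma source_trace_invariant n (c : coords M n) (z : gT) : (#[z]%g %| N)%N ->
  lat_tr c (gmod_act M (z ^+ t)%g) = lat_tr c (gmod_act M z).
Proof.
move=> zN; apply: (rigid_group_trace p_pr O_dvr res_surj k_char mu_prim t1 zN).
have [_ [nV [e eB]] _] := V_endo; have [cV _] := basis_coords eB.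
have [A [B [zA zB Ax Bx sumBA]]] := source_maps V_ind M_sum.
set u := (z.`_p)%g.
have uN : (#[u]%g %| N)%N by apply: dvdn_trans zN; rewrite order_constt dvdn_part.
pose is_coset (C : {set gT}) := C == (repr C *: P)%g.
pose s (C : {set gT}) := (u *: C)%g.
pose x C := if is_coset C then mat cV c (B (repr C)) *m mat c cV (A (repr C)) else 0.
have s_iter e' C : iter e' s C = ((u ^+ e')%g *: C)%g.
  elim: e' => [|e' IHe]; first by rewrite expg0 lcoset1.
  by rewrite iterS IHe expgS lcosetM.
have s_coset C h : C = (h *: P)%g -> is_coset C.
  move=> CE; apply/eqP; rewrite {1}CE; apply/esym/lcoset_eqP; rewrite -CE.
  by apply: (mem_repr h); rewrite CE lcoset_refl.
have s_is_coset C : is_coset (s C) = is_coset C.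
  apply/idP/idP => /eqP CE.
    apply: (s_coset _ (u^-1 * repr (s C))%g).
    by rewrite lcosetM -CE /s -lcosetM mulVg lcoset1.
  by apply: (s_coset _ (u * repr C)%g); rewrite lcosetM -CE.
have s_repr C : is_coset C -> exists y : subg_of P, repr (s C) = (u * repr C * sgval y)%g.
  move=> /eqP CE; have: (repr (s C) \in (u * repr C) *: P)%g.
    by rewrite lcosetM -CE; apply: (mem_repr (u * repr C)%g);
       rewrite /s {2}CE -lcosetM lcoset_refl.
  rewrite mem_lcoset => yP; exists (subg P ((u * repr C)^-1 * repr (s C))%g).
  by rewrite subgK // mulKVg.
apply: (group_orbit_rigid p_pr O_dvr res_surj k_char mu_prim tN (s := s) (x := x)) => //.
- exact: p_elt_constt.
- by apply: (can_inj (g := fun C => (u^-1 *: C)%g)) => C; rewrite /s -lcosetM mulVg lcoset1.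
- by move=> C; rewrite s_iter expg_order lcoset1.
- move=> C; rewrite /x s_is_coset; case: ifP => [C_coset|_]; last by rewrite mulmx0 mul0mx.
  have [y yE] := s_repr C C_coset.
  rewrite mulmxA -!mulmxA /rho -!mat_comp; apply: mat_eq => m /=.
  by rewrite zB yE Ax zA Bx -gmod_actM mulgV gmod_act1.
- apply: eq_mulmx_cV => v; rewrite mul1mx mulmx_suml.
  transitivity (co c (inc c v)); last exact: incK.
  rewrite [in RHS](sumBA (inc c v)) linear_sum [RHS]big_mkcond; apply: eq_bigr => C _ /=.
  rewrite /x /is_coset; case: ifP => _; last by rewrite mul0mx.
  by rewrite -mulmxA !mat_mul coK.
move=> C sC; rewrite /x; case: ifP => [C_coset|_]; last exact: rigid_factor0.
have [y yE] := s_repr C C_coset; rewrite sC in yE.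
have uh : (u * repr C = repr C * sgval y^-1)%g by rewrite {2}yE -mulgA mulgV mulg1.
have yN : (#[y^-1]%g %| N)%N.
  have yE' : (sgval y^-1 = u ^ repr C)%g by rewrite /conjg -(mulKg (repr C) (sgval _)) -uh.
  have -> : #[y^-1]%g = #[sgval y^-1]%g.
    by rewrite -(order_injm (injm_sgval P)) ?finset.in_setT.
  by rewrite yE' orderJ.
exists nV, (rho cV y^-1%g), (mat c cV (A (repr C))), (mat cV c (B (repr C))); split=> //.
- exact: (endopermutation_group_rigid p_pr O_dvr res_surj k_char K_char mu_prim tN V_endo V_int yN).
- rewrite /rho -!mat_comp; apply: mat_eq => m /=.
  rewrite -(zA (repr C) u m); have -> : (u * repr C = repr C * sgval y^-1)%g by [].
  by rewrite Ax invgK -gmod_actM mulVg gmod_act1.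
rewrite /rho -!mat_comp; apply: mat_eq => v /=.
by rewrite zB uh Bx.
Qed.

End Source.

(** ** Blocks as bimodules *)

Section BlockTrace.

Variables (gT : finGroupType) (B : block O gT).

Local Notation b := (block_idem B).

(** The block is a retract of the group algebra, on which [gT * gT] permutes a basis. *)
Lemma block_scalar_maps : exists (A : gT -> {linear block_bimod B -> O^o})
    (C : gT -> {linear O^o -> block_bimod B}),
  [/\ forall z g a, A (z.1 * g * z.2^-1)%g (gmod_act (block_bimod B) z a) = A g a,
      forall z g v, gmod_act (block_bimod B) z (C g v) = C (z.1 * g * z.2^-1)%g v,
      forall a, a = \sum_g C g (A g a)
    & forall g h v, A h (C g v) = v * (b (g^-1 * h)%g : O)].
Proof.
have [_ bb bC _] := block_idemP B.
have A_lin g : linear (fun a : block_bimod B => block_val a g : O^o).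
  move=> x a c; have -> : block_val (x *: a + c) = x *: block_val a + block_val c by [].
  by rewrite !ffunE.
have C_in g (v : O^o) : v *: (gelt O g * b) \in in_block B.
  by apply/eqP; rewrite -scalerAl -mulrA bb.
have C_lin g : linear (fun v => BlockAlg (C_in g v) : block_bimod B).
  by move=> x v w; apply: val_inj; rewrite /= scalerDl scalerA.
have [A AE] : exists A : gT -> {linear block_bimod B -> O^o},
    forall g (a : block_bimod B), A g a = block_val a g.
  pose A g : {linear block_bimod B -> O^o} := HB.pack (fun a : block_bimod B => block_val a g : O^o)
    (GRing.isLinear.Build O (block_bimod B) O^o _ _ (A_lin g)).
  by exists A.
have [C CE] : exists C : gT -> {linear O^o -> block_bimod B},
    forall g v, block_val (C g v) = v *: (gelt O g * b).
  pose C g : {linear O^o -> block_bimod B} := HB.pack (fun v => BlockAlg (C_in g v) : block_bimod B)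
    (GRing.isLinear.Build O O^o (block_bimod B) _ _ (C_lin g)).
  by exists C.
exists A, C; split=> [z g a|z g v|a|g h v].
- rewrite !AE /= /greg_act galg_geltr galg_geltl; congr (block_val a _).
  by rewrite invgK mulgKV mulKg.
- apply: val_inj => /=; rewrite !CE /greg_act -scalerAr -scalerAl; congr (_ *: _).
  by rewrite !geltM -!mulrA bC !mulrA.
- apply: val_inj; rewrite -[LHS](eqP (block_valP a)) raddf_sum /=.
  rewrite [in LHS](galg_geltE (block_val a)) mulr_suml; apply: eq_bigr => g _.
  by rewrite CE AE -scalerAl.
by rewrite AE CE ffunE galg_geltl.
Qed.

Lemma block_lattice : exists n, inhabited (coords (block_bimod B) n).
Proof.
have [A [C [_ _ sumCA _]]] := block_scalar_maps.
exact: (retract_sum O_dvr (scalar_coords O) sumCA).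
Qed.

Lemma block_trace n (c : coords (block_bimod B) n) z :
  lat_tr c (gmod_act (block_bimod B) z) = \sum_g b (z.2 * g^-1 * z.1^-1 * g)%g.
Proof.
have [A [C [zA zC sumCA AC]]] := block_scalar_maps.
transitivity (\sum_g lat_tr c (gmod_act (block_bimod B) z \o (C g \o A g))).
  rewrite (@lat_tr_sum _ _ _ _ _ _ (fun g => gmod_act (block_bimod B) z \o (C g \o A g)) (fun=> 1)).
    by apply: eq_bigr => g _; rewrite mul1r.
  by move=> a; rewrite {1}(sumCA a) linear_sum; apply: eq_bigr => g _; rewrite scale1r.
apply: eq_bigr => g _.
rewrite (lat_trC c (scalar_coords O) (A g) (gmod_act (block_bimod B) z \o C g)).
rewrite /lat_tr /mxtrace big_ord1 mxE /= zC AC /scalar_co mxE /scalar_inc mxE eqxx mul1r.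
by congr (b _); rewrite !invMg invgK !mulgA.
Qed.

(** As for a module with a source, with the trivial module in place of [V]. *)
Lemma block_trace_invariant t n (c : coords (block_bimod B) n) z :
  coprime t N -> t = 1 %[mod (N`_p^')%N] -> (#[z]%g %| N)%N ->
  lat_tr c (gmod_act (block_bimod B) (z ^+ t)%g) = lat_tr c (gmod_act (block_bimod B) z).
Proof.
move=> tN t1 zN.
apply: (rigid_group_trace p_pr O_dvr res_surj k_char mu_prim t1 zN).
have [A [C [zA zC sumCA AC]]] := block_scalar_maps.
set u := (z.`_p)%g; pose s g := (u.1 * g * u.2^-1)%g; pose cO := scalar_coords O.
have uN : (#[u]%g %| N)%N by apply: dvdn_trans zN; rewrite order_constt dvdn_part.
have s_iter e g : iter e s g = ((u ^+ e).1 * g * (u ^+ e).2^-1)%g.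
  elim: e => [|e IHe]; first by rewrite expg0 /= invg1 mulg1 mul1g.
  by rewrite iterS IHe expgS /s /= invMg !mulgA.
apply: (group_orbit_rigid p_pr O_dvr res_surj k_char mu_prim tN (s := s)
  (x := fun g => mat cO c (C g) *m mat c cO (A g))) => //.
- exact: p_elt_constt.
- by move=> g h; rewrite /s => /mulIg/mulgI.
- by move=> g; rewrite s_iter expg_order /= invg1 mulg1 mul1g.
- move=> g; rewrite mulmxA -!mulmxA /rho -!mat_comp; apply: mat_eq => a /=.
  by rewrite zC zA.
- apply: eq_mulmx_cV => v; rewrite mul1mx mulmx_suml.
  transitivity (co c (inc c v)); last exact: incK.
  rewrite [in RHS](sumCA (inc c v)) linear_sum; apply: eq_bigr => g _ /=.
  by rewrite -mulmxA !mat_mul coK.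
move=> g sg; exists 1%N, 1%:M, (mat c cO (A g)), (mat cO c (C g)); split=> //.
- exact: rigid1.
- by rewrite mul1mx /rho -mat_comp; apply: mat_eq => a /=; rewrite -[RHS](zA u g a) -/(s g) sg.
by rewrite mulmx1 /rho -mat_comp; apply: mat_eq => v /=; rewrite zC -/(s g) sg.
Qed.

End BlockTrace.

End InvariantTraces.

(** * Traces on tensor products *)

Lemma galg_actM (R : comNzRingType) (gT : finGroupType) (V : gmod R gT) (a c : galg R gT) v :
  galg_act (V := V) (a * c) v = galg_act a (galg_act c v).
Proof.
rewrite /galg_act; under eq_bigr do rewrite galg_mulE scaler_suml.
rewrite exchange_big; apply: eq_bigr => x _ /=.
rewrite linear_sum scaler_sumr (reindex_inj (mulgI x)); apply: eq_bigr => y _ /=.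
by rewrite linearZ scalerA mulKg -gmod_actM.
Qed.

Lemma antipodeM (R : comNzRingType) (gT : finGroupType) (a c : galg R gT) :
  antipode (a * c) = antipode c * antipode a.
Proof.
apply/ffunP => z; rewrite ffunE !galg_mulE (reindex_inj (mulgI z^-1)%g) /=.
by apply: eq_bigr => x _ /=; rewrite !ffunE mulrC !invMg !invgK mulgK.
Qed.

Lemma bimod_ractM (R : comNzRingType) (gT' gT : finGroupType)
    (M : gmod R (gT' * gT)%type) (m : M) a c :
  bimod_ract m (a * c) = bimod_ract (bimod_ract m a) c.
Proof. by rewrite /bimod_ract antipodeM galg_actM. Qed.

(** The packed map is hidden behind an existential so that it does not unfold. *)
Lemma linear_pack (R : nzRingType) (X Y : lmodType R) (f : X -> Y) : linear f ->
  exists g : {linear X -> Y}, g =1 f.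
Proof.
move=> f_lin; pose g : {linear X -> Y} := HB.pack f (GRing.isLinear.Build R X Y _ f f_lin).
by exists g.
Qed.

Section TensorTrace.

Variables (O : idomainType) (gT' gT : finGroupType) (b : galg O gT).
Variables (M : gmod O (gT' * gT)%type) (U : gmod O gT) (T : lmodType O) (t : M -> U -> T).
Hypothesis tT : is_tensor b t.
Variables (rM rU : nat) (cM : coords M rM) (cU : coords U rU).

Let dyad (m : M) (u : U) : 'M[O]_(rM, rU) := co cM m *m (co cU u)^T.

Lemma dyad_linearl u : linear (dyad^~ u).
Proof. by move=> a m m'; rewrite /dyad linearP mulmxDl scalemxAl. Qed.

Lemma dyad_linearr m : linear (dyad m).
Proof. by move=> a u u'; rewrite /dyad !linearP. Qed.

Lemma dyad_delta i j : delta_mx i j = dyad (inc cM (delta_mx i 0)) (inc cU (delta_mx j 0)).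
Proof. by rewrite /dyad !incK trmx_delta mul_delta_mx. Qed.

Lemma dyad_ext (W : lmodType O) (f g : {linear 'M[O]_(rM, rU) -> W}) :
  (forall m u, f (dyad m u) = g (dyad m u)) -> f =1 g.
Proof.
move=> fg Q; rewrite (matrix_sum_delta Q) !linear_sum; apply: eq_bigr => i _.
by rewrite !linear_sum; apply: eq_bigr => j _; rewrite !linearZ dyad_delta fg.
Qed.

(** The matrices [dyad m u] represent the tensor product of [M] and [U] over [O],
    which maps onto the one over the group algebra. *)
Lemma tensor_eval : exists s : {linear 'M[O]_(rM, rU) -> T},
  forall m u, s (dyad m u) = t m u.
Proof.
have [[lin1 lin2 _] _] := tT.
pose s (Q : 'M[O]_(rM, rU)) : T :=
  \sum_i \sum_j Q i j *: t (inc cM (delta_mx i 0)) (inc cU (delta_mx j 0)).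
have s_lin : linear s.
  move=> a Q R; rewrite /s scaler_sumr -big_split; apply: eq_bigr => i _ /=.
  rewrite scaler_sumr -big_split; apply: eq_bigr => j _ /=.
  by rewrite !mxE scalerDl scalerA.
have [sL sLE] := linear_pack s_lin.
exists sL => m u; rewrite sLE /s.
have [t1 t1E] := linear_pack (lin1 u).
transitivity (t1 (inc cM (co cM m))); last by rewrite coK t1E.
rewrite [co cM m in RHS]cV_sum_delta !linear_sum; apply: eq_bigr => i _.
rewrite !linearZ t1E; have [t2 t2E] := linear_pack (lin2 (inc cM (delta_mx i 0))).
transitivity (co cM m i 0 *: t2 (inc cU (co cU u))); last by rewrite coK t2E.
rewrite [co cU u in RHS]cV_sum_delta !linear_sum; apply: eq_bigr => j _.
by rewrite !linearZ /= scalerA t2E !mxE big_ord1 mxE mulrC.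
Qed.

(** Summing over the group turns a bilinear map into a balanced one. *)
Lemma tensor_factor (P : gT -> {linear M -> M}) (Q : gT -> {linear U -> U}) :
  (forall x y m, P y (gmod_act M (1, x^-1)%g m) = P (x * y)%g m) ->
  (forall x y u, Q y (gmod_act U x u) = Q (x^-1 * y)%g u) ->
  exists n : {linear T -> 'M[O]_(rM, rU)},
    forall m u, n (t m u) = \sum_y dyad (P y m) (Q y u).
Proof.
move=> PE QE; have [_ univ] := tT.
pose F m u := \sum_y dyad (P y m) (Q y u).
have F_lin1 u : linear (F^~ u).
  move=> a m m'; rewrite /F scaler_sumr -big_split; apply: eq_bigr => y _ /=.
  by rewrite linearP dyad_linearl.
have F_lin2 m : linear (F m).
  move=> a u u'; rewrite /F scaler_sumr -big_split; apply: eq_bigr => y _ /=.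
  by rewrite linearP dyad_linearr.
have F_bal x m u : F (gmod_act M (1, x^-1)%g m) u = F m (gmod_act U x u).
  rewrite /F [RHS](reindex_inj (mulgI x)) /=; apply: eq_bigr => y _.
  by rewrite PE QE mulKg.
have [|n [nE _]] := univ _ F; last by exists n.
split=> // a _ m u.
have [F1 F1E] := linear_pack (F_lin1 u); have [F2 F2E] := linear_pack (F_lin2 m).
rewrite -[LHS]F1E -[RHS]F2E.
rewrite bimod_ract_sum /galg_act !linear_sum; apply: eq_bigr => x _.
by rewrite !linearZ F1E F2E F_bal.
Qed.

Hypothesis bt : forall m u, t (bimod_ract m b) u = t m u.
Hypotheses (bb : b * b = b) (bcomm : forall a, a * b = b * a).

Lemma tensor_diag x m u : t (gmod_act M (1, x)%g m) (gmod_act U x u) = t m u.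
Proof.
have [[lin1 lin2 bal] _] := tT.
have xb : gelt O x^-1 * b * b = gelt O x^-1 * b by rewrite -mulrA bb.
have -> : gmod_act M (1, x)%g m = bimod_ract m (gelt O x^-1) by rewrite gelt_ract invgK.
rewrite -bt -bimod_ractM bal // bcomm galg_actM gelt_act -gmod_actM mulVg gmod_act1.
by rewrite -bal // bt.
Qed.

(** Summing over the group defines a map [n] from the tensor product over the group
    algebra to the tensor product over [O]. Composed with the projection [s], it is
    [#|gT|] on one side and the sum of the diagonal actions on the other; the formula
    follows as both compositions have the same trace. *)
Lemma tensor_trace nT (cT : coords T nT) (al : {linear M -> M}) (be : {linear U -> U})
    (tau : {linear T -> T}) : (forall m u, tau (t m u) = t (al m) (be u)) ->
  #|gT|%:R * lat_tr cT tau = \sum_y lat_tr cM (gmod_act M (1, y)%g \o al)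
                                 * lat_tr cU (gmod_act U y \o be).
Proof.
move=> tauE; have [s sE] := tensor_eval.
have [||n nE] := @tensor_factor (fun y => gmod_act M (1, y^-1)%g) (fun y => gmod_act U y^-1%g).
- move=> x y m; rewrite -gmod_actM; congr (gmod_act M _ m).
  by apply: injective_projections; rewrite /= ?mulg1 ?invMg.
- by move=> x y u; rewrite -gmod_actM invMg invgK.
have sn v : #|gT|%:R *: tau v = tau (s (n v)).
  have [g gE] : exists g : {linear T -> T}, g =1 (fun v => #|gT|%:R *: tau v).
    by apply: linear_pack => a x y; rewrite linearP scalerDr !scalerA mulrC.
  rewrite -gE; apply: (@tensor_ext _ _ _ _ _ _ _ _ _ g (tau \o (s \o n)) tT) => m u /=.
  rewrite gE nE !linear_sum -sum1_card natr_sum scaler_suml; apply: eq_bigr => y _.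
  by rewrite sE tensor_diag scale1r.
transitivity (lat_tr cT ((tau \o s) \o n)).
  rewrite /lat_tr -mxtraceZ; congr (\tr _); apply/matrixP => i j.
  by rewrite !mxE /= -sn linearZ mxE.
rewrite (lat_trC cT (mx_coords O rM rU)).
pose A y := mat cM cM (gmod_act M (1, y)%g \o al).
pose B y := mat cU cU (gmod_act U y \o be).
rewrite (@lat_tr_sum _ _ _ (mx_coords O rM rU) _ _
  (fun y Q => A y *m Q *m (B y)^T) (fun=> 1)) => [|Q].
  by apply: eq_bigr => y _; rewrite mul1r lat_tr_mx mxtrace_tr.
have [h hE] : exists h : {linear 'M[O]_(rM, rU) -> 'M[O]_(rM, rU)},
    h =1 (fun Q => \sum_y 1 *: (A y *m Q *m (B y)^T)).
  apply: linear_pack => a R S; rewrite scaler_sumr -big_split; apply: eq_bigr => y _ /=.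
  by rewrite linearP mulmxDl !scale1r /= -scalemxAl.
rewrite -[RHS]hE; apply: (@dyad_ext _ (n \o (tau \o s)) h) => {Q} m u /=.
rewrite sE tauE nE hE [LHS](reindex_inj invg_inj); apply: eq_bigr => y _ /=.
rewrite invgK scale1r /dyad mulmxA mat_co -[in RHS]mulmxA -trmx_mul mat_co.
by [].
Qed.

(** If the maps can be chosen so that [s \o n] is the identity, the tensor product is a
    retract of a lattice. *)
Lemma tensor_lattice (P : gT -> {linear M -> M}) (Q : gT -> {linear U -> U}) :
  complete_dvr O ->
  (forall x y m, P y (gmod_act M (1, x^-1)%g m) = P (x * y)%g m) ->
  (forall x y u, Q y (gmod_act U x u) = Q (x^-1 * y)%g u) ->
  (forall m u, \sum_y t (P y m) (Q y u) = t m u) ->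
  exists n, inhabited (coords T n).
Proof.
move=> O_dvr PE QE PQ; have [s sE] := tensor_eval.
have [n nE] := tensor_factor PE QE.
apply: (retract_sum (I := unit) (P := predT) (A := fun=> n) (B := fun=> s) O_dvr (mx_coords O rM rU)).
move=> v; rewrite big_const card_unit /= addr0.
apply/esym; apply: (@tensor_ext _ _ _ _ _ _ _ _ _ (s \o n) idfun tT) => m u /=.
by rewrite nE linear_sum -[RHS]PQ; apply: eq_bigr => y _; rewrite sE.
Qed.

End TensorTrace.

(** ** Duals *)

Lemma dual_trace (O : idomainType) (gT' gT : finGroupType) (M : gmod O (gT' * gT)%type)
    n (c : coords M n) :
  exists c' : coords (bimod_dual M) n, forall z,
    lat_tr c' (gmod_act (bimod_dual M) z) = lat_tr c (gmod_act M (z.2^-1, z.1^-1)%g).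
Proof.
have ev_lin (f : bimod_dual M) : linear (f : M -> O^o) by have /asboolP := hom_funP f.
pose co' (f : bimod_dual M) : 'cV[O]_n := \col_i f (inc c (delta_mx i 0)).
have inc_in (v : 'cV[O]_n) : (fun m : M => \sum_i v i 0 * co c m i 0 : O^o)
    \in @is_linear O M O^o.
  apply/asboolP => a m m'; rewrite scaler_sumr -big_split; apply: eq_bigr => i _ /=.
  by rewrite linearP !mxE mulrDr mulrCA.
pose inc' (v : 'cV[O]_n) : bimod_dual M := Defs.Hom (inc_in v).
have co'_lin : linear co' by move=> a f g; apply/colP => i; rewrite !mxE.
have inc'_lin : linear inc'.
  move=> a v w; apply/val_inj/funext => m; rewrite /= !fctE scaler_sumr -big_split.
  by apply: eq_bigr => i _; rewrite !mxE mulrDl -mulrA.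
have [C CE] := linear_pack co'_lin; have [I IE] := linear_pack inc'_lin.
have CK : cancel C I.
  move=> f; rewrite CE IE; apply/val_inj/funext => m /=.
  have [F FE] := linear_pack (ev_lin f).
  rewrite -FE -[in RHS](coK c m) [co c m in RHS]cV_sum_delta !linear_sum.
  by apply: eq_bigr => i _; rewrite !linearZ FE !mxE mulrC.
have IK : cancel I C.
  move=> v; rewrite CE IE; apply/colP => i; rewrite mxE /= (bigD1 i) //= incK !mxE !eqxx.
  by rewrite mulr1 big1 ?addr0 // => j ji; rewrite mxE (negbTE ji) mulr0.
exists (Coords CK IK) => z; rewrite /lat_tr -mxtrace_tr; congr (\tr _).
apply/matrixP => i j; rewrite !mxE /= CE IE mxE /= (bigD1 i) //= !mxE !eqxx mul1r.
rewrite big1 ?addr0 // => l li; by rewrite mxE (negbTE li) mul0r.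
Qed.

(** ** Projective modules *)

Section IdemPart.

Variables (R : comNzRingType) (gT : finGroupType) (e : galg R gT) (F : gmod R gT).

Definition in_part : {pred F} := fun v => galg_act e v == v.

Lemma galg_act_linear (V : gmod R gT) a : linear (galg_act (V := V) a).
Proof.
move=> x u v; rewrite /galg_act scaler_sumr -big_split; apply: eq_bigr => y _ /=.
by rewrite linearP scalerDr !scalerA mulrC.
Qed.

Fact in_part_submod : submod_closed in_part.
Proof.
have [E EE] := linear_pack (galg_act_linear (V := F) e).
split=> [|x u v /eqP uE /eqP vE]; apply/eqP; rewrite -EE ?linear0 //.
by rewrite linearP !EE uE vE.
Qed.

HB.instance Definition _ := GRing.isSubmodClosed.Build R F in_part in_part_submod.

Record part := Part { part_val : F; part_valP : part_val \in in_part }.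

HB.instance Definition _ := [isSub for part_val].
HB.instance Definition _ := [Choice of part by <:].
HB.instance Definition _ := [SubChoice_isSubLmodule of part by <:].

Hypothesis e_central : forall a, a * e = e * a.

Fact part_act_subproof z (v : part) : gmod_act F z (part_val v) \in in_part.
Proof.
apply/eqP; rewrite -gelt_act -galg_actM -e_central galg_actM.
by rewrite (eqP (part_valP v)).
Qed.

Definition part_act z (v : part) : part := Part (part_act_subproof z v).

Fact part_act_linear z : linear (part_act z).
Proof. by move=> x u v; apply: val_inj; rewrite /= linearP. Qed.

HB.instance Definition _ z :=
  GRing.isLinear.Build R part part _ (part_act z) (part_act_linear z).

Fact part_act1 v : part_act 1%g v = v.
Proof. by apply: val_inj; exact: gmod_act1. Qed.

Fact part_actM z w v : part_act (z * w)%g v = part_act z (part_act w v).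
Proof. by apply: val_inj; exact: gmod_actM. Qed.

(** Cutting a module down by the central idempotent yields a module of the category in
    which projectivity is tested. *)
Definition gpart : gmod R gT := @GMod R gT part (fun z => part_act z) part_act1 part_actM.

End IdemPart.

(** A projective module is relatively projective with respect to the trivial
    subgroup: its identity is the trace of a linear endomorphism. It is obtained
    by splitting the cover [Map gT W -> W], cut down by the idempotent [e]. *)
Lemma projective_relative_trace (R : comNzRingType) (gT : finGroupType) (e : galg R gT)
    (C : gmod R gT -> Prop) (W : gmod R gT) :
  e * e = e -> (forall a, a * e = e * a) -> (forall Y, C Y <-> idem_module e Y) ->
  projective_in C W -> exists theta : {linear W -> W},
    forall w, w = \sum_h gmod_act W h (theta (gmod_act W h^-1%g w)).
Proof.
move=> ee eC CE [CW W_proj]; have /CE eW := CW.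
pose sh h (f : {ffun gT -> W}) : {ffun gT -> W} := [ffun x => f (h^-1 * x)%g].
have sh_lin h : linear (sh h) by move=> a f g; apply/ffunP => x; rewrite !ffunE.
have [S SE] := choice (fun h => linear_pack (sh_lin h)).
have S1 f : S 1%g f = f by apply/ffunP => x; rewrite SE ffunE invg1 mul1g.
have SM h h' f : S (h * h')%g f = S h (S h' f).
  by apply/ffunP => x; rewrite !SE !ffunE invMg mulgA.
pose F : gmod R gT := @GMod R gT {ffun gT -> W} S S1 SM.
pose ev (f : F) : W := \sum_h gmod_act W h ((f : {ffun gT -> W}) h).
have ev_lin : linear ev.
  move=> a f g; rewrite /ev scaler_sumr -big_split; apply: eq_bigr => h _ /=.
  by rewrite !ffunE linearP.
have ev_eq h f : ev (gmod_act F h f) = gmod_act W h (ev f).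
  rewrite /ev linear_sum (reindex_inj (mulgI h)); apply: eq_bigr => x _ /=.
  by rewrite SE ffunE mulKg gmod_actM.
have [E EE] := linear_pack ev_lin.
have Ee f : E (galg_act e f) = galg_act e (E f).
  by rewrite /galg_act linear_sum; apply: eq_bigr => h _; rewrite linearZ; congr (_ *: _);
     rewrite [LHS]EE ev_eq EE.
have [G GE] : exists G : {linear gpart F eC -> W}, forall f, G f = E (part_val f).
  have [|G GE] := @linear_pack R (gpart F eC) W (fun f => E (part_val f)).
    by move=> a f g; rewrite -linearP.
  by exists G.
have G_eq : gequivariant G by move=> h f; rewrite !GE /= EE ev_eq EE.
have G_surj w : exists f, G f = w.
  pose d : F := [ffun x => if x == 1%g then w else 0].
  have d_in : galg_act (V := F) e d \in in_part (F := F) e by apply/eqP; rewrite -galg_actM ee.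
  exists (Part d_in); rewrite GE /= Ee EE /ev (bigD1 1%g) //= ffunE eqxx gmod_act1.
  rewrite big1 ?addr0 ?eW // => h /negbTE h1; by rewrite ffunE h1 linear0.
have C_part : C (gpart F eC).
  apply/CE => f; apply: val_inj => /=.
  have -> : val (galg_act (V := gpart F eC) e f) = galg_act (V := F) e (part_val f).
    by rewrite /galg_act raddf_sum.
  exact: (eqP (part_valP f)).
have [|h h_eq Gh] := W_proj _ _ G idfun C_part CW G_eq _ G_surj; first by [].
have [theta thE] : exists theta : {linear W -> W},
    forall w, theta w = (part_val (h w) : {ffun gT -> W}) 1%g.
  have [|theta thE] := @linear_pack R W W (fun w => (part_val (h w) : {ffun gT -> W}) 1%g).
    by move=> a f g; rewrite linearP /= !ffunE.
  by exists theta.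
exists theta => w; rewrite -[LHS](Gh w) GE EE; apply: eq_bigr => x _.
by rewrite thE h_eq /= SE ffunE invgK mulg1.
Qed.

(** ** Bimodules over blocks *)

Section CentralIdempotents.

Variable R : comNzRingType.

Lemma galg_central (gT : finGroupType) (e : galg R gT) :
  (forall a, a * e = e * a) <-> (forall x y, e (x * y)%g = e (y * x)%g).
Proof.
split=> [eC x y|eC a].
  by have /ffunP/(_ y) := eC (gelt R x^-1); rewrite galg_geltl galg_geltr invgK.
apply/ffunP => z; rewrite !galg_mulE [RHS](reindex_inj invg_inj) /=.
rewrite [RHS](reindex_inj (mulIg z^-1%g)) /=; apply: eq_bigr => x _.
by rewrite mulrC eC invgK mulgKV invMg invgK.
Qed.

Lemma antipodeK (gT : finGroupType) : involutive (@antipode R gT).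
Proof. by move=> a; apply/ffunP => x; rewrite !ffunE invgK. Qed.

Lemma antipode_central (gT : finGroupType) (e : galg R gT) :
  (forall a, a * e = e * a) -> forall a, a * antipode e = antipode e * a.
Proof. by move=> eC a; rewrite -[a]antipodeK -!antipodeM eC. Qed.

Section Bimodule.

Variables (gT' gT : finGroupType) (b' : galg R gT') (b : galg R gT).
Hypotheses (b'b' : b' * b' = b') (b'C : forall a, a * b' = b' * a).
Hypotheses (bb : b * b = b) (bC : forall a, a * b = b * a).

(** Bimodules over two blocks are the modules cut out by one central idempotent of the
    group algebra of the product, so that they are covered by the results on such
    idempotents. *)
Lemma block_bimodule_idem : exists e : galg R (gT' * gT)%type,
  [/\ e * e = e, forall a, a * e = e * a
    & forall Y, block_bimodule Y b' b <-> idem_module e Y].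
Proof.
pose e : galg R (gT' * gT)%type := [ffun z => (b' z.1 : R) * antipode b z.2].
have eE z : e z = (b' z.1 : R) * antipode b z.2 by rewrite ffunE.
have act_lr Y (m : gmod_car Y) : galg_act e m = bimod_lact b' (bimod_ract m b).
  rewrite /bimod_lact /bimod_ract /galg_act.
  rewrite (eq_bigr (fun z => (fun x y => b' x *: gmod_act Y (x, 1%g)
      (antipode b y *: gmod_act Y (1%g, y) m)) z.1 z.2)) => [|[x y] _].
    rewrite -(pair_bigA _ (fun x y => b' x *: gmod_act Y (x, 1%g)
      (antipode b y *: gmod_act Y (1%g, y) m))) /=.
    by apply: eq_bigr => x _; rewrite linear_sum scaler_sumr.
  rewrite eE /= linearZ scalerA -gmod_actM; congr (_ *: gmod_act Y _ m).
  by apply: injective_projections; rewrite /= ?mulg1 ?mul1g.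
have act_rl Y (m : gmod_car Y) : galg_act e m = bimod_ract (bimod_lact b' m) b.
  rewrite act_lr /bimod_lact /bimod_ract /galg_act.
  under eq_bigr do rewrite linear_sum scaler_sumr.
  rewrite exchange_big; apply: eq_bigr => y _ /=.
  rewrite linear_sum scaler_sumr; apply: eq_bigr => x _.
  rewrite [X in _ *: X = _]linearZ [X in _ = _ *: X]linearZ /= !scalerA mulrC -!gmod_actM.
  congr (_ *: gmod_act Y _ m).
  by apply: injective_projections; rewrite /= ?mulg1 ?mul1g.
exists e; split.
- apply/ffunP => -[x y]; rewrite galg_mulE eE /=.
  have -> : antipode b y = \sum_z (antipode b z : R) * antipode b (z^-1 * y)%g.
    by rewrite -galg_mulE -antipodeM bb.
  rewrite -{1}b'b' galg_mulE big_distrlr /= pair_bigA /=.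
  by apply: eq_bigr => -[u v] _ /=; rewrite !eE /= mulrACA.
- apply/galg_central => -[x y] [u v]; rewrite !eE /=.
  have /galg_central -> := b'C; have /galg_central -> // := antipode_central bC.
move=> Y; split=> [Yb m|Ye m].
  by have [lm _] := Yb (bimod_ract m b); have [_ rm] := Yb m; rewrite act_lr rm; have [] := Yb m.
split.
  by rewrite -{1}(Ye m) act_lr {1 2}/bimod_lact -galg_actM b'b' -/(bimod_lact b' _) -act_lr Ye.
by rewrite -{1}(Ye m) act_rl -bimod_ractM bb -act_rl Ye.
Qed.

End Bimodule.

End CentralIdempotents.

(** ** Direct sums *)

Section Sums.

Variables (O : idomainType) (gT : finGroupType) (T U W : gmod O gT).
Hypothesis T_iso : giso T (gprod U W).

Lemma giso_maps : exists (p1 : {linear T -> U}) (p2 : {linear T -> W})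
    (i1 : {linear U -> T}) (i2 : {linear W -> T}),
  [/\ forall v, v = i1 (p1 v) + i2 (p2 v), forall u, p1 (i1 u) = u, forall w, p2 (i2 w) = w,
      (forall z v, p1 (gmod_act T z v) = gmod_act U z (p1 v))
    & forall z v, p2 (gmod_act T z v) = gmod_act W z (p2 v)].
Proof.
have [f f_eq [g fK gK]] := T_iso.
have g_lin : linear g by move=> a u v; apply: (can_inj fK); rewrite gK linearP !gK.
have [|p1 p1E] := @linear_pack O T U (fun v => (f v).1); first by move=> a u v; rewrite linearP.
have [|p2 p2E] := @linear_pack O T W (fun v => (f v).2); first by move=> a u v; rewrite linearP.
have [|i1 i1E] := @linear_pack O U T (fun u => g (u, 0)).
  move=> a u v; rewrite -g_lin; congr g; apply: injective_projections;
     by rewrite /= ?scaler0 ?addr0.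
have [|i2 i2E] := @linear_pack O W T (fun w => g (0, w)).
  move=> a u v; rewrite -g_lin; congr g; apply: injective_projections;
     by rewrite /= ?scaler0 ?addr0.
exists p1, p2, i1, i2; split=> [v|u|w|z v|z v].
- apply: (can_inj fK); rewrite linearD i1E i2E !gK p1E p2E.
  by apply: injective_projections; rewrite /= ?addr0 ?add0r.
- by rewrite p1E i1E gK.
- by rewrite p2E i2E gK.
- by rewrite !p1E f_eq.
by rewrite !p2E f_eq.
Qed.

Lemma giso_trace nT nU nW (cT : coords T nT) (cU : coords U nU) (cW : coords W nW) z :
  lat_tr cT (gmod_act T z) = lat_tr cU (gmod_act U z) + lat_tr cW (gmod_act W z).
Proof.
have [p1 [p2 [i1 [i2 [ip pi1 pi2 p1z p2z]]]]] := giso_maps.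
transitivity (lat_tr cT (i1 \o (p1 \o gmod_act T z)) + lat_tr cT (i2 \o (p2 \o gmod_act T z))).
  rewrite (@lat_tr_sum _ _ _ cT bool _
    (fun j => if j then i1 \o (p1 \o gmod_act T z) else i2 \o (p2 \o gmod_act T z)) (fun=> 1)).
    by rewrite big_bool !mul1r.
  by move=> v; rewrite big_bool !scale1r {1}(ip (gmod_act T z v)).
rewrite (lat_trC cT cU) (lat_trC cT cW); congr (_ + _); apply: lat_tr_eq => v /=.
  by rewrite p1z pi1.
by rewrite p2z pi2.
Qed.

Lemma giso_lattice nT (cT : coords T nT) : complete_dvr O -> exists n, inhabited (coords W n).
Proof.
move=> O_dvr; have [p1 [p2 [i1 [i2 [ip pi1 pi2 p1z p2z]]]]] := giso_maps.
apply: (retract_sum (I := unit) (P := predT) (A := fun=> i2) (B := fun=> p2) O_dvr cT).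
by move=> w; rewrite big_const card_unit /= addr0 pi2.
Qed.

End Sums.

(** * Traces and stable equivalences *)

Section StableTraces.

Variables (p : nat) (O : idomainType) (k : fieldType) (res : {rmorphism O -> k}).
Hypotheses (p_pr : prime p) (O_dvr : complete_dvr O).
Hypothesis res_surj : forall y : k, exists x : O, res x = y.
Hypotheses (k_char : p \in [pchar k]) (K_char : [pchar {fraction O}] =i pred0).
Variables (N : nat) (mu : {fraction O}).
Hypothesis mu_prim : N.-primitive_root mu.

(** The identity of [X] is the sum of the conjugates of an endomorphism [theta]; the
    element [z] permutes them in orbits whose length is divisible by [p], so the
    identity is twisted. *)
Lemma projective_trace0 (gT : finGroupType) (e : galg O gT) C (X : gmod O gT) n (c : coords X n) z :
  e * e = e -> (forall a, a * e = e * a) -> (forall Y, C Y <-> idem_module e Y) ->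
  projective_in C X -> (p %| #[z]%g)%N -> (#[z]%g %| N)%N ->
  lat_tr c (gmod_act X z) = 0.
Proof.
move=> ee eC CE X_proj pz zN.
have [theta thE] := projective_relative_trace ee eC CE X_proj.
have [zp zpP] := prim_root_in_O O_dvr mu_prim (dvdn_trans pz zN).
have res_zp : res zp = 1 := res_p_root res p_pr k_char (prim_expr_order zpP).
have zp1 : zp != 1.
  by rewrite -[zp]expr1 -(prim_order_dvd zpP) dvdn1 neq_ltn prime_gt1 ?orbT.
pose s h := (z * h)%g; have s_inj : injective s := mulgI z.
have [g gP] := orbit_grading p s_inj.
have p_s h : (p %| fingraph.order s h)%N.
  apply: dvdn_trans pz _; rewrite order_dvdn.
  have iterE d : iter d s h = (z ^+ d * h)%g.
    by elim: d => [|d IHd]; rewrite ?expg0 ?mul1g // iterS IHd /s expgS mulgA.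
  by rewrite -(inj_eq (mulIg h)) -iterE (iter_order s_inj) mul1g.
pose x h := rho c h *m mat c c theta *m rho c h^-1%g.
have sum_x : \sum_(h | predT h) x h = 1%:M.
  apply: eq_mulmx_cV => v; rewrite mul1mx mulmx_suml.
  transitivity (co c (inc c v)); last exact: incK.
  rewrite [in RHS](thE (inc c v)) linear_sum; apply: eq_bigr => h _.
  by rewrite -[in LHS](incK c v) /x /rho -!mulmxA !mat_co.
have tw : twisted res zp (rho c z) (\sum_(h | predT h) x h).
  apply: (twisted_grading zpP res_zp s_inj (g := g)) => // [h _|h]; first exact: gP.
  rewrite /x !mulmxA -rhoM -/(s h) -!mulmxA -rhoM; congr (_ *m (_ *m rho c _)).
  by rewrite /s invMg mulgKV.
rewrite sum_x in tw.
have zp11 : zp ^+ 1 != 1 by rewrite expr1.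
by have [] := twisted_trace0 O_dvr res_surj zp11 zp1 tw (unitmx1 _ _).
Qed.

Section TensorBimodule.

Variables (gT1 gT2 : finGroupType) (b : galg O gT2).
Variables (M1 : gmod O (gT1 * gT2)%type) (M2 : gmod O (gT2 * gT1)%type).
Variables (T : gmod O (gT1 * gT1)%type) (t : M1 -> lres M2 -> T).
Hypothesis tT : is_tensor b t.
Hypotheses (bb : b * b = b) (bC : forall a, a * b = b * a).
Hypothesis bM2 : idem_module b (lres M2).
Variables (n1 n2 : nat) (c1 : coords M1 n1) (c2 : coords M2 n2).

Lemma tensor_block_act m u : t (bimod_ract m b) u = t m u.
Proof. by have [[_ _ bal] _] := tT; rewrite bal // bM2. Qed.

Lemma tensor_slide x m u : t (gmod_act M1 (1, x)%g m) u = t m (gmod_act (lres M2) x^-1%g u).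
Proof.
rewrite -[RHS](tensor_diag tT tensor_block_act bb bC x).
by rewrite -gmod_actM mulgV gmod_act1.
Qed.

(** If one of the factors is projective, the projection from the tensor product over
    [O] splits. *)
Lemma projective_tensor_lattice :
  (exists theta : {linear lres M2 -> lres M2},
     forall w, w = \sum_h gmod_act (lres M2) h (theta (gmod_act (lres M2) h^-1%g w))) \/
  (exists theta : {linear rres M1 -> rres M1},
     forall w, w = \sum_h gmod_act (rres M1) h (theta (gmod_act (rres M1) h^-1%g w))) ->
  exists n, inhabited (coords T n).
Proof.
have [[lin1 lin2 _] _] := tT.
have act1M x y m : gmod_act M1 (1, x)%g (gmod_act M1 (1, y)%g m) = gmod_act M1 (1, x * y)%g m.
  by rewrite -gmod_actM; congr (gmod_act M1 _ m); apply: injective_projections; rewrite /= ?mulg1.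
case=> [[theta thE]|[theta thE]].
  apply: (tensor_lattice tT c1 (c2 : coords (lres M2) n2)
    (P := fun x => gmod_act M1 (1, x^-1)%g) (Q := fun x => theta \o gmod_act (lres M2) x^-1%g) O_dvr).
  - by move=> x y m; rewrite act1M invMg.
  - move=> x y u; rewrite [in RHS]invMg invgK; congr (theta _).
    exact/esym/(gmod_actM (g := lres M2)).
  move=> m u; have [F FE] := linear_pack (lin2 m).
  rewrite -[RHS]FE [in RHS](thE u) linear_sum; apply: eq_bigr => y _.
  by rewrite FE tensor_slide invgK.
apply: (tensor_lattice tT c1 (c2 : coords (lres M2) n2)
    (P := fun x => theta \o gmod_act (rres M1) x^-1%g) (Q := fun x => gmod_act (lres M2) x^-1%g) O_dvr).
- by move=> x y m; rewrite /= act1M invMg.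
- by move=> x y u; rewrite -gmod_actM invMg invgK.
move=> m u; have [F FE] := linear_pack (lin1 u).
rewrite -[RHS]FE [in RHS](thE m) linear_sum; apply: eq_bigr => y _.
by rewrite FE -tensor_slide.
Qed.

(** The projective summand of the tensor product does not contribute to the trace. *)
Lemma stable_tensor_trace (D : block O gT1) (X : gmod O (gT1 * gT1)%type)
    nT (cT : coords T nT) nD (cD : coords (block_bimod D) nD) z :
  (forall x z m n, t (gmod_act M1 (x, 1%g) m) (gmod_act M2 (1%g, z) n) =
     gmod_act T (x, z) (t m n)) ->
  projective_in (fun Y => block_bimodule Y D D) X ->
  giso T (gprod (block_bimod D) X) -> (p %| #[z]%g)%N -> (#[z]%g %| N)%N ->
  #|gT2|%:R * lat_tr cD (gmod_act (block_bimod D) z) =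
    \sum_y lat_tr c1 (gmod_act M1 (z.1, y)) * lat_tr c2 (gmod_act M2 (y, z.2)).
Proof.
move=> t_eq X_proj T_iso pz zN.
have [_ DD DC _] := block_idemP D.
have [e [ee eC eE]] := block_bimodule_idem DD DC DD DC.
have [nX [cX]] := giso_lattice T_iso cT O_dvr.
have trX := projective_trace0 cX ee eC eE X_proj pz zN.
have := giso_trace T_iso cT cD cX z; rewrite trX addr0 => <-.
rewrite (tensor_trace tT c1 (c2 : coords (lres M2) n2) tensor_block_act bb bC cT
  (al := gmod_act M1 (z.1, 1%g)) (be := gmod_act M2 (1%g, z.2))) => [|m u].
  apply: eq_bigr => y _; congr (_ * _); apply: lat_tr_eq => v /=; rewrite -gmod_actM.
    by congr (gmod_act M1 _ v); apply: injective_projections; rewrite /= ?mulg1 ?mul1g.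
  by congr (gmod_act M2 _ v); apply: injective_projections; rewrite /= ?mulg1 ?mul1g.
by rewrite t_eq -surjective_pairing.
Qed.

End TensorBimodule.

Section StableMorita.

Variables (gT gT' : finGroupType) (B : block O gT) (B' : block O gT').
Variable M : gmod O (gT' * gT)%type.
Hypothesis M_stable : stable_Morita B' B M.
Variables (n : nat) (c : coords M n).

Lemma dual_block_left : idem_module B (lres (bimod_dual M)).
Proof.
have [bM _ _ _ _] := M_stable => f; apply/val_inj/funext => m.
have -> : val (galg_act (V := lres (bimod_dual M)) B f)
    = fun m' => \sum_y block_idem B y *: (f : M -> O^o) (gmod_act M (1, y^-1)%g m').
  apply/funext => m'; rewrite /galg_act raddf_sum /= fct_sumE; apply: eq_bigr => y _.
  rewrite /= !fctE; congr (_ *: (f : M -> O^o) (gmod_act M _ m')).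
  by apply: injective_projections; rewrite /= ?invg1.
have /asboolP f_lin := hom_funP f; have [F FE] := linear_pack f_lin.
have [_ mB] := bM m; rewrite -[in RHS]mB bimod_ract_sum -[RHS]FE linear_sum.
by apply: eq_bigr => y _; rewrite linearZ FE.
Qed.

Lemma stable_trace_left nB (cB : coords (block_bimod B) nB) (z : gT * gT) :
  (p %| #[z]%g)%N -> (#[z]%g %| N)%N ->
  #|gT'|%:R * lat_tr cB (gmod_act (block_bimod B) z) =
    \sum_y lat_tr c (gmod_act M (y^-1, z.1^-1)%g) * lat_tr c (gmod_act M (y, z.2)).
Proof.
move=> pz zN; have [bM [_ M_proj] _ _ [T [X [[t tT t_eq] X_proj T_iso]]]] := M_stable.
have [_ B'B' B'C _] := block_idemP B'.
have [c' c'E] := dual_trace c.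
have B'M : idem_module B' (lres M) by move=> m; have [] := bM m.
have th := projective_relative_trace B'B' B'C (fun Y => iff_refl _) M_proj.
have [nT [cT]] := projective_tensor_lattice tT B'B' B'C B'M c' c (or_introl th).
rewrite (stable_tensor_trace tT B'B' B'C B'M c' c cT cB t_eq X_proj T_iso pz zN).
by apply: eq_bigr => y _; rewrite c'E.
Qed.

Lemma stable_trace_right nB' (cB' : coords (block_bimod B') nB') (z : gT' * gT') :
  (p %| #[z]%g)%N -> (#[z]%g %| N)%N ->
  #|gT|%:R * lat_tr cB' (gmod_act (block_bimod B') z) =
    \sum_y lat_tr c (gmod_act M (z.1, y)) * lat_tr c (gmod_act M (z.2^-1, y^-1)%g).
Proof.
move=> pz zN; have [bM _ [_ M_proj] [T [X [[t tT t_eq] X_proj T_iso]]] _] := M_stable.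
have [_ BB BC _] := block_idemP B.
have [c' c'E] := dual_trace c.
have aBB : antipode B * antipode B = antipode B by rewrite -antipodeM BB.
have th := projective_relative_trace aBB (antipode_central BC) (fun Y => iff_refl _) M_proj.
have [nT [cT]] := projective_tensor_lattice tT BB BC dual_block_left c c' (or_intror th).
rewrite (stable_tensor_trace tT BB BC dual_block_left c c' cT cB' t_eq X_proj T_iso pz zN).
by apply: eq_bigr => y _; rewrite c'E.
Qed.

End StableMorita.

End StableTraces.

(** * Operators on class functions *)

Section Kernels.

Variable K : fieldType.

(** The map on class functions induced by a bimodule with character [kap]. *)
Definition kern (gT' gT : finGroupType) (kap : gT' -> gT -> K) (f : {ffun gT -> K}) :
  {ffun gT' -> K} := [ffun x => #|gT|%:R^-1 * \sum_y kap x y * f y].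

Fact kern_zmod (gT' gT : finGroupType) (kap : gT' -> gT -> K) : zmod_morphism (kern kap).
Proof.
move=> f g; apply/ffunP => x; rewrite !ffunE -mulrBr -sumrB; congr (_ * _).
by apply: eq_bigr => y _; rewrite !ffunE mulrBr.
Qed.

HB.instance Definition _ (gT' gT : finGroupType) (kap : gT' -> gT -> K) :=
  GRing.isZmodMorphism.Build {ffun gT -> K} {ffun gT' -> K} (kern kap) (kern_zmod kap).

(** On generalised characters, the conjugation [mu |-> mu ^+ t]. *)
Definition powf (gT : finGroupType) t (f : {ffun gT -> K}) : {ffun gT -> K} :=
  [ffun y => f (y ^+ t)%g].

Fact powf_zmod (gT : finGroupType) t : zmod_morphism (@powf gT t).
Proof. by move=> f g; apply/ffunP => x; rewrite !ffunE. Qed.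

HB.instance Definition _ (gT : finGroupType) t :=
  GRing.isZmodMorphism.Build {ffun gT -> K} {ffun gT -> K} (@powf gT t) (@powf_zmod gT t).

Lemma expg_inj (gT : finGroupType) t : coprime t #|gT| -> injective (fun y : gT => y ^+ t)%g.
Proof.
move=> tG x y xy; have G_t : coprime #|[set: gT]| t by rewrite cardsT coprime_sym.
by rewrite -(expgK G_t (finset.in_setT x)) xy (expgK G_t (finset.in_setT y)).
Qed.

Lemma kern_powf (gT' gT : finGroupType) (kap : gT' -> gT -> K) t f :
  coprime t #|gT| -> (forall x y, kap (x ^+ t)%g (y ^+ t)%g = kap x y) ->
  kern kap (powf t f) = powf t (kern kap f).
Proof.
move=> tG kapt; apply/ffunP => x; rewrite !ffunE; congr (_ * _).
by rewrite [RHS](reindex_inj (expg_inj tG)); apply: eq_bigr => y _; rewrite ffunE kapt.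
Qed.

Lemma kern_comp (gT1 gT2 gT : finGroupType) (k1 : gT2 -> gT -> K) (k2 : gT1 -> gT2 -> K)
    (k3 : gT1 -> gT -> K) (f : {ffun gT -> K}) :
  #|gT2|%:R != 0 :> K ->
  (forall x y, f y != 0 -> #|gT2|%:R * k3 x y = \sum_z k2 x z * k1 z y) ->
  kern k2 (kern k1 f) = kern k3 f.
Proof.
move=> n0 k3E; apply/ffunP => x; rewrite !ffunE.
under eq_bigr do rewrite ffunE mulrCA mulr_sumr.
rewrite -mulr_sumr mulrCA; congr (_ * _); rewrite exchange_big mulr_sumr /=.
apply: eq_bigr => y _; have [->|fy] := eqVneq (f y) 0.
  by rewrite mulr0 big1 ?mulr0 // => z _; rewrite !mulr0.
under eq_bigr do rewrite mulrA.
by rewrite -mulr_suml mulrA -k3E // mulKf.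
Qed.

End Kernels.

Section InnerProduct.

Variables (O : idomainType) (gT : finGroupType).
Local Notation K := {fraction O}.
Implicit Types f g h : {ffun gT -> K}.

Lemma cdotC f g : cdot f g = cdot g f.
Proof.
rewrite /cdot (reindex_inj invg_inj); congr (_ * _).
by apply: eq_bigr => x _; rewrite invgK mulrC.
Qed.

Lemma cdotBl f g h : cdot (f - g) h = cdot f h - cdot g h.
Proof.
rewrite /cdot -mulrBr -sumrB; congr (_ * _).
by apply: eq_bigr => x _; rewrite !ffunE mulrBl.
Qed.

Lemma cdotMnl f g n : cdot (f *+ n) g = cdot f g *+ n.
Proof.
rewrite /cdot -mulrnAr -sumrMnl; congr (_ * _).
apply: eq_bigr => x _; rewrite -mulrnAl; congr (_ * _).
by elim: n => [|n IHn]; rewrite ?mulr0n ?ffunE // !mulrS ffunE IHn.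
Qed.

Lemma cdot_powf t f g : coprime t #|gT| -> cdot (powf t f) (powf t g) = cdot f g.
Proof.
move=> tG; rewrite /cdot [in RHS](reindex_inj (expg_inj tG)); congr (_ * _).
by apply: eq_bigr => x _; rewrite !ffunE expVgn.
Qed.

End InnerProduct.

(** ** Functions with cyclotomic values *)

Section Cyclotomic.

Variables (K : fieldType) (r : {rmorphism rat -> K}) (N : nat) (mu : K).
Hypothesis mu_prim : N.-primitive_root mu.

(** The function is defined over the rationals, compatibly with the action of the
    Galois group of the cyclotomic field through power maps. *)
Definition cyclotomic_fun (gT : finGroupType) (f : {ffun gT -> K}) :=
  forall y, exists q, forall j, f (y ^+ j)%g = evq r q (mu ^+ j).

Lemma cyclotomic_funB (gT : finGroupType) (f g : {ffun gT -> K}) :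
  cyclotomic_fun f -> cyclotomic_fun g -> cyclotomic_fun (f - g).
Proof.
move=> fq gq y; have [q qE] := fq y; have [s sE] := gq y.
by exists (q - s) => j; rewrite evqB -qE -sE !ffunE.
Qed.

Lemma cyclotomic_fun0 (gT : finGroupType) : cyclotomic_fun (0 : {ffun gT -> K}).
Proof. by move=> y; exists 0 => j; rewrite /evq rmorph0 horner0 ffunE. Qed.

Lemma cyclotomic_powf (gT : finGroupType) t (f : {ffun gT -> K}) :
  cyclotomic_fun f -> cyclotomic_fun (powf t f).
Proof.
move=> fq y; have [q qE] := fq y; exists (q \Po 'X^t) => j.
by rewrite evqXn -exprM -qE ffunE -expgM.
Qed.

(** An element of the field generated by [mu] is fixed by the automorphism
    [mu |-> mu ^+ t] as soon as the function is invariant under the power map. *)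
Lemma powf_fixed (gT : finGroupType) t (f : {ffun gT -> K}) : coprime t N ->
  cyclotomic_fun f ->
  powf t f = f <-> (forall q, range f (evq r q mu) -> evq r q (mu ^+ t) = evq r q mu).
Proof.
move=> tN fq; have mut : N.-primitive_root (mu ^+ t) by rewrite prim_root_exp_coprime.
split=> [ft q [y _ fy]|ft].
  have [s sE] := fq y.
  have sq : evq r s (mu ^+ t) = evq r q (mu ^+ t).
    by apply: (@prim_root_transfer_eq _ _ r r _ mu _ s q mu_prim mut);
       rewrite -fy -[mu]expr1 -sE expg1.
  by rewrite -sq -sE -fy -[in RHS]ft ffunE.
apply/ffunP => y; rewrite ffunE; have [s sE] := fq y.
rewrite sE -[y in RHS]expg1 sE expr1; apply: ft; exists y => //.
by rewrite -[y]expg1 sE expr1.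
Qed.

End Cyclotomic.

(** Over the complex numbers, where the inverse of a root of unity is its conjugate,
    the product [cdot f f] becomes a sum of squares of absolute values. *)
Lemma cdot_definite (O : idomainType) (r : {rmorphism rat -> {fraction O}}) N
    (mu : {fraction O}) (gT : finGroupType) (f : {ffun gT -> {fraction O}}) :
  N.-primitive_root mu -> (forall y : gT, y ^+ N = 1)%g -> cyclotomic_fun r mu f ->
  cdot f f = 0 -> f = 0.
Proof.
move=> muP yN fq; have N_gt0 := prim_order_gt0 muP.
have G0 : #|gT|%:R != 0 :> {fraction O}.
  by rewrite -(rmorph_nat r) fmorph_eq0 pnatr_eq0 -lt0n; apply/card_gt0P; exists 1%g.
move=> /eqP; rewrite mulf_eq0 invr_eq0 (negbTE G0) => /= /eqP f0.
have [q qE] := choice fq.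
have [w wP] := C_prim_root_exists N_gt0.
have rC : {rmorphism rat -> algC} by exact: (@ratr algC).
pose Q := \sum_y q y * (q y \Po 'X^(N.-1)).
have evQ (L : fieldType) (h : {rmorphism rat -> L}) z :
    evq h Q z = \sum_y evq h (q y) z * evq h (q y) (z ^+ N.-1).
  rewrite /evq rmorph_sum horner_sum; apply: eq_bigr => y _.
  by rewrite rmorphM hornerM; congr (_ * _); exact: evqXn.
have Q0 : evq rC Q w = 0.
  apply: (prim_root_transfer rC muP wP (f := r)); rewrite evQ -[RHS]f0.
  apply: eq_bigr => y _; rewrite -qE -[X in evq _ _ X](expr1 mu) -qE expg1; congr (_ * f _).
  by apply/eqP; rewrite eq_sym eq_invg_mul -expgS prednK // yN.
have wV : w ^+ N.-1 = w^*.
  have w1 : `|w| = 1.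
    by apply/eqP; rewrite -(pexpr_eq1 N_gt0) // -normrX (prim_expr_order wP) normr1.
  have w0 : w != 0 by rewrite -normr_eq0 w1 oner_eq0.
  by apply: (mulfI w0); rewrite -exprS prednK // (prim_expr_order wP) -normCK w1 expr1n.
have : \sum_y `|evq rC (q y) w| ^+ 2 = 0.
  rewrite -[RHS]Q0 evQ; apply: eq_bigr => y _; rewrite normCK wV; congr (_ * _).
  by rewrite (evq_map rC Num.conj rC).
move=> /eqP; rewrite psumr_eq0 => [/allP q0|y _]; last exact: exprn_ge0.
apply/ffunP => y; rewrite ffunE -[y]expg1 qE expr1.
have := q0 y (mem_index_enum _); rewrite sqrf_eq0 normr_eq0 => /eqP.
exact: (prim_root_transfer r wP muP).
Qed.

(** * Generalised characters *)

Section GeneralisedCharacters.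

Variables (O : idomainType) (gT : finGroupType) (b : galg O gT).
Local Notation K := {fraction O}.
Local Notation G := [set: gT].

Lemma Irr_ZIrr chi : Irr b chi -> ZIrr b chi.
Proof. by move=> chiP; exists 1%N, (fun=> chi), (fun=> 1); rewrite big_ord1. Qed.

Lemma ZIrr0 : ZIrr b 0.
Proof. by exists 0%N, (fun=> 0), (fun=> 0); rewrite big_ord0; split=> // -[]. Qed.

Lemma ZIrrB phi psi : ZIrr b phi -> ZIrr b psi -> ZIrr b (phi - psi).
Proof.
move=> [n [c [z [cI ->]]]] [m [d [w [dI ->]]]].
pose cd (s : 'I_n + 'I_m) := match s with inl i => c i | inr j => d j end.
pose zw (s : 'I_n + 'I_m) := match s with inl i => z i | inr j => - w j end.
exists (n + m)%N, (cd \o @fintype.split n m), (zw \o @fintype.split n m).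
split=> [i|]; first by rewrite /= /cd; case: (fintype.split i) => j.
rewrite big_split_ord /= -sumrN; congr (_ + _); apply: eq_bigr => i _.
  by rewrite (unsplitK (inl i)).
by rewrite (unsplitK (inr i)) mulrNz.
Qed.

Lemma ZIrrD phi psi : ZIrr b phi -> ZIrr b psi -> ZIrr b (phi + psi).
Proof.
move=> phiP psiP; rewrite -[psi]opprK -[- psi]sub0r.
by apply: ZIrrB => //; apply: ZIrrB => //; exact: ZIrr0.
Qed.

Lemma ZIrrMn psi n : ZIrr b psi -> ZIrr b (psi *+ n).
Proof.
move=> psiP; elim: n => [|n IHn]; first exact: ZIrr0.
by rewrite mulrS; apply: ZIrrD.
Qed.

Lemma ZIrr_ind (P : {ffun gT -> K} -> Prop) : P 0 -> (forall chi, Irr b chi -> P chi) ->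
  (forall phi psi, ZIrr b phi -> ZIrr b psi -> P phi -> P psi -> P (phi - psi)) ->
  forall psi, ZIrr b psi -> P psi.
Proof.
move=> P0 PI PB psi [n [c [z [cI ->]]]].
pose Q phi := ZIrr b phi /\ P phi.
have Q0 : Q 0 by split; first exact: ZIrr0.
have QB x y : Q x -> Q y -> Q (x - y).
  by move=> [xZ xP] [yZ yP]; split; [exact: ZIrrB | exact: PB].
have QD x y : Q x -> Q y -> Q (x + y).
  by move=> xQ yQ; rewrite -[y]opprK -[- y]sub0r; do 2!apply: (QB) => //.
have QI i : Q (c i) by split; [exact: Irr_ZIrr | exact: PI].
have QMn i m : Q (c i *+ m) by elim: m => // m IHm; rewrite mulrS; exact: QD.
suff: Q (\sum_(i < n) c i *~ z i) by case.
elim/big_ind: _ => // i _; case: (z i) => m; first exact: QMn.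
rewrite NegzE mulrNz -sub0r; apply: QB => //; exact: QMn.
Qed.

Definition algmx n (rG : mx_representation K G n) (a : galg O gT) : 'M_n :=
  \sum_x tofrac (a x : O) *: rG x.

Lemma repr_setM n (rG : mx_representation K G n) x y : rG (x * y)%g = rG x *m rG y.
Proof. by rewrite repr_mxM ?inE. Qed.

(** The trace is additive along a composition series. *)
Lemma rep_ZIrr n (rG : mx_representation K G n) : algmx rG b = 1%:M ->
  ZIrr b [ffun x => \tr (rG x)].
Proof.
elim/ltn_ind: n rG => n IHn rG rb.
have [n0|n_gt0] := posnP n.
  suff -> : [ffun x => \tr (rG x)] = 0 :> {ffun gT -> K} by exact: ZIrr0.
  by apply/ffunP => x; rewrite !ffunE /mxtrace
    big1 // => i; have := leq_trans (ltn_ord i) (eq_leq n0).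
have [irr|] := pselect (mx_irreducible rG).
  by apply: Irr_ZIrr; exists n, rG.
move=> nirr; have : ~ (forall U : 'M_n, mxmodule rG U -> U != 0 -> row_full U).
  by move=> min; apply: nirr; apply/mx_irrP.
move=> /existsNP[U] /not_implyP[Umod] /not_implyP[U0 /negP Ufull].
have Un : (\rank U < n)%N by rewrite ltn_neqAle rank_leq_col andbT.
have U_gt0 : (0 < \rank U)%N by rewrite lt0n mxrank_eq0.
have cokn : (\rank (cokermx U) < n)%N by rewrite mxrank_coker; lia.
have -> : [ffun x => \tr (rG x)] = [ffun x => \tr (submod_repr Umod x)]
      + [ffun x => \tr (factmod_repr Umod x)] :> {ffun gT -> K}.
  by apply/ffunP => x; rewrite !ffunE mxtrace_sub_fact_mod.
apply: ZIrrD; apply: IHn => //.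
  transitivity (in_submod U (val_submod (1%:M : 'M_(\rank U)) *m algmx rG b)).
    rewrite /algmx mulmx_sumr linear_sum; apply: eq_bigr => x _.
    by rewrite -scalemxAr linearZ.
  by rewrite rb mulmx1 val_submodK.
transitivity (in_factmod U (val_factmod (1%:M : 'M_(\rank (cokermx U))) *m algmx rG b)).
  rewrite /algmx mulmx_sumr linear_sum; apply: eq_bigr => x _.
  by rewrite -scalemxAr linearZ.
by rewrite rb mulmx1 val_factmodK.
Qed.

(** The image of an idempotent that commutes with a representation carries a
    representation. *)
Lemma idempotent_ZIrr n (rG : mx_representation K G n) (E : 'M_n) :
  E *m E = E -> (forall x, E *m rG x = rG x *m E) -> algmx rG b *m E = E ->
  ZIrr b [ffun x => \tr (rG x *m E)].
Proof.
move=> EE EG Eb; have := idempotent_factor EE; move: (\rank E) => r [C [W [CW WC]]].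
have WE : W *m E = W by rewrite -CW mulmxA WC mul1mx.
have EC : E *m C = C by rewrite -CW -mulmxA WC mulmx1.
have sG_repr : mx_repr G (fun x => W *m rG x *m C).
  split=> [|x y _ _]; first by rewrite repr_mx1 mulmx1 WC.
  rewrite repr_setM -!mulmxA; congr (W *m _); rewrite [C *m _]mulmxA CW mulmxA.
  by rewrite [E *m _]mulmxA EG !mulmxA -[_ *m E *m C]mulmxA EC.
pose sG := MxRepresentation sG_repr.
have -> : [ffun x => \tr (rG x *m E)] = [ffun x => \tr (sG x)] :> {ffun gT -> K}.
  by apply/ffunP => x; rewrite !ffunE /= -CW mulmxA mxtrace_mulC mulmxA.
apply: rep_ZIrr; transitivity (W *m (algmx rG b *m E) *m C); last by rewrite Eb WE.
rewrite -!mulmxA EC /algmx mulmx_suml mulmx_sumr; apply: eq_bigr => x _ /=.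
by rewrite -scalemxAl -scalemxAr mulmxA.
Qed.

End GeneralisedCharacters.

Section BlockProjection.

Variables (O : idomainType) (gT : finGroupType).
Local Notation K := {fraction O}.
Local Notation G := [set: gT].
Hypothesis K_char : [pchar K] =i pred0.

Lemma algmxM n (rG : mx_representation K G n) (a c : galg O gT) :
  algmx rG (a * c) = algmx rG a *m algmx rG c.
Proof.
rewrite /algmx mulmx_suml; under eq_bigr do rewrite galg_mulE rmorph_sum scaler_suml.
rewrite exchange_big; apply: eq_bigr => x _ /=.
rewrite mulmx_sumr (reindex_inj (mulgI x)); apply: eq_bigr => y _ /=.
by rewrite mulKg repr_setM -scalemxAl -scalemxAr scalerA rmorphM.
Qed.

Lemma algmx_gelt n (rG : mx_representation K G n) x : algmx rG (gelt O x) = rG x.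
Proof.
rewrite /algmx (bigD1 x) //= ffunE eqxx rmorph1 scale1r big1 ?addr0 // => y /negbTE yx.
by rewrite ffunE yx rmorph0 scale0r.
Qed.

Definition block_kernel (b : galg O gT) y y' : K :=
  tofrac (\sum_g b (y' * g^-1 * y^-1 * g)%g : O).

Lemma card_neq0 : #|gT|%:R != 0 :> K.
Proof.
have /pcharf0P -> := K_char; rewrite -lt0n; by apply/card_gt0P; exists 1%g.
Qed.

(** The operator [kern (block_kernel b)] projects class functions onto those of the
    block, as averaging over conjugates has no effect on the central element [b]. *)
Lemma block_projection (b : galg O gT) n (rG : mx_representation K G n) :
  (forall a, a * b = b * a) ->
  kern (block_kernel b) [ffun x => \tr (rG x)] = [ffun y => \tr (rG y *m algmx rG b)].
Proof.
move=> bC; have rC g : rG g *m algmx rG b = algmx rG b *m rG g.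
  by rewrite -(algmx_gelt rG g) -!algmxM bC.
apply/ffunP => y; rewrite !ffunE; apply: (mulfI card_neq0); rewrite mulVKf ?card_neq0 //.
rewrite /block_kernel; under eq_bigr do rewrite rmorph_sum mulr_suml.
rewrite exchange_big -sum1_card natr_sum mulr_suml; apply: eq_bigr => g _ /=.
transitivity (\tr (rG (g^-1 * y * g)%g *m algmx rG b)).
  rewrite /algmx mulmx_sumr raddf_sum (reindex_inj (mulIg (g^-1 * y * g)%g)).
  apply: eq_bigr => x _ /=; rewrite -scalemxAr mxtraceZ ffunE repr_setM mxtrace_mulC.
  by have -> : (x * (g^-1 * y * g) * g^-1 * y^-1 * g)%g = x
    by rewrite -!mulgA mulKVg mulKVg mulVg mulg1.
rewrite mul1r !repr_setM -mulmxA rC mulmxA mxtrace_mulC !mulmxA mxtrace_mulC.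
by rewrite !mulmxA rC -[algmx rG b *m _ *m _]mulmxA -repr_setM mulgV repr_mx1 mulmx1.
Qed.

Lemma block_projection_id (b : galg O gT) : (forall a, a * b = b * a) ->
  forall psi, ZIrr b psi -> kern (block_kernel b) psi = psi.
Proof.
move=> bC; apply: ZIrr_ind => [|_ [n [rG [_ rb ->]]]|phi psi _ _ phiE psiE].
- exact: raddf0.
- by rewrite block_projection // /algmx rb; apply/ffunP => x; rewrite !ffunE mulmx1.
by rewrite raddfB /= phiE psiE.
Qed.

Lemma block_projection_ZIrr (b : galg O gT) : b * b = b -> (forall a, a * b = b * a) ->
  forall psi, ZIrr (1 : galg O gT) psi -> ZIrr b (kern (block_kernel b) psi).
Proof.
move=> bb bC; apply: ZIrr_ind => [|_ [n [rG [_ _ ->]]]|phi psi _ _ phiE psiE].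
- by rewrite raddf0; exact: ZIrr0.
- rewrite block_projection //; apply: idempotent_ZIrr => [|x|]; rewrite -?algmxM ?bb //.
  by rewrite -(algmx_gelt rG x) -!algmxM bC.
by rewrite raddfB /=; exact: ZIrrB.
Qed.

Lemma ZIrr_cyclotomic (r : {rmorphism rat -> K}) N (mu : K) (b : galg O gT) psi :
  N.-primitive_root mu -> (forall y : gT, y ^+ N = 1)%g ->
  ZIrr b psi -> cyclotomic_fun r mu psi.
Proof.
move=> muP yN; move: psi; apply: ZIrr_ind => [|_ [n [rG [_ _ ->]]] y|phi psi _ _].
- exact: cyclotomic_fun0.
- have rX j : rG (y ^+ j)%g = rG y ^+ j.
    elim: j => [|j IHj]; first by rewrite repr_mx1.
    by rewrite expgS repr_setM IHj [RHS]exprS.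
  have [|q qE] := trace_evq r muP (A := rG y); first by rewrite -rX yN repr_mx1.
  by exists q => j; rewrite ffunE rX qE.
exact: cyclotomic_funB.
Qed.

End BlockProjection.

(** ** Conjugates of characters *)

Section Convolution.

Variables (O : idomainType) (gT : finGroupType).
Local Notation K := {fraction O}.
Local Notation G := [set: gT]%G.
Hypothesis K_char : [pchar K] =i pred0.

Let aG := regular_repr K G.

Lemma mxtrace_regular_mx x : \tr (aG x) = #|gT|%:R *+ (x == 1%g).
Proof.
rewrite /mxtrace; transitivity (\sum_(i < #|G|) ((x == 1%g)%:R : K)).
  apply: eq_bigr => i _; rewrite mxE mxE eqxx /=; congr (_ %:R); congr nat_of_bool.
  have [->|x1] := eqVneq x 1%g; first by rewrite mulg1 gring_valK eqxx.
  apply/negbTE; apply: contraNneq x1 => /(congr1 enum_val).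
  rewrite gring_indexK ?inE // => /eqP.
  by rewrite -[X in X == _]mulg1 (inj_eq (mulgI _)) eq_sym.
by rewrite sumr_const card_ord cardsT; case: eqP => _; rewrite ?mulr1n ?mulr0n ?mul0rn.
Qed.

(** The central idempotent of an irreducible representation has coefficients
    proportional to the values of the dual character; that it acts as 1 on the
    representation is the convolution formula. *)
Lemma irreducible_convolution n (rG : mx_representation K G n) : mx_irreducible rG ->
  exists2 m, (0 < m)%N & forall y,
    m%:R * \sum_x \tr (rG x) * \tr (rG (x^-1 * y)%g) = #|gT|%:R * \tr (rG y).
Proof.
move=> irrG; apply/asboolP; apply: (socle_exists aG) => sG; apply/asboolP.
have F'G : ([pchar K]^'.-group G)%g.
  by apply/pgroupP => q _ _; rewrite -[q \in _]/(q \notin [pchar K]) K_char.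
pose i := irr_comp sG rG; have rsim := rsim_irr_comp_pchar sG F'G irrG.
have chiE x : \tr (rG x) = \tr (irr_repr i x) by rewrite (mxtrace_rsim rsim) ?inE.
have /envelop_mxP[a eE] : (Wedderburn_id i \in enveloping_algebra_mx aG)%MS.
  by have := Wedderburn_id_mem i; rewrite genmxE mem_sub_gring => /andP[].
have op_e j : \sum_(x in G) a x *: irr_repr j x = (j == i)%:R%:M.
  transitivity (gring_op (irr_repr j) (Wedderburn_id i)).
    rewrite eE linear_sum; apply: eq_bigr => x Gx; by rewrite linearZ /= gring_opG.
  have [->|ji] := eqVneq j i; first by rewrite op_Wedderburn_id_pchar.
  by rewrite eq_sym in ji; rewrite (irr_repr'_op0_pchar F'G ji (Wedderburn_id_mem i)) raddf0.
have trE x : \tr (aG x) = \sum_(W : sG) \tr (irr_repr W x) *+ socle_mult W.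
  have soc1 : (Socle sG :=: 1%:M)%MS by rewrite -(irr_mx_sum_pchar sG F'G).
  by rewrite -(mxtrace_submod1 (Socle_module sG) soc1) ?inE // mxtrace_Socle ?inE.
have op_tr j y : \sum_(x in G) a x * \tr (irr_repr j (x * y)%g)
    = \tr (irr_repr j y) *+ (j == i).
  transitivity (\tr ((\sum_(x in G) a x *: irr_repr j x) *m irr_repr j y)).
    rewrite mulmx_suml raddf_sum; apply: eq_bigr => x _ /=.
    by rewrite -scalemxAl mxtraceZ repr_setM.
  by rewrite op_e; case: (j == i); rewrite ?mul1mx // mul_scalar_mx scale0r mxtrace0.
pose m := socle_mult i.
(* the regular character reads off the coefficients of the idempotent *)
have aE y : #|gT|%:R * a y = m%:R * \tr (rG y^-1%g).
  transitivity (\sum_(x in G) a x * \tr (aG (x * y^-1)%g)).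
    rewrite (bigD1 y) ?inE //= mxtrace_regular_mx mulgV eqxx mulrC big1 ?addr0 //.
    by move=> x /andP[_ xy]; rewrite mxtrace_regular_mx -eq_mulgV1 (negbTE xy) mulr0.
  under eq_bigr do rewrite trE mulr_sumr.
  rewrite exchange_big (bigD1 i) //= [X in _ + X]big1 => [|j ji].
    under eq_bigr do rewrite mulrnAr.
    by rewrite addr0 sumrMnl op_tr eqxx chiE mulr_natl.
  under eq_bigr do rewrite mulrnAr.
  by rewrite sumrMnl op_tr (negbTE ji) mul0rn.
exists m => [|y].
  have simi := socle_simple i; rewrite /m /socle_mult divn_gt0.
    by apply: mxrankS; apply: component_mx_id.
  by rewrite lt0n mxrank_eq0; case: simi.
have -> : \tr (rG y) = \sum_(x in G) a x * \tr (rG (x * y)%g).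
  by under eq_bigr do rewrite chiE; rewrite op_tr eqxx mulr1n chiE.
rewrite (reindex_inj invg_inj) !mulr_sumr; apply: eq_big => [x|x _]; first by rewrite inE.
by rewrite invgK !mulrA -aE.
Qed.

(** Scaled to an idempotent of the group algebra, the function cuts out a part of
    the regular representation, whose character is [h *+ m]. *)
Lemma convolution_idempotent_ZIrr (h : {ffun gT -> K}) m :
  (forall x y, h (x * y)%g = h (y * x)%g) ->
  (forall y, m%:R * \sum_x h x * h (x^-1 * y)%g = #|gT|%:R * h y) ->
  ZIrr (1 : galg O gT) (h *+ m).
Proof.
move=> h_class h_idem; have G0 := card_neq0 gT K_char.
pose E := \sum_x (#|gT|%:R^-1 * m%:R * h x^-1%g) *: aG x.
have EG x : E *m aG x = aG x *m E.
  rewrite /E mulmx_suml mulmx_sumr (reindex_inj (mulgI x)) [RHS](reindex_inj (mulIg x)) /=.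
  apply: eq_bigr => y _; rewrite -scalemxAl -scalemxAr -!repr_setM !invMg h_class.
  by rewrite mulgA.
have EE : E *m E = E.
  rewrite {1}/E mulmx_suml.
  transitivity (\sum_x \sum_y (#|gT|%:R^-1 * m%:R * h x^-1%g) *:
      ((#|gT|%:R^-1 * m%:R * h (x^-1 * y)^-1%g) *: aG y)).
    apply: eq_bigr => x _; rewrite -scalemxAl /E mulmx_sumr scaler_sumr.
    rewrite [RHS](reindex_inj (mulgI x)); apply: eq_bigr => y _ /=.
    by rewrite -scalemxAr -repr_setM mulKg.
  rewrite exchange_big; apply: eq_bigr => y _ /=.
  under eq_bigr do rewrite scalerA.
  rewrite -scaler_suml; congr (_ *: _).
  transitivity (#|gT|%:R^-1 * m%:R *
      (#|gT|%:R^-1 * (m%:R * \sum_x h x * h (x^-1 * y^-1)%g))); last by rewrite h_idem mulKf.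
  rewrite [X in m%:R * X](reindex_inj invg_inj) !mulr_sumr; apply: eq_bigr => x _.
  by rewrite invgK invMg invgK [h (y^-1 * x)%g]h_class; ring.
have := @idempotent_ZIrr O gT 1 _ aG E EE EG; rewrite (_ : algmx aG 1 = 1%:M).
  rewrite mul1mx => /(_ erefl); congr (ZIrr _ _); apply/ffunP => y.
  rewrite ffunE mulmx_sumr raddf_sum (bigD1 y^-1%g) //= -scalemxAr mxtraceZ -repr_setM.
  rewrite mxtrace_regular_mx mulgV eqxx invgK big1 => [|x xy].
    rewrite addr0 mulr1n; transitivity (h y *+ m).
      by rewrite -[RHS]mulr_natl mulrC !mulrA (mulfV G0) mul1r.
    by elim: (m) => [|d IHd]; rewrite ?mulr0n ?ffunE // !mulrS ffunE IHd.
  rewrite -scalemxAr mxtraceZ -repr_setM mxtrace_regular_mx.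
  by rewrite -eq_invg_mul eq_sym (negbTE xy) mulr0.
by rewrite -[RHS](repr_mx1 aG); exact: (algmx_gelt aG 1%g).
Qed.

Lemma character_class (b : galg O gT) chi : 
  Irr b chi -> forall x y : gT, chi (x * y)%g = chi (y * x)%g.
Proof.
by move=> [n [rG [_ _ ->]]] x y; rewrite !ffunE !repr_setM mxtrace_mulC.
Qed.

(** The conjugate [powf t chi] of an irreducible character satisfies the same
    algebraic identities as [chi], because a primitive root of unity has the same
    polynomial relations as its powers. *)
Lemma conjugate_multiple (r : {rmorphism rat -> K}) N (mu : K) t (b : galg O gT) psi :
  N.-primitive_root mu -> (forall y : gT, y ^+ N = 1)%g -> coprime t N ->
  ZIrr b psi -> exists2 m, (0 < m)%N & ZIrr (1 : galg O gT) (powf t psi *+ m).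
Proof.
move=> muP yN tN; move: psi; apply: ZIrr_ind => [|chi chiI|phi psi phiZ psiZ].
- by exists 1%N => //; rewrite raddf0 mul0rn; exact: ZIrr0.
- have chiq := ZIrr_cyclotomic r muP yN (Irr_ZIrr chiI).
  have [q qE] := choice chiq.
  have chi_class := character_class chiI.
  have [n [rG [rirr _ chiE]]] := chiI.
  have [m m_gt0 mE] := irreducible_convolution rirr.
  exists m => //; apply: convolution_idempotent_ZIrr => [x y|y].
    rewrite !ffunE; have -> : ((x * y) ^+ t = x * ((y * x) ^+ t * x^-1))%g.
      transitivity (((y * x) ^+ t) ^ x^-1)%g; last by rewrite conjgE invgK.
      by rewrite conjXg conjgE invgK mulgK.
    by rewrite chi_class mulgKV.
  pose L := \sum_x q x * q (x^-1 * y)%g.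
  have evL j : evq r (L *+ m) (mu ^+ j)
      = m%:R * \sum_x chi (x ^+ j)%g * chi ((x^-1 * y) ^+ j)%g.
    rewrite /evq rmorphMn hornerMn mulr_natl rmorph_sum horner_sum; congr (_ *+ _).
    by apply: eq_bigr => x _; rewrite rmorphM hornerM !qE.
  have evR j : evq r (q y *+ #|gT|) (mu ^+ j) = #|gT|%:R * chi (y ^+ j)%g.
    by rewrite /evq rmorphMn hornerMn mulr_natl qE.
  have mu1 : N.-primitive_root (mu ^+ 1) by rewrite expr1.
  have mut : N.-primitive_root (mu ^+ t) by rewrite prim_root_exp_coprime.
  have := @prim_root_transfer_eq _ _ r r _ _ _ (L *+ m) (q y *+ #|gT|) mu1 mut.
  rewrite !evL !evR => trans; rewrite ffunE -trans.
    by congr (_ * _); apply: eq_bigr => x _; rewrite !ffunE.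
  have := mE y; rewrite chiE ffunE expg1 => <-; congr (_ * _).
  by apply: eq_bigr => x _; rewrite !ffunE !expg1.
move=> [m m_gt0 mZ] [d d_gt0 dZ]; exists (m * d)%N; first by rewrite muln_gt0 m_gt0.
rewrite raddfB /= mulrnBl; apply: ZIrrB; first by rewrite mulrnA; exact: ZIrrMn.
by rewrite mulnC mulrnA; exact: ZIrrMn.
Qed.

End Convolution.

(** * Lattices and the character of a bimodule *)

Lemma common_denominator (O : idomainType) (I : finType) (f : I -> {fraction O}) :
  exists2 d : O, d != 0 & exists g : I -> O, forall i, tofrac d * f i = tofrac (g i).
Proof.
have [num /choice[den nd]] := choice (fun i => frac_num_den (f i)).
exists (\prod_i den i); first by apply/prodf_neq0 => i _; have [] := nd i.
exists (fun i => num i * \prod_(j | j != i) den j) => i.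
have [d0 ->] := nd i; have fd0 : tofrac (den i) != 0 by rewrite tofrac_eq0.
by rewrite (bigD1 i) //= !rmorphM; field.
Qed.

Lemma tofrac_mx_inj (O : idomainType) m n : injective (map_mx (@tofrac O) : 'M_(m, n) -> 'M_(m, n)).
Proof.
move=> A B /matrixP AB; apply/matrixP => i j; have := AB i j; rewrite !mxE => /eqP.
by rewrite tofrac_eq => /eqP.
Qed.

Section IntegralForm.

Variables (O : idomainType) (gT : finGroupType).
Hypothesis O_dvr : complete_dvr O.
Local Notation K := {fraction O}.
Local Notation G := [set: gT].

(** The lattice spanned by the translates of a basis is stable under the group,
    and it is free because [O] is a principal ideal domain. *)
Lemma integral_form n (rG : mx_representation K G n) :
  exists r (A : 'M[K]_(r, n)) (B : 'M_(n, r)) (R : gT -> 'M[O]_r),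
    [/\ A *m B = 1%:M, B *m A = 1%:M & forall y, map_mx (@tofrac O) (R y) = A *m rG y *m B].
Proof.
pose I : finType := (gT * 'I_n)%type.
have [d d0 [g gE]] := common_denominator (fun s : gT * 'I_n * 'I_n => rG s.1.1 s.2 s.1.2).
(* the rows of [L] are the multiples by [d] of the columns of the matrices [rG x] *)
pose L : 'M[O]_(#|I|, n) := \matrix_(a, l) g (enum_val a, l).
pose S : 'M[O]_(n, #|I|) := \matrix_(j, a) (a == enum_rank (1%g, j) :> 'I_#|I|)%:R.
pose P y : 'M[O]_#|I| :=
  \matrix_(a, c) (c == enum_rank ((y * (enum_val a).1)%g, (enum_val a).2))%:R.
pose F m1 m2 (Q : 'M[O]_(m1, m2)) := map_mx (@tofrac O) Q.
have fd0 : tofrac d != 0 by rewrite tofrac_eq0.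
have SL : S *m L = d%:M.
  apply: tofrac_mx_inj; apply/matrixP => j l; rewrite !mxE (bigD1 (enum_rank (1%g, j))) //=.
  rewrite big1 => [|a /negbTE aj]; last by rewrite !mxE aj mul0r.
  rewrite !mxE eqxx mul1r enum_rankK addr0 -gE /= repr_mx1 mxE eq_sym.
  by rewrite rmorphMn mulr_natr.
have PL y : F _ _ (P y *m L) = F _ _ L *m (rG y)^T.
  apply/matrixP => a l; rewrite !mxE (bigD1 (enum_rank ((y * (enum_val a).1)%g, (enum_val a).2))) //=.
  rewrite big1 => [|c /negbTE ca]; last by rewrite !mxE ca mul0r.
  rewrite !mxE eqxx mul1r enum_rankK addr0 -gE /= repr_setM mxE mulr_sumr.
  by apply: eq_bigr => j _; rewrite !mxE -gE /= -mulrA; congr (_ * _); exact: mulrC.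
have [r [W [C [D [LE WE Winj]]]]] := row_basis O_dvr L.
have VW : S *m C *m W = d%:M by rewrite -mulmxA -LE.
have WV : W *m (S *m C) = d%:M.
  apply/row_matrixP => i; apply/eqP; rewrite -subr_eq0 -linearB /=; apply/eqP/Winj.
  rewrite -row_mul mulmxBl -mulmxA VW mul_mx_scalar mul_scalar_mx subrr.
  by rewrite row0.
pose V := (tofrac d)^-1 *: F _ _ (S *m C).
have VW1 : V *m F _ _ W = 1%:M.
  by rewrite /V -scalemxAl -map_mxM VW /F map_scalar_mx scale_scalar_mx mulVf.
have WV1 : F _ _ W *m V = 1%:M.
  by rewrite /V -scalemxAr -map_mxM WV /F map_scalar_mx scale_scalar_mx mulVf.
exists r, V^T, (F _ _ W)^T, (fun y => (D *m P y *m C)^T); split.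
- by rewrite -trmx_mul WV1 trmx1.
- by rewrite -trmx_mul VW1 trmx1.
move=> y; rewrite -map_trmx -[rG y]trmxK -!trmx_mul; congr (_^T).
transitivity (F _ _ (D *m P y *m C) *m (F _ _ W *m V)); first by rewrite WV1 mulmx1.
rewrite mulmxA -map_mxM; have -> : D *m P y *m C *m W = D *m (P y *m L) by rewrite LE !mulmxA.
rewrite map_mxM -/(F _ _ (P y *m L)) PL mulmxA /F -map_mxM -WE !mulmxA.
by [].
Qed.

End IntegralForm.

Lemma tprod_linear (F : fieldType) m1 n1 m2 n2 (B : 'M[F]_(m2, n2)) :
  linear (fun A : 'M_(m1, n1) => tprod A B).
Proof.
elim: m1 => [|m1 IHm] a A1 A2 /=; first by rewrite scaler0 addr0.
rewrite !linearP IHm -!trowbE linearP scale_col_mx add_col_mx.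
by [].
Qed.

Section BimoduleCharacter.

Variables (O : idomainType) (gT gT' : finGroupType) (B : block O gT) (B' : block O gT').
Local Notation K := {fraction O}.
Hypothesis O_dvr : complete_dvr O.
Hypothesis K_char : [pchar K] =i pred0.
Variables (M : gmod O (gT' * gT)%type) (n : nat) (c : coords M n).
Hypothesis bM : block_bimodule M B' B.

Definition bimod_kernel x y : K := tofrac (lat_tr c (gmod_act M (x, y))).
Definition dual_kernel y x : K := bimod_kernel x^-1%g y^-1%g.

Lemma irreducible_lattice chi : Irr B chi ->
  exists2 U : gmod O gT, idem_module B U & lattice_character U chi.
Proof.
move=> [m [rG [_ rb ->]]]; have [r [A [D [R [AD DA RE]]]]] := integral_form O_dvr rG.
have R1 (v : 'cV_r) : R 1%g *m v = v.
  suff -> : R 1%g = 1%:M by rewrite mul1mx.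
  by apply: tofrac_mx_inj; rewrite RE repr_mx1 mulmx1 AD map_mx1.
have RM x y (v : 'cV_r) : R (x * y)%g *m v = R x *m (R y *m v).
  rewrite mulmxA; congr (_ *m v); apply: tofrac_mx_inj.
  by rewrite map_mxM !RE repr_setM -!mulmxA [D *m _]mulmxA DA mul1mx.
pose U := @GMod O gT 'cV[O]_r (fun y => mulmx (R y)) R1 RM.
pose cU : coords U r := @Coords O U r idfun idfun (fun=> erefl) (fun=> erefl).
have Rb : \sum_x (block_idem B x : O) *: R x = 1%:M :> 'M[O]_r.
  apply: tofrac_mx_inj; transitivity (A *m (\sum_x tofrac (block_idem B x : O) *: rG x) *m D).
    2: by rewrite rb mulmx1 AD map_mx1.
  rewrite map_mx_sum mulmx_sumr mulmx_suml; apply: eq_bigr => x _.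
  by rewrite map_mxZ RE -scalemxAr -scalemxAl.
exists U.
  move=> v; rewrite -[RHS]mul1mx -Rb mulmx_suml; apply: eq_bigr => x _.
  by rewrite -scalemxAl.
apply/lattice_characterP; exists r, cU => x.
have -> : lat_tr cU (gmod_act U x) = \tr (R x).
  by congr (\tr _); apply/matrixP => i j; rewrite mxE /= -colE mxE.
rewrite ffunE -[RHS]/(tofrac _) -trace_map_mx RE mxtrace_mulC mulmxA DA mul1mx.
by [].
Qed.

(** For the character of a lattice this is the trace formula for tensor products;
    every irreducible character is of this kind, and both sides are additive. *)
Lemma induced_character (PhiM : {ffun gT -> K} -> {ffun gT' -> K}) :
  induced_by_tensor B B' M PhiM ->
  forall psi, ZIrr B psi -> PhiM psi = kern bimod_kernel psi.
Proof.
move=> [[_ PhiMD] PhiM_tensor]; have [_ bb bC _] := block_idemP B.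
have PhiM0 : PhiM 0 = 0.
  by apply: (addrI (PhiM 0)); rewrite -PhiMD ?addr0 //; exact: ZIrr0.
apply: ZIrr_ind => [|chi chiI|phi psi phiZ psiZ phiE psiE].
- by rewrite PhiM0 raddf0.
- have [U Ub Uchi] := irreducible_lattice chiI.
  have [T [t tT t_eq] Tchi] := PhiM_tensor U chi Ub Uchi.
  have /lattice_characterP[rU [cU chiE]] := Uchi.
  have /lattice_characterP[rT [cT TE]] := Tchi.
  have bt m u : t (bimod_ract m B) u = t m u by have [_ ->] := bM m.
  apply/ffunP => x; rewrite ffunE TE; apply: (mulfI (card_neq0 gT K_char)).
  rewrite mulVKf ?card_neq0 // -(rmorph_nat (@tofrac O)) -rmorphM.
  rewrite (tensor_trace tT c cU bt bb bC cT (al := gmod_act M (x, 1%g)) (be := idfun)) //.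
  rewrite rmorph_sum; apply: eq_bigr => y _; rewrite rmorphM chiE; congr (tofrac _ * _).
  apply: lat_tr_eq => m /=; rewrite -gmod_actM.
  by congr (gmod_act M _ m); apply: injective_projections; rewrite /= ?mulg1 ?mul1g.
rewrite raddfB /= -phiE -psiE; apply/esym/(canLR (addrK (PhiM psi))).
by rewrite -PhiMD ?subrK //; exact: ZIrrB.
Qed.

(** The values are the traces on the fixed points of [gT'] in the tensor product over
    [K] of the dual of [M] with a module of the second group; [E] is the projection
    onto the fixed points. *)
Lemma dual_kernel_ZIrr psi : ZIrr B' psi -> ZIrr B (kern dual_kernel psi).
Proof.
move: psi; apply: ZIrr_ind => [|_ [m [rG [_ _ ->]]]|phi psi _ _ phiE psiE].
- by rewrite raddf0; exact: ZIrr0.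
- pose F z : 'M[K]_n := map_mx (@tofrac O) (rho c z).
  have FM z w : F (z * w)%g = F z *m F w by rewrite /F rhoM map_mxM.
  have pM (a a' : gT') (x x' : gT) : ((a, x) * (a', x'))%g = ((a * a')%g, (x * x')%g) by [].
  have F1 : F 1%g = 1%:M by rewrite /F rho1 map_mx1.
  have trF x y : \tr (F (x, y)) = bimod_kernel x y by rewrite trace_map_mx.
  pose rD y := tprod (F (1%g, y^-1%g))^T (1%:M : 'M[K]_m).
  have rD_repr : mx_repr [set: gT] rD.
    split=> [|x y _ _]; first by rewrite /rD invg1 F1 trmx1 tprod1.
    by rewrite /rD -tprodE mulmx1 -trmx_mul -FM pM ?mulg1 -invMg.
  pose E0 x := tprod (F (x^-1%g, 1%g))^T (rG x).
  pose E := #|gT'|%:R^-1 *: \sum_x E0 x.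
  have E0M x y : E0 x *m E0 y = E0 (x * y)%g.
    by rewrite /E0 -tprodE repr_setM -trmx_mul -FM pM ?mulg1 -invMg.
  have G0 := card_neq0 gT' K_char.
  have EE : E *m E = E.
    rewrite {1}/E -scalemxAl mulmx_suml (eq_bigr (fun=> E)) => [|x _].
      by rewrite sumr_const -scaler_nat scalerA mulVf ?scale1r.
    rewrite /E -scalemxAr mulmx_sumr; congr (_ *: _).
    by rewrite [RHS](reindex_inj (mulgI x)); apply: eq_bigr => y _; rewrite E0M.
  pose rDG := MxRepresentation rD_repr.
  have DE y : rDG y *m E = #|gT'|%:R^-1 *: \sum_x tprod (F (x^-1%g, y^-1%g))^T (rG x).
    rewrite /E -scalemxAr mulmx_sumr; congr (_ *: _); apply: eq_bigr => x _ /=.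
    by rewrite /rD /E0 -tprodE mul1mx -trmx_mul -FM pM ?mulg1 ?mul1g.
  have -> : kern dual_kernel [ffun x => \tr (rG x)] = [ffun y => \tr (rDG y *m E)].
    apply/ffunP => y; rewrite !ffunE DE mxtraceZ raddf_sum; congr (_ * _).
    by apply: eq_bigr => x _; rewrite ffunE /= mxtrace_prod mxtrace_tr trF.
  apply: idempotent_ZIrr => // [y|].
    rewrite DE /E -scalemxAl mulmx_suml; congr (_ *: _); apply: eq_bigr => x _ /=.
    by rewrite /rD /E0 -tprodE mulmx1 -trmx_mul -FM pM ?mulg1 ?mul1g.
  rewrite -[RHS]mul1mx; congr (_ *m _).
  transitivity (tprod (\sum_y tofrac (block_idem B y : O) *: F (1%g, y^-1%g))^T (1%:M : 'M[K]_m)).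
    have [L LE] := linear_pack (@tprod_linear K n n m m 1%:M).
    rewrite -LE !linear_sum; apply: eq_bigr => y _.
    by rewrite !linearZ /= LE.
  suff -> : \sum_y tofrac (block_idem B y : O) *: F (1%g, y^-1%g) = 1%:M.
    by rewrite trmx1 tprod1.
  rewrite -(map_mx1 (@tofrac O)) -(mat_id c).
  have -> : mat c c id = \sum_y (block_idem B y : O) *: rho c (1, y^-1)%g.
    apply: mat_sum => v; have [_ vB] := bM v; by rewrite -bimod_ract_sum vB.
  by rewrite map_mx_sum; apply: eq_bigr => y _; rewrite map_mxZ.
by rewrite raddfB; exact: ZIrrB.
Qed.

End BimoduleCharacter.

(** * Conjugation and the correspondence of characters *)

Lemma expg_pair (gT gT' : finGroupType) (x : gT) (y : gT') m :
  ((x, y) ^+ m = (x ^+ m, y ^+ m))%g.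
Proof. by elim: m => // m IHm; rewrite !expgS IHm. Qed.

Lemma card_expg (gT : finGroupType) N (x : gT) : (#|gT| %| N)%N -> (x ^+ N = 1)%g.
Proof.
move=> /dvdnP[m ->]; rewrite mulnC expgM -cardsT.
by rewrite (expg_cardG (finset.in_setT x)) expg1n.
Qed.

Definition p_singular (K : fieldType) p (gT : finGroupType) (f : {ffun gT -> K}) :=
  forall x : gT, (p^'.-elt x)%g -> f x = 0.

Lemma powf_singular (K : fieldType) p N t (gT : finGroupType) (f : {ffun gT -> K}) :
  (#|gT| %| N)%N -> (0 < N)%N -> t = 1 %[mod (N`_p^')%N] -> p_singular p (f - powf t f).
Proof.
move=> GN N_gt0 t1 x px; rewrite !ffunE.
have xN : (#[x]%g %| N`_p^')%N.
  rewrite -(part_pnat_id px); apply: partn_dvd => //; rewrite order_dvdn.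
  by rewrite (card_expg _ GN).
suff -> : (x ^+ t = x)%g by rewrite subrr.
apply/eqP; rewrite -[X in _ == X]expg1 eq_expg_mod_order; apply/eqP.
by rewrite -(modn_dvdm t xN) t1 modn_dvdm.
Qed.

Section Main.

Variables (p : nat) (O : idomainType) (k : fieldType) (res : {rmorphism O -> k}).
Hypotheses (p_pr : prime p) (O_dvr : complete_dvr O).
Hypothesis res_surj : forall y : k, exists x : O, res x = y.
Hypotheses (k_char : p \in [pchar k]) (K_char : [pchar {fraction O}] =i pred0).
Local Notation K := {fraction O}.
Variables (N : nat) (mu : K) (gT gT' : finGroupType).
Hypotheses (mu_prim : N.-primitive_root mu) (GN : (#|gT| %| N)%N) (GN' : (#|gT'| %| N)%N).
Variables (B : block O gT) (B' : block O gT') (M : gmod O (gT' * gT)%type).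
Hypothesis M_stable : stable_Morita B' B M.
Variables (n : nat) (c : coords M n).

Lemma order_pair_dvd (aT bT : finGroupType) (x : aT) (y : bT) :
  (#|aT| %| N)%N -> (#|bT| %| N)%N -> (#[(x, y)]%g %| N)%N.
Proof. by move=> aN bN; rewrite order_dvdn expg_pair !card_expg. Qed.

Lemma singular_pair (aT bT : finGroupType) (x : aT) (f : {ffun bT -> K}) y :
  p_singular p f -> f y != 0 -> (p %| #[(x, y)]%g)%N.
Proof.
move=> f_sing fy; have : ~~ (p^'.-elt y)%g by apply: contraNN fy => /f_sing ->.
rewrite /p_elt p'natE // negbK => py; apply: dvdn_trans py _; rewrite order_dvdn.
have /eqP := expg_order (x, y); rewrite expg_pair xpair_eqE.
by move=> /andP[_].
Qed.

Lemma block_kernelE (hT : finGroupType) (D : block O hT) m (cD : coords (block_bimod D) m) y y' :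
  block_kernel D y y' = tofrac (lat_tr cD (gmod_act (block_bimod D) (y, y'))).
Proof. by rewrite block_trace. Qed.

(** On functions that vanish on the elements of order prime to [p], the maps
    induced by [M] and by its dual are inverse to each other up to the block
    projections, since projective bimodules do not contribute. *)
Lemma dual_kernelK f : p_singular p f ->
  kern (dual_kernel c) (kern (bimod_kernel c) f) = kern (block_kernel B) f.
Proof.
move=> f_sing; apply: kern_comp => [|y' y fy]; first exact: card_neq0.
have [nB [cB]] := block_lattice O_dvr B.
rewrite (block_kernelE cB) -(rmorph_nat (@tofrac O)) -rmorphM.
rewrite (stable_trace_left p_pr O_dvr res_surj k_char mu_prim M_stable c cB).
- by rewrite rmorph_sum; apply: eq_bigr => x _; rewrite rmorphM.
- exact: singular_pair fy.
exact: order_pair_dvd.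
Qed.

Lemma bimod_kernelK f : p_singular p f ->
  kern (bimod_kernel c) (kern (dual_kernel c) f) = kern (block_kernel B') f.
Proof.
move=> f_sing; apply: kern_comp => [|x' x fx]; first exact: card_neq0.
have [nB [cB]] := block_lattice O_dvr B'.
rewrite (block_kernelE cB) -(rmorph_nat (@tofrac O)) -rmorphM.
rewrite (stable_trace_right p_pr O_dvr res_surj k_char mu_prim M_stable c cB).
- by rewrite rmorph_sum; apply: eq_bigr => y _; rewrite rmorphM.
- exact: singular_pair fx.
exact: order_pair_dvd.
Qed.

Variable t : nat.
Hypotheses (tN : coprime t N) (t1 : t = 1 %[mod (N`_p^')%N]).
Hypothesis M_rat : forall z : (gT' * gT)%type,
  lat_tr c (gmod_act M (z ^+ t)%g) = lat_tr c (gmod_act M z).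

Lemma coprime_card (hT : finGroupType) : (#|hT| %| N)%N -> coprime t #|hT|.
Proof. by move=> HN; apply: coprime_dvdr HN tN. Qed.

Lemma bimod_kern_powf f :
  kern (bimod_kernel c) (powf t f) = powf t (kern (bimod_kernel c) f).
Proof.
apply: kern_powf => [|x y]; first exact: coprime_card.
by rewrite /bimod_kernel -expg_pair M_rat.
Qed.

Lemma dual_kern_powf f :
  kern (dual_kernel c) (powf t f) = powf t (kern (dual_kernel c) f).
Proof.
apply: kern_powf => [|y x]; first exact: coprime_card.
by rewrite /dual_kernel /bimod_kernel -!expgVn -expg_pair M_rat.
Qed.

Lemma block_kern_powf (hT : finGroupType) (D : block O hT) f : (#|hT| %| N)%N ->
  kern (block_kernel D) (powf t f) = powf t (kern (block_kernel D) f).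
Proof.
move=> HN; have [m [cD]] := block_lattice O_dvr D.
apply: kern_powf => [|x y]; first exact: coprime_card.
rewrite !(block_kernelE cD) -expg_pair.
rewrite (block_trace_invariant p_pr O_dvr res_surj k_char mu_prim) //.
exact: order_pair_dvd.
Qed.

Lemma block_kern_id (hT : finGroupType) (D : block O hT) psi : ZIrr D psi ->
  kern (block_kernel D) psi = psi.
Proof. by have [_ _ DC _] := block_idemP D; exact: block_projection_id. Qed.

Let N_gt0 : (0 < N)%N := prim_order_gt0 mu_prim.

(** If the image of [psi] is fixed, then the difference [psi - powf t psi] is in the
    kernel of the operator of [M], which is injective on such differences. *)
Lemma kern_fixed psi : ZIrr B psi ->
  powf t psi = psi <-> powf t (kern (bimod_kernel c) psi) = kern (bimod_kernel c) psi.
Proof.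
move=> psiZ; split=> [psit|Fpsit]; first by rewrite -bimod_kern_powf psit.
have sing := powf_singular psi GN N_gt0 t1.
have := dual_kernelK sing; rewrite !raddfB /= bimod_kern_powf Fpsit subrr.
by rewrite block_kern_powf // block_kern_id // => /esym/eqP; rewrite subr_eq0 => /eqP.
Qed.

Variables (r : {rmorphism rat -> K}).

(** As conjugation preserves the positive definite scalar product, equality holds
    in the Cauchy-Schwarz inequality for [psi] and its conjugate. *)
Lemma powf_fixed_cdot (hT : finGroupType) (b : galg O hT) psi : (#|hT| %| N)%N ->
  ZIrr b psi -> cdot (psi - powf t psi) psi = 0 -> powf t psi = psi.
Proof.
move=> HN psiZ psi0; apply/esym/eqP; rewrite -subr_eq0; apply/eqP.
have psiq := ZIrr_cyclotomic r mu_prim (fun y => card_expg y HN) psiZ.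
apply: (cdot_definite mu_prim (fun y => card_expg y HN)).
  by apply: cyclotomic_funB psiq (cyclotomic_powf t psiq).
have psitt := cdot_powf psi psi (coprime_card HN).
rewrite cdotBl ![cdot _ (psi - _)]cdotC psi0 cdotBl psitt [cdot psi (powf t psi)]cdotC.
move: psi0; rewrite cdotBl => /eqP; rewrite subr_eq0 => /eqP ->.
by rewrite !subrr.
Qed.

(** On multiples of [psi - powf t psi] the isometry is the operator of [M], which
    commutes with conjugation. With [psi = chi] when the image of [chi] is fixed, and
    [psi] the image of [Phi chi] under the dual operator when [chi] is fixed, the
    isometry transports the orthogonality required by [powf_fixed_cdot]. *)
Lemma isometry_fixed (Phi : {ffun gT -> K} -> {ffun gT' -> K}) chi :
  ZIrr_isometry B B' Phi ->
  (forall psi, L0 p B psi -> Phi psi = kern (bimod_kernel c) psi) -> ZIrr B chi ->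
  powf t chi = chi <-> powf t (Phi chi) = Phi chi.
Proof.
move=> [[PhiZ PhiD] _ Phi_iso] Phi_L0 chiZ; set eta := Phi chi.
have [_ BB BC _] := block_idemP B.
have etaZ : ZIrr B' eta by exact: PhiZ.
have [bM _ _ _ _] := M_stable.
have L0_multiple psi : ZIrr B psi ->
    exists2 m, (0 < m)%N & L0 p B ((psi - powf t psi) *+ m).
  move=> psiZ; have [m m_gt0 mZ] := conjugate_multiple K_char r mu_prim
    (fun y => card_expg y GN) tN psiZ.
  exists m => //; split.
    rewrite mulrnBl; apply: ZIrrB; first exact: ZIrrMn.
    have := block_projection_ZIrr K_char BB BC mZ; rewrite raddfMn /=.
    by rewrite block_kern_powf // block_kern_id.
  move=> x px; have := powf_singular psi GN N_gt0 t1 px; move: (psi - _) => f fx.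
  by elim: (m) => [|d IHd]; rewrite ?mulr0n ?ffunE // !mulrS ffunE IHd fx addr0.
have natK m : (0 < m)%N -> m%:R != 0 :> K by move: K_char => /pcharf0P ->; rewrite -lt0n.
have cdot0 m (hT : finGroupType) (f g : {ffun hT -> K}) :
    (0 < m)%N -> cdot (f *+ m) g = 0 -> cdot f g = 0.
  move=> m_gt0; rewrite cdotMnl -mulr_natl => /eqP.
  by rewrite mulf_eq0 (negbTE (natK _ m_gt0)) => /eqP.
split=> [chit|etat].
  apply: (powf_fixed_cdot GN' etaZ).
  have xiZ := dual_kernel_ZIrr K_char c bM etaZ; set xi := kern _ eta in xiZ.
  have [m m_gt0 dL0] := L0_multiple xi xiZ; have [dZ _] := dL0.
  apply: (cdot0 m) => //.
  have -> : (eta - powf t eta) *+ m = Phi ((xi - powf t xi) *+ m).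
    rewrite Phi_L0 // raddfMn /= /xi -dual_kern_powf -raddfB bimod_kernelK.
      by rewrite raddfB /= block_kern_powf // block_kern_id.
    exact: (powf_singular eta GN' N_gt0 t1).
  rewrite Phi_iso // cdotMnl cdotBl -[in X in _ - X]chit cdot_powf ?subrr ?mul0rn //.
  exact: coprime_card.
apply: (powf_fixed_cdot GN chiZ).
have [m m_gt0 dL0] := L0_multiple chi chiZ; have [dZ _] := dL0.
apply: (cdot0 m) => //; rewrite -Phi_iso // Phi_L0 // raddfMn raddfB /= bimod_kern_powf.
rewrite cdotMnl cdotBl -/eta -[in X in _ - X]etat cdot_powf ?subrr ?mul0rn //.
exact: coprime_card.
Qed.

End Main.

Lemma conductor_part_eq (K : fieldType) (r : {rmorphism rat -> K}) p N (mu : K)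
    (gT gT' : finGroupType) (f : {ffun gT -> K}) (g : {ffun gT' -> K}) :
  prime p -> N.-primitive_root mu -> cyclotomic_fun r mu f -> cyclotomic_fun r mu g ->
  (forall t, coprime t N -> t = 1 %[mod (N`_p^')%N] -> powf t f = f <-> powf t g = g) ->
  ((char_conductor g)`_p = (char_conductor f)`_p)%N.
Proof.
move=> p_pr muP fq gq fg.
have valq (hT : finGroupType) (h : {ffun hT -> K}) : cyclotomic_fun r mu h ->
    forall s, range h s -> exists q, s = evq r q mu.
  by move=> hq s [y _ <-]; have [q qE] := hq y; exists q; rewrite -[y]expg1 qE expr1.
apply/eqP; rewrite eqn_leq; apply/andP; split.
  apply: (leq_conductor_part p_pr muP (valq _ _ fq) (valq _ _ gq)) => t tN t1.
  by move=> /(powf_fixed muP tN fq)/(fg t tN t1)/(powf_fixed muP tN gq).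
apply: (leq_conductor_part p_pr muP (valq _ _ gq) (valq _ _ fq)) => t tN t1.
by move=> /(powf_fixed muP tN gq)/(fg t tN t1)/(powf_fixed muP tN fq).
Qed.

Theorem theorem1p5
    (p : nat) (O : idomainType) (k : fieldType) (res : {rmorphism O -> k})
    (p_prime : prime p)
    (O_dvr : complete_dvr O)
    (res_surj : forall y : k, exists x : O, res x = y)
    (k_char : p \in [pchar k])
    (K_char : [pchar {fraction O}] =i pred0)
    (gT gT' : finGroupType) (B : block O gT) (B' : block O gT')
    (K_root : exists (n : nat) (z : {fraction O}),
        [/\ n.-primitive_root z, (#|gT| %| n)%N & (#|gT'| %| n)%N])
    (M : gmod O (gT' * gT)%type)
    (M_indec : indecomposable M)
    (M_stable : stable_Morita B' B M)
    (P : {group gT' * gT}) (V : gmod O (subg_of P))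
    (V_source : is_source M V)
    (V_endo : endopermutation p V)
    (V_int : forall chi, lattice_character V chi ->
        forall x, exists z : int, chi x = z%:~R)
    (PhiM : {ffun gT -> {fraction O}} -> {ffun gT' -> {fraction O}})
    (PhiM_tensor : induced_by_tensor B B' M PhiM) :
  (forall psi, ZIrr B psi ->
     ((char_conductor (PhiM psi))`_p = (char_conductor psi)`_p)%N) /\
  (forall Phi : {ffun gT -> {fraction O}} -> {ffun gT' -> {fraction O}},
     ZIrr_isometry B B' Phi ->
     (forall psi, L0 p B psi -> Phi psi = PhiM psi) ->
     forall chi, Irr B chi ->
       ((char_conductor (Phi chi))`_p = (char_conductor chi)`_p)%N).
Proof.
have [N [mu [muP GN GN']]] := K_root.
have [r _] := ratr_rmorphism K_char.
have [_ _ [I V_ind M_sum]] := V_source.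
have [n [c]] := source_lattice O_dvr V_ind M_sum V_endo.
have M_rat t : coprime t N -> t = 1 %[mod (N`_p^')%N] -> forall z : (gT' * gT)%type,
    lat_tr c (gmod_act M (z ^+ t)%g) = lat_tr c (gmod_act M z).
  move=> tN t1 [x y]; apply: (source_trace_invariant p_prime O_dvr res_surj k_char K_char
    muP V_ind M_sum V_endo V_int tN t1).
  exact: order_pair_dvd.
have [bM _ _ _ _] := M_stable.
have FE := induced_character O_dvr K_char c bM PhiM_tensor.
have psiq psi : ZIrr B psi -> cyclotomic_fun r mu psi.
  by apply: (ZIrr_cyclotomic r muP) => y; exact: card_expg GN.
have psi'q psi : ZIrr B' psi -> cyclotomic_fun r mu psi.
  by apply: (ZIrr_cyclotomic r muP) => y; exact: card_expg GN'.
have [[PhiMZ _] _] := PhiM_tensor.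
split=> [psi psiZ|Phi Phi_isom Phi_L0 chi /Irr_ZIrr chiZ].
  apply: (conductor_part_eq p_prime muP (psiq _ psiZ) (psi'q _ (PhiMZ _ psiZ))) => t tN t1.
  rewrite FE //.
  exact: (kern_fixed p_prime O_dvr res_surj k_char K_char muP GN M_stable tN t1 (M_rat t tN t1) psiZ).
have [[PhiZ _] _ _] := Phi_isom.
apply: (conductor_part_eq p_prime muP (psiq _ chiZ) (psi'q _ (PhiZ _ chiZ))) => t tN t1.
apply: (isometry_fixed p_prime O_dvr res_surj k_char K_char muP GN GN' M_stable tN t1
  (M_rat t tN t1) r Phi_isom _ chiZ) => psi psiL0.
by rewrite Phi_L0 // FE //; case: psiL0.
Qed.
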